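(* Let $t$ be a positive integer with $t \geq 2$. Let $X$ be a graph with $\operatorname{rtd}_2(X) \leq t$. There exists an integer $\bar{c}(t,X)$ such that for every integer $k$, for every graph $G$ with $\operatorname{tw}(G)<k$, for every family $\mathcal{F}$ of connected subgraphs of $G$, if $G$ has no $\mathcal{F}$-rich model of $X$, then there exists $S \subseteq V(G)$ such that (A) $V(F) \cap S \neq \emptyset$ for every $F \in \mathcal{F}$; (B) for every component $C$ of $G-S$, $N_G(V(C))$ intersects at most two components of $G-V(C)$; (C) $\operatorname{wcol}_r(G,S) \leq \bar{c}(t,X)k \cdot r^{t-2} \log r$ for every integer $r$ with $r \geq 2$.
   Context: For a graph $G$, $S\subseteq V(G)$, an ordering $\sigma$ of $S$, $u\in V(G)$ and $v\in S$, $v$ is weakly $r$-reachable from $u$ in $(G,S,\sigma)$ if there is a $u$–$v$ path $P$ in $G$ of length at most $r$ with $\min_\sigma(V(P)\cap S)=v$; $\operatorname{wcol}_r(G,S)$ is the minimum over orderings $\sigma$ of $S$ of the maximum over $u\in V(G)$ of the number of such $v$. A model of $H$ in $G$ is a family $(B_x\mid x\in V(H))$ of disjoint vertex sets with each $G[B_x]$ connected and an edge between $B_x,B_y$ for each $xy\in E(H)$; it is $\mathcal{F}$-rich if each $G[B_x]$ contains some $F\in\mathcal{F}$. $\operatorname{tw}$ is treewidth. The rooted $2$-treedepth $\operatorname{rtd}_2(G)$ is $0$ for the null graph, $1$ for a one-vertex graph, and otherwise the minimum of $\max\{\operatorname{rtd}_2(A),\operatorname{rtd}_2(B\setminus V(A))+|V(A)\cap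 V(B)|\}$ over all separations $(A,B)$ of $G$ of order at most one (i.e. $A\cup B=G$, $E(A\cap B)=\emptyset$, $|V(A\cap B)|\leq1$) with $V(A)\neq\emptyset$ and $V(B)\setminus V(A)\neq\emptyset$. *)

(* Defs.v *)
From HB Require Import structures.
From mathcomp Require Import all_boot all_order all_algebra.
From mathcomp Require Import boolp reals exp.

Set Implicit Arguments.
Unset Strict Implicit.
Unset Printing Implicit Defensive.

(* A finite simple graph is a pair (V, E) where V is a finite set of points of
   an ambient finite type and E is a set of 2-element subsets of V.  Graphs on
   the same ambient type can be compared, united and intersected componentwise,
   so subgraphs, components and separations are again graphs. *)
Definition is_graph (T : finType) (VE : {set T} * {set {set T}}) : bool :=
  [forall e in VE.2, (#|e| == 2) && (e \subset VE.1)].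

Record graph (T : finType) :=
  Graph { graph_val : {set T} * {set {set T}}; graphP : is_graph graph_val }.

HB.instance Definition _ T := [isSub for @graph_val T].
HB.instance Definition _ T := [Finite of graph T by <:].

Section Graphs.
Variable T : finType.
Implicit Types (G H A B C D F : graph T) (U S : {set T}).

Definition vset G : {set T} := (graph_val G).1.
Definition eset G : {set {set T}} := (graph_val G).2.

Definition adj G : rel T := fun x y => [set x; y] \in eset G.

Definition subgraph H G := (vset H \subset vset G) && (eset H \subset eset G).

Fact induced_subproof G U :
  is_graph (vset G :&: U, [set e in eset G | e \subset U]).
Proof.
apply/forall_inP => e /=; rewrite inE => /andP[eG eU].
by have /forall_inP/(_ e eG)/andP[-> eV] := graphP G; rewrite subsetI eV.
Qed.

Definition induced G U : graph T := Graph (induced_subproof G U).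

Definition delete G U : graph T := induced G (~: U).

Definition nbhd G U : {set T} :=
  [set v in vset G :\: U | [exists u in U, adj G u v]].

(* The null graph is not connected. *)
Definition connected G : bool :=
  (vset G != set0) &&
  [forall x in vset G, forall y in vset G, connect (adj G) x y].

Definition components G : {set graph T} :=
  [set C | [&& subgraph C G, connected C &
    [forall D, [&& subgraph C D, subgraph D G & connected D] ==> (D == C)]]].

Definition tree G : Prop :=
  connected G /\ forall c : seq T, 2 < size c -> ~ ucycle (adj G) c.

(* p lists the vertices following u on a path, so size p is its length. *)
Definition is_path G (u v : T) (p : seq T) : bool :=
  [&& u \in vset G, path (adj G) u p, uniq (u :: p) & last u p == v].

(* An ordering of S is a duplicate-free enumeration of S, in increasing order. *)
Definition ordering S (s : seq T) : bool := perm_eq s (enum S).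

Definition is_min S (s : seq T) (W : seq T) (v : T) : Prop :=
  [/\ v \in W, v \in S &
      forall w, w \in W -> w \in S -> index v s <= index w s].

Definition weakly_reachable (r : nat) G S (s : seq T) (u v : T) : Prop :=
  v \in S /\
  exists p : seq T, [/\ is_path G u v p, size p <= r & is_min S s (u :: p) v].

Definition wcol_ord (r : nat) G S (s : seq T) : nat :=
  \max_(u in vset G) #|[set v | `[< weakly_reachable r G S s u v >]]|.

Definition wcol (r : nat) G S : nat :=
  wcol_ord r G S
    [arg min_(s < enum_tuple S | ordering S s) wcol_ord r G S s].

Definition rtd2_separation A B G : bool :=
  [&& vset A :|: vset B == vset G, eset A :|: eset B == eset G,
      eset A :&: eset B == set0, #|vset A :&: vset B| <= 1,
      vset A != set0 & vset B :\: vset A != set0].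

(* The first argument bounds the recursion depth: A and B - V(A) have fewer
   vertices than G.  The default value #|vset G| of the iterated minimum does not
   affect it: when G has at least two vertices some separation achieves a value
   at most #|vset G|; see rtd2_le and rtd2_attained. *)
Fixpoint rtd2_rec (n : nat) G : nat :=
  if n is m.+1 then
    if #|vset G| <= 1 then #|vset G| else
    \big[minn/#|vset G|]_(AB : graph T * graph T | rtd2_separation AB.1 AB.2 G)
      maxn (rtd2_rec m AB.1)
           (rtd2_rec m (delete AB.2 (vset AB.1)) + #|vset AB.1 :&: vset AB.2|)
  else 0.

Definition rtd2 G : nat := rtd2_rec #|vset G| G.

Definition rtd2_value A B : nat :=
  maxn (rtd2 A) (rtd2 (delete B (vset A)) + #|vset A :&: vset B|).

Lemma vset_induced G U : vset (induced G U) = vset G :&: U. Proof. by []. Qed.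

Lemma vset_delete G U : vset (delete G U) = vset G :\: U.
Proof. by rewrite setDE. Qed.

Lemma rtd2_separation_ltl A B G :
  rtd2_separation A B G -> #|vset A| < #|vset G|.
Proof.
case/andP=> /eqP<- /and5P[_ _ _ _ /set0Pn[x /setDP[xB xA]]].
apply/proper_card/properP; split; first exact: subsetUl.
by exists x; rewrite ?inE ?xB ?orbT.
Qed.

Lemma rtd2_separation_ltr A B G :
  rtd2_separation A B G -> #|vset (delete B (vset A))| < #|vset G|.
Proof.
case/andP=> /eqP<- /and5P[_ _ _ /set0Pn[x xA] _]; rewrite vset_delete.
apply/proper_card/properP; split; last by exists x; rewrite !inE xA.
exact: subset_trans (subsetDl _ _) (subsetUr _ _).
Qed.

Lemma rtd2_recE n G : #|vset G| <= n -> rtd2_rec n G = rtd2 G.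
Proof.
suff indep k : forall m n' G', k = #|vset G'| -> k <= m -> k <= n' ->
    rtd2_rec m G' = rtd2_rec n' G' by move=> le_Gn; apply: (indep _ n #|vset G|).
elim/ltn_ind: k => k IH m n' {}G' kE; case: m => [|m]; case: n' => [|n'] //=.
- by rewrite leqn0 -kE => /eqP->.
- by rewrite leqn0 -kE => _ /eqP->.
move=> km kn; case: ifP => // _; apply: eq_bigr => -[A B] /= sepAB.
have ltA := rtd2_separation_ltl sepAB; have ltB := rtd2_separation_ltr sepAB.
rewrite -kE in ltA ltB; congr (maxn _ (_ + _)); apply: IH; try reflexivity;
  by rewrite // -ltnS; apply: leq_trans kn || apply: leq_trans km.
Qed.

Lemma rtd2_small G : #|vset G| <= 1 -> rtd2 G = #|vset G|.
Proof. by move=> G1; rewrite -(rtd2_recE (leqnSn _)) /= G1. Qed.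

Lemma rtd2E G : 1 < #|vset G| ->
  rtd2 G = \big[minn/#|vset G|]_(AB : graph T * graph T |
             rtd2_separation AB.1 AB.2 G) rtd2_value AB.1 AB.2.
Proof.
rewrite ltnNge => /negPf G1; rewrite -(rtd2_recE (leqnSn _)) /= G1.
apply: eq_bigr => -[A B] /= sepAB.
have ltA := rtd2_separation_ltl sepAB; have ltB := rtd2_separation_ltr sepAB.
by rewrite /rtd2_value !rtd2_recE // ltnW.
Qed.

Lemma rtd2_le A B G : 1 < #|vset G| -> rtd2_separation A B G ->
  rtd2 G <= rtd2_value A B.
Proof.
move=> G1 sepAB; rewrite (rtd2E G1) -Order.NatOrder.minEnat -Order.NatOrder.leEnat.
exact: (Order.TotalTheory.bigmin_le_cond _ _ (j := (A, B))).
Qed.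

Fact point_subproof (x : T) : is_graph ([set x], set0).
Proof. by apply/forall_inP => e; rewrite inE. Qed.

Lemma rtd2_separation_point G x : 1 < #|vset G| -> x \in vset G ->
  rtd2_separation (Graph (point_subproof x)) G G.
Proof.
move=> G1 xG; rewrite /rtd2_separation /vset /eset /= -/(vset G).
rewrite (setUidPr _) ?sub1set // set0U set0I !eqxx (setIidPl _) ?sub1set //.
rewrite cards1 -!card_gt0 cards1 cardsD (setIidPr _) ?sub1set // cards1.
by rewrite subn_gt0 G1.
Qed.

Lemma rtd2_le_card G : rtd2 G <= #|vset G|.
Proof.
have [G1|G1] := leqP #|vset G| 1; first by rewrite rtd2_small.
rewrite (rtd2E G1) -Order.NatOrder.minEnat -Order.NatOrder.leEnat.
exact: Order.TotalTheory.bigmin_le_id.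
Qed.

Lemma rtd2_attained G : 1 < #|vset G| ->
  exists2 AB : graph T * graph T,
    rtd2_separation AB.1 AB.2 G & rtd2 G = rtd2_value AB.1 AB.2.
Proof.
move=> G1; have [x xG] : exists x, x \in vset G by apply/card_gt0P; rewrite ltnW.
have sepx := rtd2_separation_point G1 xG; set K := Graph _ in sepx.
have K1 : #|vset K| = 1 by rewrite /vset cards1.
have leK : rtd2_value K G <= #|vset G|.
  rewrite /rtd2_value geq_max rtd2_small K1 // ltnW //=.
  apply: leq_trans (leq_add (rtd2_le_card _) (leqnn _)) _.
  by rewrite vset_delete [vset K :&: _]setIC addnC cardsID.
have : rtd2 G = #|vset G| \/ exists2 AB : graph T * graph T,
    rtd2_separation AB.1 AB.2 G & rtd2 G = rtd2_value AB.1 AB.2.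
  rewrite (rtd2E G1); elim/big_ind: _ => [|m n Hm Hn|AB sepAB]; first by left.
    by rewrite /minn; case: ifP.
  by right; exists AB.
case=> // GE; exists (K, G) => //=; apply/eqP.
by rewrite eqn_leq (rtd2_le G1 sepx) GE leK.
Qed.
End Graphs.

Section TreewidthModels.
Variable T : finType.
Implicit Types G F : graph T.

(* connected includes nonemptiness, so the last clause also says that every
   vertex lies in a bag. *)
Definition tree_decomposition (W : finType) (D : graph W) G
    (B : W -> {set T}) : Prop :=
  [/\ tree D,
      forall x, x \in vset D -> B x \subset vset G,
      forall e, e \in eset G -> exists2 x, x \in vset D & e \subset B x &
      forall v, v \in vset G -> connected (induced D [set x | v \in B x])].

Definition max_bag (W : finType) (D : graph W) (B : W -> {set T}) : nat :=
  \max_(x in vset D) #|B x|.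

Fact tree_decomposition_exists G :
  exists n, `[< exists (W : finType) (D : graph W) (B : W -> {set T}),
                  tree_decomposition D G B /\ max_bag D B = n >].
Proof.
set D := Graph (point_subproof tt); set B := fun _ : unit => vset G.
exists (max_bag D B); apply/asboolP; exists unit, D, B; split=> //; split.
- split=> [|c c2 /andP[_ /card_uniqP c1]].
    apply/andP; split; first by apply/set0Pn; exists tt; rewrite inE.
    by apply/forall_inP => -[] _; apply/forall_inP => -[] _; exact: connect0.
  by have := max_card (mem c); rewrite c1 card_unit leqNgt (ltn_trans _ c2).
- by [].
- move=> e eG; exists tt; first by rewrite inE.
  by have /forall_inP/(_ e eG)/andP[] := graphP G.
move=> v vG; apply/andP; split; first by apply/set0Pn; exists tt; rewrite !inE.
by apply/forall_inP => -[] _; apply/forall_inP => -[] _; exact: connect0.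
Qed.

(* With this convention the null graph has treewidth -1. *)
Definition tw G : int := (Posz (ex_minn (tree_decomposition_exists G)) - 1)%R.

Definition model (U : finType) (X : graph U) G (B : U -> {set T}) : Prop :=
  [/\ forall x, x \in vset X ->
        B x \subset vset G /\ connected (induced G (B x)),
      forall x y, x \in vset X -> y \in vset X -> x != y ->
        [disjoint B x & B y] &
      forall x y, adj X x y ->
        exists u v, [/\ u \in B x, v \in B y & adj G u v]].

Definition rich_model (FF : {set graph T}) (U : finType) (X : graph U) G
    (B : U -> {set T}) : Prop :=
  model X G B /\
  forall x, x \in vset X -> exists2 F, F \in FF & subgraph F (induced G (B x)).
End TreewidthModels.

Definition log2 (R : realType) (x : R) : R := (ln x / ln 2)%R.

(* Main.v *)
(* Call a graph P nice for g if excluding an F-rich model of P forces a hitting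
   set S satisfying (B) with wcol_r(G, S) = O(k g(r)).  A graph of rooted
   2-treedepth at most t embeds in a tree-like graph X(h, d, P), where P has
   rooted 2-treedepth at most t - 1: a root is joined to d copies of P, every
   vertex of which is the root of X(h - 1, d, P).  Induction on h, with the family
   of the connected sets that contain a rich model of X(h, d', P), reduces X(h, d, P)
   to apex graphs, that is, to P with a dominating vertex added.

   To exclude the apex graph of P, hit within a connected piece C of G the
   connected subgraphs that touch a component of G - C and contain a member of F:
   these have no rich model of P, because that component would serve as the apex.
   Iterating on the components that remain gives levels, of which a path of length
   r meets at most r + 1: hence one more factor r.  If P is edgeless, the levels
   have size O(k) and form a path-like structure; ordering them by the 2-adic
   valuation of their index gives O(k log r).

   Condition (B) is restored after each combination at the cost of O(k) vertices.
   Given a connected X whose complement has boundedly many components, the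
   connected subsets of X that lie in no connected subset of X with at most two
   complementary components have bounded packing number, so by the Erdos-Posa
   property they have a hitting set of size O(k), and a smallest one works. *)
Require Import Defs.
From mathcomp Require Import all_boot all_order all_algebra.
From mathcomp Require Import boolp reals exp zify.

Set Implicit Arguments.
Unset Strict Implicit.
Unset Printing Implicit Defensive.

(** * Connected sets and components *)

(** The argument runs on vertex sets under a fixed symmetric relation [e]; the ambient set [V]
    shrinks to components, so no change of graph or type is needed. Condition (B) is kept as a bound
    on all components of [V :\: C] for connected [V], where each of them contains a neighbour of
    [C]. The number two makes the apex step affordable: the outside of a piece offers at most two
    candidate apices, hence two uses of the smaller pattern per level. A solution found inside a
    component controls complements only relative to that component; without a repair after each
    round, the number of candidates, and with it the constant, would grow with the depth of the
    recursion. The bound stays linear in [k] because the sets chosen in successive rounds are ranked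
    one after the other, so their costs add. The exponent [t - 2] counts the apex steps above stars;
    the passage from apex graphs to trees changes only constants. *)

Section Connectivity.
Variables (T : finType) (e : rel T).
Hypothesis eS : symmetric e.
Implicit Types (A B C V X Y Z : {set T}) (x y z : T).

Definition erel A x y := [&& x \in A, y \in A & e x y].

(* The empty set is connected here, unlike in [Defs.connected]. *)
Definition conn A := [forall x in A, forall y in A, connect (erel A) x y].

Definition cmp A x := [set y in A | connect (erel A) x y].

Definition comps A := [set cmp A x | x in A].

Definition ncomp A := #|comps A|.

Definition touch A B := [exists x in A, exists y in B, e x y].

Lemma touchP A B :
  reflect (exists x y, [/\ x \in A, y \in B & e x y]) (touch A B).
Proof.
apply: (iffP idP) => [/exists_inP[x xA /exists_inP[y yB exy]]|[x [y [xA yB exy]]]].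
  by exists x, y.
by apply/exists_inP; exists x => //; apply/exists_inP; exists y.
Qed.

Lemma touchC A B : touch A B = touch B A.
Proof. by apply/touchP/touchP => -[x [y [xA yB exy]]]; exists y, x; split => //; rewrite eS. Qed.

Lemma touchS A B A' B' : A \subset A' -> B \subset B' -> touch A B -> touch A' B'.
Proof.
move=> /subsetP sA /subsetP sB /touchP[x [y [xA yB exy]]].
by apply/touchP; exists x, y; split; auto.
Qed.

Lemma erel_sym A : connect_sym (erel A).
Proof. by apply: sym_connect_sym => x y; rewrite /erel eS andbCA. Qed.

Lemma connP A :
  reflect (forall x y, x \in A -> y \in A -> connect (erel A) x y) (conn A).
Proof.
apply: (iffP idP) => [/forall_inP H x y xA yA|H].
  by have /forall_inP := H x xA; apply.
by apply/forall_inP => x xA; apply/forall_inP => y yA; apply: H.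
Qed.

Lemma connectS A B x y :
  A \subset B -> connect (erel A) x y -> connect (erel B) x y.
Proof.
move=> /subsetP sAB; apply: connect_sub => u v /and3P[uA vA euv].
by apply: connect1; rewrite /erel !sAB.
Qed.

Lemma conn_from a A :
  a \in A -> (forall y, y \in A -> connect (erel A) a y) -> conn A.
Proof.
move=> aA H; apply/connP => x y xA yA.
by apply: connect_trans (H y yA); rewrite erel_sym H.
Qed.

Lemma conn0 : conn set0.
Proof. by apply/connP => x y; rewrite inE. Qed.

Lemma conn1 x : conn [set x].
Proof. by apply/connP => u v /set1P-> /set1P->. Qed.

Lemma erel_path_sub A x p : path (erel A) x p -> {subset p <= A}.
Proof.
elim: p x => //= y p IH x /andP[/and3P[_ yA _] /IH sp] z.
by rewrite inE => /orP[/eqP->|/sp].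
Qed.

Lemma connU_touch A B : touch A B -> conn A -> conn B -> conn (A :|: B).
Proof.
case/touchP=> x [y [xA yB exy]] /connP cA /connP cB.
apply: (@conn_from x); first by rewrite inE xA.
move=> z /setUP[zA|zB]; first exact: connectS (subsetUl _ _) (cA _ _ xA zA).
apply: connect_trans (connectS (subsetUr _ _) (cB _ _ yB zB)).
by apply: connect1; rewrite /erel !inE xA yB orbT.
Qed.

Lemma conn_bigcup (I : finType) (P : pred I) (F : I -> {set T}) A :
  conn A -> (forall i, P i -> conn (F i) /\ touch A (F i)) ->
  conn (A :|: \bigcup_(i | P i) F i).
Proof.
move=> cA cF; have [A0|[a aA]] := set_0Vmem A.
  rewrite {}A0 in cA cF *; rewrite set0U big1 ?conn0 // => i Pi.
  by have [_ /touchP[x [y []]]] := cF i Pi; rewrite inE.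
apply: (@conn_from a); first by rewrite inE aA.
move=> y /setUP[yA|/bigcupP[i Pi yi]].
  by apply: connectS (subsetUl _ _) _; move/connP: cA; apply.
have [cFi tFi] := cF i Pi.
apply: (@connectS (A :|: F i)); first by rewrite setUS // (bigcup_sup i).
have /connP := connU_touch tFi cA cFi.
by apply; rewrite !inE ?aA // yi orbT.
Qed.

Lemma comp_sub A x : cmp A x \subset A.
Proof. by apply/subsetP => y; rewrite inE => /andP[]. Qed.

Lemma comp_refl A x : x \in A -> x \in cmp A x.
Proof. by rewrite inE => ->; exact: connect0. Qed.

Lemma connect_comp A x y : x \in A -> connect (erel A) x y -> connect (erel (cmp A x)) x y.
Proof.
move=> xA /connectP[p pp ->]; apply/connectP; exists p => //.
suff aux q u : path (erel A) u q -> u \in cmp A x -> path (erel (cmp A x)) u q.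
  by apply: aux => //; exact: comp_refl.
elim: q u => //= z q IH u /andP[/and3P[uA zA euz] pq] ux.
have zx : z \in cmp A x.
  move: ux; rewrite !inE zA => /andP[_ xu] /=.
  by apply: connect_trans xu _; apply: connect1; rewrite /erel uA zA.
by rewrite {1}/erel ux zx euz /=; exact: IH.
Qed.

Lemma comp_conn A x : conn (cmp A x).
Proof.
have [xA|xA] := boolP (x \in A).
  apply: (@conn_from x); first exact: comp_refl.
  by move=> y; rewrite inE => /andP[_ /connect_comp]; apply.
apply/connP => u v; rewrite inE => /andP[uA /connectP[[|z p] /= H E]].
  by rewrite -E uA in xA.
by case/andP: H => /and3P[]; rewrite (negPf xA).
Qed.

Lemma conn_sub_comp A B x : conn B -> B \subset A -> x \in B -> B \subset cmp A x.
Proof.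
move=> /connP cB sBA xB; apply/subsetP => y yB.
by rewrite inE (subsetP sBA) //= (connectS sBA) // cB.
Qed.

Lemma comp_eq A x y : x \in A -> y \in cmp A x -> cmp A x = cmp A y.
Proof.
move=> xA; rewrite inE => /andP[yA cxy]; apply/setP => z; rewrite !inE.
by rewrite (same_connect (@erel_sym A) cxy).
Qed.

Lemma compsP A C : reflect (exists2 x, x \in A & C = cmp A x) (C \in comps A).
Proof. exact: imsetP. Qed.

Lemma mem_comps A x : x \in A -> cmp A x \in comps A.
Proof. exact: imset_f. Qed.

Lemma comps_sub A C : C \in comps A -> C \subset A.
Proof. by case/compsP=> x _ ->; exact: comp_sub. Qed.

Lemma comps_conn A C : C \in comps A -> conn C.
Proof. by case/compsP=> x _ ->; exact: comp_conn. Qed.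

Lemma comps_neq0 A C : C \in comps A -> C != set0.
Proof. by case/compsP=> x xA ->; apply/set0Pn; exists x; exact: comp_refl. Qed.

Lemma comps_comp A C x : C \in comps A -> x \in C -> C = cmp A x.
Proof. by case/compsP=> y yA -> xy; exact: comp_eq. Qed.

Lemma comps_max A C B x :
  C \in comps A -> conn B -> B \subset A -> x \in B -> x \in C -> B \subset C.
Proof.
by move=> CA cB sB xB xC; rewrite (comps_comp CA xC); exact: conn_sub_comp.
Qed.

Lemma comps_eq A C C' x :
  C \in comps A -> C' \in comps A -> x \in C -> x \in C' -> C = C'.
Proof.
by move=> CA C'A xC xC'; rewrite (comps_comp CA xC) (comps_comp C'A xC').
Qed.

Lemma comps_disj A C C' :
  C \in comps A -> C' \in comps A -> C != C' -> [disjoint C & C'].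
Proof.
move=> CA C'A; apply: contra_neqT => /pred0Pn[x /andP[/= xC xC']].
exact: (comps_eq CA C'A xC xC').
Qed.

Lemma comps_nbr A C x y :
  C \in comps A -> x \in C -> y \in A -> e x y -> y \in C.
Proof.
move=> CA xC yA exy; rewrite (comps_comp CA xC).
have xA := subsetP (comps_sub CA) x xC.
by rewrite inE yA connect1 // /erel xA yA.
Qed.

Lemma conn_comps A C : C \subset A -> C != set0 -> conn C ->
  (forall x y, x \in C -> y \in A -> e x y -> y \in C) -> C \in comps A.
Proof.
move=> sCA /set0Pn[x xC] cC clC; apply/compsP.
exists x; first exact: (subsetP sCA).
apply/eqP; rewrite eqEsubset conn_sub_comp //=.
apply/subsetP => y; rewrite inE => /andP[_ /connectP[p pp ->]].
elim: p x xC pp => //= z p IH x xC /andP[/and3P[_ zA exz] pp].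
by apply: IH pp; exact: clC exz.
Qed.

Lemma comps_full A : A != set0 -> conn A -> comps A = [set A].
Proof.
move=> A0 cA; have AA : A \in comps A by apply: conn_comps => //.
apply/setP => C; rewrite inE; apply/idP/eqP => [CA|->//].
have /set0Pn[x xC] := comps_neq0 CA.
by apply: (comps_eq CA AA xC); exact: (subsetP (comps_sub CA)).
Qed.

Lemma comps0 : comps set0 = set0.
Proof. by rewrite /comps imset0. Qed.

Lemma ncomp_conn A : conn A -> ncomp A <= 1.
Proof.
have [->|A0] := eqVneq A set0; first by rewrite /ncomp comps0 cards0.
by move=> cA; rewrite /ncomp comps_full // cards1.
Qed.

Lemma conn_ncomp A : ncomp A <= 1 -> conn A.
Proof.
move=> n1; apply/connP => x y xA yA.
have Cx := mem_comps xA; have Cy := mem_comps yA.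
have E : cmp A x = cmp A y by apply: (card_le1_eqP n1).
by have := comp_refl yA; rewrite -E inE yA.
Qed.

Lemma conn_cross V A : conn V -> A \subset V -> A != set0 -> A != V ->
  touch A (V :\: A).
Proof.
move=> cV sAV /set0Pn[a aA] nAV.
have [y yV yA] : exists2 y, y \in V & y \notin A.
  apply/subsetPn; apply: contra nAV => sVA.
  by rewrite eqEsubset sAV.
have /connectP[p pp E] := connP _ cV a y (subsetP sAV a aA) yV.
elim: p a aA pp E => [|z p IH] a aA /= pp E.
  by rewrite E aA in yA.
have /andP[/and3P[_ zV eaz] pz] := pp.
have [zA|zA] := boolP (z \in A); first exact: IH zA pz E.
by apply/touchP; exists a, z; rewrite inE zA.
Qed.

Lemma comps_touch V A C : conn V -> A \subset V -> A != set0 ->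
  C \in comps (V :\: A) -> touch C A.
Proof.
move=> cV sAV /set0Pn[a aA] CV.
have sCVA := comps_sub CV.
have sCV : C \subset V by apply: subset_trans sCVA (subsetDl _ _).
have nCV : C != V.
  apply/eqP => E; have := subsetP sCVA a; rewrite E inE aA /= => H.
  by have := H (subsetP sAV a aA).
have /touchP[x [y [xC]]] := conn_cross cV sCV (comps_neq0 CV) nCV.
rewrite inE => /andP[yC yV] exy; apply/touchP; exists x, y; split => //.
apply: contraR yC => yA.
by apply: (comps_nbr CV xC _ exy); rewrite inE yA.
Qed.

(** Every component of [A :|: B] contains a component of [A] or of [B], and [f] sends such a piece
    to the component around it. *)
Lemma ncompU A B : ncomp (A :|: B) <= ncomp A + ncomp B.
Proof.
pose f (P : {set T}) := if [pick x in P] is Some x then cmp (A :|: B) x else set0.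
apply: (@leq_trans #|f @: (comps A :|: comps B)|).
  apply/subset_leq_card/subsetP => C /compsP[x xAB ->].
  have [P [PAB cP sP xP]] : exists P, [/\ P \in comps A :|: comps B, conn P,
      P \subset A :|: B & x \in P].
    have /setUP[xA|xB] := xAB.
      exists (cmp A x); rewrite inE mem_comps ?comp_conn ?comp_refl //.
      by split => //; apply: subset_trans (comp_sub _ _) (subsetUl _ _).
    exists (cmp B x); rewrite inE mem_comps ?comp_conn ?comp_refl ?orbT //.
    by split => //; apply: subset_trans (comp_sub _ _) (subsetUr _ _).
  apply/imsetP; exists P => //; rewrite /f.
  case: pickP => [y yP|/(_ x)]; last by rewrite xP.
  apply: comp_eq => //; apply: (subsetP (conn_sub_comp cP sP xP)).
  exact: yP.
by apply: leq_trans (leq_imset_card _ _) _; rewrite cardsU leq_subr.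
Qed.

End Connectivity.

(** * Separators leaving components with at most two complementary components *)

Section Directions.
Variables (T : finType) (e : rel T).
Hypothesis eS : symmetric e.
Implicit Types (A B C V X Y Z R L : {set T}) (I : {set {set T}}).

Local Notation conn := (conn e).
Local Notation cmp := (cmp e).
Local Notation comps := (comps e).

(** The items behave like nodes of a tree in which [#|dirs V I A|] is the degree of [A]: items in
    the same component of [V :\: A] lie in the same direction. *)
Definition dirs V I A :=
  [set R in comps (V :\: A) | [exists B in I, (B != A) && (B \subset R)]].

Lemma dirsP V I A R :
  reflect (R \in comps (V :\: A) /\ exists B, [/\ B \in I, B != A & B \subset R])
          (R \in dirs V I A).
Proof.
rewrite inE; apply: (iffP andP) => -[RA].
  by case/exists_inP=> B BI /andP[nBA sBR]; split=> //; exists B.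
by case=> B [BI nBA sBR]; split=> //; apply/exists_inP; exists B; rewrite ?nBA.
Qed.

Lemma item_dir V I A B :
  B \in I -> B != A -> [disjoint A & B] -> B \subset V -> B != set0 -> conn B ->
  exists2 R, R \in dirs V I A & B \subset R.
Proof.
move=> BI nBA dAB sBV /set0Pn[b bB] cB.
have sB : B \subset V :\: A by rewrite subsetD sBV disjoint_sym.
exists (cmp (V :\: A) b); last exact: conn_sub_comp.
apply/dirsP; split; first by apply: mem_comps; exact: (subsetP sB).
by exists B; split => //; exact: conn_sub_comp.
Qed.

Definition connected_items V I :=
  [/\ forall A, A \in I -> [/\ A \subset V, A != set0 & conn A] & trivIset I].

Lemma connected_itemsS V I I' :
  I' \subset I -> connected_items V I -> connected_items V I'.
Proof.
move=> sI [HI tI]; split=> [A AI|]; first by apply: HI; exact: (subsetP sI).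
exact: trivIsetS tI.
Qed.

Lemma direction_conn V A R : conn V -> A \subset V -> A != set0 -> conn A ->
  R \in comps (V :\: A) -> conn (R :|: A).
Proof.
move=> cV sAV A0 cA RA; apply: connU_touch => //; last exact: comps_conn RA.
exact: comps_touch RA.
Qed.

(** Among all pairs of an item [A] and a direction [R] of [A], take one with [R] largest. If [A] had
    a second direction, containing an item [B], then the direction from [B] towards [A] would
    contain [R :|: A], which is larger. *)
Lemma exists_leaf_item V I : conn V -> connected_items V I -> I != set0 ->
  exists2 L, L \in I & #|dirs V I L| <= 1.
Proof.
move=> cV [HI tI] /set0Pn[A0 A0I].
pose P (p : {set T} * {set T}) := (p.1 \in I) && (p.2 \in dirs V I p.1).
have [p0 Pp0|noP] := pickP P; last first.
  exists A0 => //; rewrite (_ : dirs V I A0 = set0) ?cards0 //.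
  by apply/setP => R; have := noP (A0, R); rewrite /P /= A0I /= in_set0 => ->.
case: (arg_maxnP (fun p : {set T} * {set T} => #|p.2|) Pp0) => -[A R].
case/andP=> /= AI RA maxR; exists A => //; apply/card_le1_eqP => R1 R2.
suff E R' : R' \in dirs V I A -> R' = R by move=> /E-> /E->.
case/dirsP=> R'A [B [BI nBA sBR']]; apply: contraTeq isT => nRR' /=.
have [RA' _] := dirsP _ _ _ _ RA.
have [[sAV A0' cA] [sBV B0 cB]] := (HI A AI, HI B BI).
have cRA := direction_conn cV sAV A0' cA RA'.
have dRR' := comps_disj eS R'A RA' nRR'.
have dAB : [disjoint A & B] by apply: (trivIsetP tI) => //; rewrite eq_sym.
have sRA : R :|: A \subset V :\: B.
  rewrite subUset !subsetD dAB sAV (subset_trans (comps_sub RA')) ?subsetDl //=.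
  by rewrite disjoint_sym andbT; exact: disjointWl sBR' _.
have /set0Pn[a aA] := A0'.
have R2A : cmp (V :\: B) a \in dirs V I B.
  apply/dirsP; split; first by apply/mem_comps/(subsetP sRA); rewrite inE aA orbT.
  exists A; split => //; first by rewrite eq_sym.
  apply: subset_trans (subsetUr R A) _.
  by apply: conn_sub_comp => //; rewrite inE aA orbT.
have := maxR (B, _) (introT andP (conj BI R2A)); rewrite /= leqNgt => /negP[].
apply: (@leq_trans #|R :|: A|).
  have dRA : [disjoint R & A].
    by have := comps_sub RA'; rewrite subsetD => /andP[].
  rewrite cardsU (disjoint_setI0 dRA) cards0 subn0 -addn1 leq_add2l.
  by rewrite card_gt0.
by apply/subset_leq_card/conn_sub_comp => //; rewrite inE aA orbT.
Qed.

(* Deleting a leaf lowers the degree of at most one other item, by one. *)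
Lemma card_branching_items V I : conn V -> connected_items V I ->
  #|[set A in I | 2 < #|dirs V I A|]| <= #|[set A in I | #|dirs V I A| <= 1]|.
Proof.
move=> cV; move: {2}#|I| (erefl #|I|) => n; elim: n I => [|n IH] I In HI.
  by rewrite (cards0_eq In) (_ : [set A in _ | _] = set0) ?cards0 //; apply/setP => A; rewrite !inE.
have I0 : I != set0 by rewrite -card_gt0 In.
have [L LI degL] := exists_leaf_item cV HI I0.
have [HI1 tI] := HI.
set I' := I :\ L.
have I'n : #|I'| = n by move: In; rewrite (cardsD1 L) LI => -[].
have sI' : I' \subset I by rewrite subsetDl.
have {}IH := IH I' I'n (connected_itemsS sI' HI).
have sdirs A : dirs V I' A \subset dirs V I A.
  apply/subsetP => R /dirsP[RA [B [BI nBA sBR]]]; apply/dirsP; split=> //.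
  by exists B; split => //; apply: (subsetP sI').
have lost A R : R \in dirs V I A -> R \notin dirs V I' A ->
    L \subset R /\ forall B, B \in I' -> B != A -> ~~ (B \subset R).
  case/dirsP=> RA [B [BI nBA sBR]] nR.
  have H D : D \in I' -> D != A -> ~~ (D \subset R).
    by move=> DI' nDA; apply: contra nR => sDR; apply/dirsP; split=> //; exists D.
  split=> //; have [<-//|nBL] := eqVneq B L.
  by have := H B; rewrite !inE nBL BI sBR => /(_ isT nBA).
have degS A : A \in I' -> #|dirs V I A| <= #|dirs V I' A|.+1.
  move=> AI'; rewrite -(cardsID (dirs V I' A)) (setIidPr (sdirs A)) -addn1 leq_add2l.
  apply/card_le1_eqP => R1 R2 /setDP[R1A nR1] /setDP[R2A nR2].
  have [[sLR1 _] [sLR2 _]] := (lost _ _ R1A nR1, lost _ _ R2A nR2).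
  have [_ /set0Pn[x xL] _] := HI1 L LI.
  have [[R1A' _] [R2A' _]] := (dirsP _ _ _ _ R1A, dirsP _ _ _ _ R2A).
  by apply: (comps_eq eS R2A' R1A' (x := x)); [exact: (subsetP sLR2)|exact: (subsetP sLR1)].
pose aff A := (A \in I') && (dirs V I' A != dirs V I A).
(* Suppose that [A] loses [R] and [A'] loses [R']. Then [R] contains [L] but not [A'], so [R :|: A]
   is connected, avoids [A'] and meets [R'] in [L]. Hence it lies in [R'], which thus keeps the item
   [A], a contradiction. *)
have affE A A' : aff A -> aff A' -> A = A'.
  have affD D : aff D -> exists R, R \in dirs V I D /\ R \notin dirs V I' D.
    case/andP=> DI'; rewrite eqEsubset sdirs /= => /subsetPn[R RD nRD].
    by exists R.
  move=> aA aA'; have [/andP[AI' _] /andP[A'I' _]] := (aA, aA').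
  have [AI A'I] := (subsetP sI' A AI', subsetP sI' A' A'I').
  have [[R [RA nR]] [R' [RA' nR']]] := (affD _ aA, affD _ aA').
  apply: contraTeq isT => nAA'.
  have [[sLR H] [sLR' H']] := (lost _ _ RA nR, lost _ _ RA' nR').
  have [[sAV A0 cA] [sA'V A'0 cA']] := (HI1 A AI, HI1 A' A'I).
  have [_ /set0Pn[x xL] _] := HI1 L LI.
  have [[RA1 _] [RA1' _]] := (dirsP _ _ _ _ RA, dirsP _ _ _ _ RA').
  have dAA' : [disjoint A & A'] by apply: (trivIsetP tI).
  have nA'R := H A' A'I' (contra_neq esym nAA').
  have sRA : R :|: A \subset V :\: A'.
    rewrite subUset !subsetD dAA' sAV (subset_trans (comps_sub RA1)) ?subsetDl //= andbT.
    rewrite disjoint_sym; apply: contraR nA'R => /pred0Pn[y /andP[/= yA' yR]].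
    apply: (comps_max eS RA1 cA' _ yA' yR).
    by rewrite subsetD sA'V disjoint_sym.
  have : R :|: A \subset R'.
    apply: (comps_max eS RA1' _ sRA (x := x)).
    - exact: direction_conn RA1.
    - by rewrite inE (subsetP sLR).
    - exact: (subsetP sLR').
  rewrite subUset => /andP[_ sAR'].
  by have := H' A AI' nAA'; rewrite sAR'.
have [XX [YY [sX sY XY]]] : exists XX YY : {set {set T}},
   [/\ [set A in I | 2 < #|dirs V I A|] \subset [set A in I' | 2 < #|dirs V I' A|] :|: XX,
       L |: [set A in I' | #|dirs V I' A| <= 1] \subset [set A in I | #|dirs V I A| <= 1] :|: YY &
       #|XX| + #|YY| <= 1].
  have [A affA|noaff] := pickP aff; last first.
    have dE A : A \in I' -> dirs V I' A = dirs V I A.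
      by move=> AI'; have := noaff A; rewrite /aff AI' /= => /negbFE/eqP.
    exists set0, set0; rewrite cards0; split=> //.
      apply/subsetP => A; rewrite !inE orbF => /andP[AI dA].
      have nAL : A != L by apply: contraTneq dA => ->; rewrite -leqNgt (leq_trans degL).
      by rewrite -{1}/I' nAL AI /= dE // !inE nAL.
    apply/subsetP => A; rewrite !inE orbF => /orP[/eqP->|/andP[AI' dA]]; first by rewrite LI.
    have AI'2 : A \in I' by rewrite !inE.
    by rewrite (subsetP sI' A) //= -dE.
  have dE B : B \in I' -> B != A -> dirs V I' B = dirs V I B.
    move=> BI' nBA; apply/eqP; apply: contraNT nBA => nE; apply/eqP/affE => //.
    by rewrite /aff BI'.
  have AI' : A \in I' by case/andP: affA.
  have dAS := degS A AI'.
  have dAs := subset_leq_card (sdirs A).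
  (* The degree of [A] drops by at most one. From 3, [A] may stop branching but does not become a
     leaf; from any other value it may become a leaf but does not stop branching. The deleted leaf
     [L] pays for either change. *)
  exists (if #|dirs V I A| == 3 then [set A] else set0),
         (if #|dirs V I A| == 3 then set0 else [set A]).
  split; last by case: ifP; rewrite cards1 cards0.
    apply/subsetP => B; rewrite inE => /andP[BI dB].
    have nBL : B != L by apply: contraTneq dB => ->; rewrite -leqNgt (leq_trans degL).
    have BI' : B \in I' by rewrite !inE nBL.
    rewrite inE [B \in [set _ in I' | _]]inE BI' /=; have [E|nBA] := eqVneq B A.
      rewrite {}E in dB *; case: ifP => [|/eqP]; first by rewrite inE eqxx orbT.
      move=> n3; suff -> : 2 < #|dirs V I' A| by [].
      by move: dAS dB n3; case: #|dirs V I A| => [|[|[|[|m]]]] // dAS _ _; rewrite -ltnS (leq_trans _ dAS).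
    by rewrite dE // dB.
  apply/subsetP => B; rewrite inE => /orP[/set1P->|]; first by rewrite !inE LI degL.
  rewrite inE => /andP[BI' dB]; rewrite inE [B \in [set _ in I | _]]inE (subsetP sI' B) //=.
  have [E|nBA] := eqVneq B A; last by rewrite -dE // dB.
  rewrite {}E in dB *; case: ifP => [/eqP E3|]; last by rewrite inE eqxx orbT.
  by have := leq_trans dAS (dB : _.+1 <= 2); rewrite E3.
have LnI' : L \notin [set A in I' | #|dirs V I' A| <= 1] by rewrite !inE eqxx.
have := leq_trans (subset_leq_card sX) (leq_card_setU _ _).
have := leq_trans (subset_leq_card sY) (leq_card_setU _ _).
rewrite cardsU1 LnI' /= add1n => h1 h2.
apply: leq_trans h2 _; rewrite -ltnS.
have : #|[set A in I' | #|dirs V I' A| <= 1]|.+1 + #|XX| <= #|[set A in I | #|dirs V I A| <= 1]| + 1.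
  by apply: leq_trans (leq_add h1 (leqnn _)) _; rewrite -addnA leq_add2l addnC.
rewrite addn1 addSn; apply: leq_trans; rewrite ltnS leq_add2r.
exact: IH.
Qed.

End Directions.

(** * Linear Erdos-Posa bounds and the separation lemma *)

Section Separators.
Variables (T : finType) (e : rel T).
Hypothesis eS : symmetric e.
Implicit Types (A B C F V X Y Z R L : {set T}) (I BB DD FF : {set {set T}}).

Local Notation conn := (conn e).
Local Notation cmp := (cmp e).
Local Notation comps := (comps e).
Local Notation ncomp := (ncomp e).
Local Notation touch := (touch e).
Local Notation dirs := (dirs e).

(* [hittable k V] is the Erdos-Posa property with linear bound [n * k], the only
   consequence of having treewidth less than [k] that is used. *)
Definition packing FF X d :=
  forall DD, DD \subset FF -> trivIset DD -> (forall F, F \in DD -> F \subset X) ->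
  #|DD| <= d.

Definition hittable k V :=
  forall BB n, (forall B, B \in BB -> [/\ B \subset V, B != set0 & conn B]) ->
  packing BB V n ->
  exists2 Z : {set T}, #|Z| <= n * k & forall B, B \in BB -> B :&: Z != set0.

Lemma hittableS k V X : X \subset V -> hittable k V -> hittable k X.
Proof.
move=> sXV hV BB n HBB pBB; apply: hV => [B /HBB[sB B0 cB]|].
  by split=> //; apply: subset_trans sXV.
move=> DD sDD tDD _; apply: pBB => // B BD.
by have [] := HBB B (subsetP sDD B BD).
Qed.

Lemma hittable_gt0 k V : V != set0 -> hittable k V -> 0 < k.
Proof.
move=> /set0Pn[v vV] hV.
have [||Z Zk HZ] := hV [set [set v]] 1.
- by move=> B /set1P->; rewrite sub1set conn1; split=> //; apply/set0Pn; exists v; rewrite inE.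
- by move=> DD sDD _ _; rewrite -(cards1 [set v]); exact: subset_leq_card.
have /set0Pn[x] := HZ _ (set11 _); rewrite inE => /andP[_ xZ].
have : 0 < #|Z| by apply/card_gt0P; exists x.
by move/leq_trans/(_ Zk); rewrite mul1n.
Qed.

Lemma comps_cover A DD : DD \subset comps A -> comps (cover DD) = DD.
Proof.
move=> sD; apply/eqP; rewrite eqEsubset; apply/andP.
have sDc C : C \in DD -> C \in comps (cover DD).
  move=> CD; have CA := subsetP sD C CD.
  apply: conn_comps (comps_neq0 CA) (comps_conn eS CA) _; first exact: (bigcup_sup C).
  move=> x y xC /bigcupP[C' C'D yC'] exy; have C'A := subsetP sD C' C'D.
  apply: (comps_nbr eS CA xC _ exy); exact: (subsetP (comps_sub C'A)).
split; apply/subsetP => C; last exact: sDc.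
move=> CC; have /set0Pn[x xC] := comps_neq0 CC.
have /bigcupP[C' C'D xC'] := subsetP (comps_sub CC) x xC.
by rewrite (comps_eq eS CC (sDc _ C'D) xC xC').
Qed.

(** Absorbing into [A] the components of [V :\: A] outside [DD] leaves exactly those in [DD] as
    complementary components. This is how connected sets with few complementary components are
    produced. *)
Lemma compl_cover_dirs V A DD : A \subset V -> DD \subset comps (V :\: A) ->
  V :\: (A :|: \bigcup_(R in comps (V :\: A) | R \notin DD) R) = cover DD.
Proof.
move=> sAV sDD; apply/setP => x; rewrite !inE negb_or; apply/idP/bigcupP.
  case/andP=> /andP[xA /bigcupP xR] xV.
  have xVA : x \in V :\: A by rewrite inE xA.
  have Cx := comp_refl e xVA.
  exists (cmp (V :\: A) x) => //; apply: contraT => nD; case: xR.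
  by exists (cmp (V :\: A) x) => //; rewrite mem_comps.
case=> R RD xR; have RA := subsetP sDD R RD.
have := subsetP (comps_sub RA) x xR; rewrite inE => /andP[-> ->]; rewrite andbT /=.
apply/bigcupP => -[R' /andP[R'A nR'D] xR'].
by rewrite (comps_eq eS R'A RA xR' xR) RD in nR'D.
Qed.

Lemma conn_with_comps V A DD : conn V -> A \subset V -> A != set0 -> conn A ->
  conn (A :|: \bigcup_(R in comps (V :\: A) | R \notin DD) R).
Proof.
move=> cV sAV A0 cA; apply: conn_bigcup => // R /andP[RA _].
by rewrite (comps_conn eS RA) touchC //; split=> //; exact: comps_touch RA.
Qed.

Section Separate.
Variables (k d m : nat) (V X : {set T}) (FF : {set {set T}}).
Hypotheses (cV : conn V) (sXV : X \subset V).
Hypotheses (mX : ncomp (V :\: X) <= m) (pFF : packing FF X d).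
Hypotheses (HFF : forall F, F \in FF -> F != set0 /\ conn F).
Hypothesis hV : hittable k V.

(* A set in [X] is bad when it cannot be enlarged to a connected set that
   contains no member of [FF] and whose complement has at most two components.
   A smallest hitting set [Z] of the bad sets works: a component of [X - Z]
   extends to a good set, and absorbing the complementary components inside that
   good set would give a smaller hitting set. *)
Definition good Y := [&& Y \subset X, conn Y, [forall F in FF, ~~ (F \subset Y)]
  & ncomp (V :\: Y) <= 2].

Definition bad := [set Y : {set T} | [&& Y \subset X, Y != set0, conn Y
  & [forall Y' : {set T}, (Y \subset Y') ==> ~~ good Y']]].

Lemma badP Y : reflect
  [/\ Y \subset X, Y != set0, conn Y & forall Y', Y \subset Y' -> ~~ good Y']
  (Y \in bad).
Proof.
rewrite inE; apply: (iffP and4P) => -[-> -> -> H]; split=> //.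
  by move=> Y' sY; have /forallP/(_ Y')/implyP := H; apply.
by apply/forallP => Y'; apply/implyP; exact: H.
Qed.

(* The items are the bad sets and the components of [V - X].  A bad set with at
   most two directions containing other items absorbs its remaining directions,
   and must then contain a member of [FF]; there are at most as many other bad
   sets as there are leaf items. *)
Lemma packing_bad : packing bad X (d.*2 + m).
Proof.
move=> DD sDD tDD _.
pose I := DD :|: comps (V :\: X).
have HDD Y : Y \in DD -> [/\ Y \subset X, Y != set0, conn Y & forall Y', Y \subset Y' -> ~~ good Y'].
  by move=> YD; apply/badP/(subsetP sDD).
have XR R : R \in comps (V :\: X) -> [disjoint R & X].
  by move=> /comps_sub; rewrite subsetD => /andP[].
have HI : connected_items e V I.
  split=> [A|].
    case/setUP=> [/HDD[sA A0 cA _]|AX]; first by split=> //; exact: subset_trans sXV.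
    rewrite (comps_neq0 AX) (comps_conn eS AX) (subset_trans (comps_sub AX)) //.
    exact: subsetDl.
  apply/trivIsetP => A B /setUP[AD|AinC] /setUP[BD|BC] nAB.
  - exact: (trivIsetP tDD).
  - by have [sA _ _ _] := HDD A AD; apply: disjointWl sA _; rewrite disjoint_sym XR.
  - by have [sB _ _ _] := HDD B BD; apply: disjointWr sB _; rewrite XR.
  - exact: (comps_disj eS AinC BC nAB).
have [HI1 tI] := HI.
have sDI : DD \subset I := subsetUl _ _.
pose low := [set Y in DD | #|dirs V I Y| <= 2].
pose up Y := Y :|: \bigcup_(R in comps (V :\: Y) | R \notin dirs V I Y) R.
have sdirs Y : dirs V I Y \subset comps (V :\: Y).
  by apply/subsetP => R; rewrite inE => /andP[].
have upC Y : Y \in DD -> V :\: up Y = cover (dirs V I Y).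
  by move=> YD; apply: compl_cover_dirs => //; have [] := HI1 Y (subsetP sDI Y YD).
(* The components of [V :\: X] are items, so a direction that contains a point of [V :\: X] contains
   an item and is not absorbed. *)
have upX Y : Y \in DD -> up Y \subset X.
  move=> YD; have YI := subsetP sDI Y YD; have [sYV _ _] := HI1 Y YI.
  have [sYX _ _ _] := HDD Y YD.
  apply/subsetP => x xU; apply: contraT => nxX.
  have xV : x \in V.
    move: xU; rewrite inE => /orP[/(subsetP sYV)//|/bigcupP[R /andP[RY _] xR]].
    by have := subsetP (comps_sub RY) x xR; rewrite inE => /andP[].
  have xVX : x \in V :\: X by rewrite inE nxX.
  have Px := mem_comps e xVX; set P := cmp _ x in Px.
  have PI : P \in I by rewrite inE Px orbT.
  have xP : x \in P by exact: comp_refl.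
  have [sPV P0 cP] := HI1 P PI.
  have nPY : P != Y by apply: contraNneq nxX => E; apply: (subsetP sYX); rewrite -E.
  have dYP : [disjoint Y & P] by rewrite (trivIsetP tI) // eq_sym.
  have [R RD sPR] := item_dir PI nPY dYP sPV P0 cP.
  have : x \in V :\: up Y by rewrite upC //; apply/bigcupP; exists R => //; apply: (subsetP sPR).
  by rewrite inE xU.
have upconn Y : Y \in DD -> conn (up Y).
  move=> YD; have [sYV Y0 cY] := HI1 Y (subsetP sDI Y YD).
  exact: conn_with_comps.
have upF Y : Y \in low -> exists F, (F \in FF) && (F \subset up Y).
  rewrite inE => /andP[YD dY]; have [_ _ _ /(_ (up Y) (subsetUl _ _))] := HDD Y YD.
  rewrite /good upX // upconn // upC // /ncomp (comps_cover (sdirs Y)) dY andbT /= => H.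
  have /exists_inP[F FFF sF] : [exists F in FF, F \subset up Y].
    apply: contraR H; rewrite negb_exists => /forallP H; apply/forall_inP => F FF1.
    by have := H F; rewrite FF1.
  by exists F; rewrite FFF.
(* Each of [Y1], [Y2] lies in a direction kept by the other. If absorbed directions [R1] and [R2]
   shared a point, then [R1 :|: Y1] would lie in [R2], which would thus contain an item. *)
have updisj Y1 Y2 : Y1 \in low -> Y2 \in low -> Y1 != Y2 -> [disjoint up Y1 & up Y2].
  rewrite !inE => /andP[Y1D _] /andP[Y2D _] nY.
  have sub Y Y' : Y \in DD -> Y' \in DD -> Y != Y' -> [disjoint Y & up Y'].
    move=> YD Y'D nYY'; have YI := subsetP sDI Y YD.
    have [sYV Y0 cY] := HI1 Y YI.
    have dYY' : [disjoint Y' & Y] by rewrite (trivIsetP tDD) // eq_sym.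
    have [R RD sYR] := item_dir YI nYY' dYY' sYV Y0 cY.
    have : Y \subset V :\: up Y'.
      by rewrite upC //; apply: subset_trans sYR _; exact: (bigcup_sup R).
    by rewrite subsetD => /andP[].
  apply/pred0Pn => -[x /andP[/= xU1 xU2]].
  have := xU1; rewrite inE => /orP[xY1|/bigcupP[R1 /andP[R1C R1n] xR1]].
    by have /pred0P/(_ x)/= := sub _ _ Y1D Y2D nY; rewrite xY1 xU2.
  have := xU2; rewrite inE => /orP[xY2|/bigcupP[R2 /andP[R2C R2n] xR2]].
    by have /pred0P/(_ x)/= := sub _ _ Y2D Y1D (contra_neq esym nY); rewrite xY2 xU1.
  have Y1I := subsetP sDI _ Y1D; have [sY1V Y10 cY1] := HI1 _ Y1I.
  have cR1 := direction_conn eS cV sY1V Y10 cY1 R1C.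
  have dY2 : [disjoint up Y1 & Y2] by rewrite disjoint_sym sub // eq_sym.
  have sU : R1 :|: Y1 \subset up Y1.
    by rewrite setUC setUS //; apply: (bigcup_sup R1); rewrite R1C.
  have : R1 :|: Y1 \subset R2.
    apply: (comps_max eS R2C cR1 _ (x := x)) => //; last by rewrite inE xR1.
    rewrite subsetD (disjointWl sU) // andbT (subset_trans sU) //.
    exact: subset_trans (upX _ Y1D) sXV.
  rewrite subUset => /andP[_ sY1R2]; case/negP: R2n; apply/dirsP; split=> //.
  by exists Y1.
have lowd : #|low| <= d.
  pose f Y := if [pick F | (F \in FF) && (F \subset up Y)] is Some F then F else set0.
  have fP Y : Y \in low -> [/\ f Y \in FF, f Y \subset up Y & f Y != set0].
    move=> YL; rewrite /f; case: pickP => [F /andP[FFF sF]|noF].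
      by split=> //; have [] := HFF FFF.
    by have [F] := upF Y YL; rewrite noF.
  have fdisj Y1 Y2 : Y1 \in low -> Y2 \in low -> Y1 != Y2 -> [disjoint f Y1 & f Y2].
    move=> L1 L2 nY; have [[_ s1 _] [_ s2 _]] := (fP _ L1, fP _ L2).
    by apply: disjointW s1 s2 _; exact: updisj.
  rewrite -(card_in_imset (f := f)).
    apply: pFF.
    - by apply/subsetP => _ /imsetP[Y YL ->]; have [] := fP Y YL.
    - apply/trivIsetP => _ _ /imsetP[Y1 L1 ->] /imsetP[Y2 L2 ->] nf.
      by apply: fdisj => //; apply: contraNneq nf => ->.
    - move=> _ /imsetP[Y YL ->]; have [_ sf _] := fP Y YL.
      by apply: subset_trans sf _; apply: upX; move: YL; rewrite inE => /andP[].
  move=> Y1 Y2 L1 L2 E; apply: contraTeq isT => nY.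
  have := fdisj _ _ L1 L2 nY; rewrite -E -setI_eq0 setIid.
  by have [_ _ /negPf->] := fP _ L1.
have := card_branching_items eS cV HI.
set hi := [set A in I | _]; set lf := [set A in I | _] => hilf.
have slf : lf \subset low :|: comps (V :\: X).
  apply/subsetP => A; rewrite !inE => /andP[/orP[->|->] dA]; last by rewrite orbT.
  by rewrite (leq_trans dA).
have sD : DD \subset low :|: hi.
  by apply/subsetP => A AD; rewrite !inE AD leqNgt; case: (2 < _).
(* The branching sets in [hi] are at most as many as the leaf items, and these are members of [low]
   or components of [V :\: X]: in total [d + (d + m)]. *)
apply: leq_trans (subset_leq_card sD) _; apply: leq_trans (leq_card_setU _ _) _.
rewrite -addnn -addnA leq_add //; apply: leq_trans hilf _.
apply: leq_trans (subset_leq_card slf) _; apply: leq_trans (leq_card_setU _ _) _.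
by rewrite leq_add.
Qed.

Lemma separate : exists Z : {set T},
  [/\ Z \subset X, #|Z| <= (d.*2 + m) * k,
      forall F, F \in FF -> F \subset X -> F :&: Z != set0 &
      forall C, C \in comps (X :\: Z) -> ncomp (V :\: C) <= 2].
Proof.
have hX := hittableS sXV hV.
have [|Z0 Z0k HZ0] := hX bad _ _ packing_bad; first by move=> B /badP[].
pose P Z := (Z \subset X) && [forall Y in bad, Y :&: Z != set0].
have PZ0 : P (Z0 :&: X).
  rewrite /P subsetIr; apply/forall_inP => Y YB; have [sYX _ _ _] := badP _ YB.
  have /set0Pn[x /setIP[xY xZ]] := HZ0 Y YB.
  by apply/set0Pn; exists x; rewrite !inE xY xZ (subsetP sYX).
case: (arg_minnP (fun Z => #|Z|) PZ0) => Z /andP[sZX /forall_inP HZ] minZ.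
have cgood C : C \in comps (X :\: Z) -> exists2 Y : {set T}, C \subset Y & good Y.
  move=> CC; have : C \notin bad.
    apply/negP => /HZ/set0Pn[x /setIP[xC xZ]].
    by have := subsetP (comps_sub CC) x xC; rewrite inE xZ.
  rewrite inE (comps_neq0 CC) (comps_conn eS CC) (subset_trans (comps_sub CC)) ?subsetDl //=.
  rewrite negb_forall => /existsP[Y]; rewrite negb_imply negbK => /andP[sCY gY].
  by exists Y.
exists Z; split=> //.
- apply: leq_trans (minZ _ PZ0) _; apply: leq_trans Z0k.
  exact/subset_leq_card/subsetIl.
- move=> F FFF sFX; have [/set0Pn[x xF] cF] := HFF FFF.
  apply: contraT => /negPn; rewrite setI_eq0 => dFZ.
  have sF : F \subset X :\: Z by rewrite subsetD sFX.
  have xXZ := subsetP sF x xF.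
  have [Y sCY /and4P[_ _ /forall_inP/(_ F FFF) nF _]] := cgood _ (mem_comps e xXZ).
  by case/negP: nF; apply: subset_trans sCY; exact: conn_sub_comp.
move=> C CC; have [Y sCY /and4P[sYX cY /forall_inP nF nY]] := cgood C CC.
have sCXZ := comps_sub CC; have cC := comps_conn eS CC; have C0 := comps_neq0 CC.
have sCX : C \subset X by apply: subset_trans sCXZ (subsetDl _ _).
have sCV := subset_trans sCX sXV.
(* [Y1] absorbs the complementary components of [C] that lie inside the good set [Y]. Each of the
   others contains a component of [V :\: Y], so at most two remain. *)
pose D := [set Q in comps (V :\: C) | ~~ (Q \subset Y)].
pose Y1 := C :|: \bigcup_(R in comps (V :\: C) | R \notin D) R.
have sD : D \subset comps (V :\: C) by apply/subsetP => Q; rewrite inE => /andP[].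
have sY1 : Y1 \subset Y.
  rewrite subUset sCY; apply/bigcupsP => R /andP[RC].
  by rewrite inE RC /= negbK.
have gY1 : good Y1.
  apply/and4P; split.
  - exact: subset_trans sYX.
  - exact: conn_with_comps.
  - by apply/forall_inP => F FFF; apply: contra (nF F FFF) => /subset_trans; apply.
  rewrite compl_cover_dirs // /ncomp (comps_cover sD); apply: leq_trans nY.
  pose f (Q : {set T}) := if [pick x in Q | x \notin Y] is Some x then cmp (V :\: Y) x else set0.
  have fP Q : Q \in D -> f Q \in comps (V :\: Y) /\ exists2 x, x \in Q & x \in f Q.
    rewrite inE => /andP[QC /subsetPn[y yQ yY]]; rewrite /f.
    case: pickP => [x /andP[xQ xY]|/(_ y)]; last by rewrite yQ yY.
    have xVY : x \in V :\: Y.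
      by have := subsetP (comps_sub QC) x xQ; rewrite !inE xY => /andP[].
    by split; [exact: mem_comps|exists x => //; exact: comp_refl].
  rewrite -(card_in_imset (f := f)).
    by apply/subset_leq_card/subsetP => _ /imsetP[Q QD ->]; have [] := fP Q QD.
  move=> Q1 Q2 D1 D2 E; have [[f1 [x xQ1 xf]] [f2 [y yQ2 yf]]] := (fP _ D1, fP _ D2).
  have sfV : f Q1 \subset V :\: C.
    by apply: subset_trans (comps_sub f1) _; exact: setDS.
  rewrite -E in yf.
  have Q1C := subsetP sD _ D1; have Q2C := subsetP sD _ D2.
  have s1 := comps_max eS Q1C (comps_conn eS f1) sfV xf xQ1.
  exact: (comps_eq eS Q1C Q2C (subsetP s1 y yf) yQ2).
have [E|nE] := eqVneq Y1 C; first by move: gY1; rewrite E => /and4P[].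
have /set0Pn[z /setIP[zZ zY1]] : Z :&: Y1 != set0.
  apply: contraNneq nE => /eqP; rewrite setI_eq0 disjoint_sym => dY1Z.
  have sY1Z : Y1 \subset X :\: Z by rewrite subsetD (subset_trans sY1).
  have /set0Pn[c cC'] := C0.
  rewrite eqEsubset subsetUl andbT.
  have /and4P[_ cY1 _ _] := gY1.
  by apply: (comps_max eS CC cY1 sY1Z _ cC'); rewrite inE cC'.
(* By minimality of [Z], some bad set [B] meets [Z] only inside [Y1]. It cannot lie in the good set
   [Y1]. An edge of [B] leaving [Y1] ends outside [Z] and outside [C], so it starts neither in the
   component [C] of [X :\: Z] nor in an absorbed component of [V :\: C]. *)
have : ~~ P (Z :\: Y1).
  apply/negP => /minZ; rewrite leqNgt => /negP[]; apply/proper_card.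
  by apply/properP; split; [exact: subsetDl|exists z => //; rewrite in_setD zY1].
rewrite /P (subset_trans (subsetDl _ _)) //= negb_forall => /existsP[B].
rewrite negb_imply negbK => /andP[Bbad /eqP BZ0].
have [sBX B0 cB nB] := badP _ Bbad.
have BZ x : x \in B -> x \in Z -> x \in Y1.
  move=> xB xZ; apply: contraT => xY1; have /setP/(_ x) := BZ0.
  by rewrite in_setI in_setD in_set0 xB xZ xY1.
have [BY|/pred0Pn[y /andP[/= yB yY1]]] := boolP [disjoint B & Y1].
  have /set0Pn[x /setIP[xB xZ]] := HZ B Bbad.
  by have /pred0P/(_ x)/= := BY; rewrite xB BZ.
suff sBY1 : B \subset Y1 by have := nB _ sBY1; rewrite gY1.
apply: contraT => nBY1.
have : touch (B :&: Y1) (B :\: (B :&: Y1)).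
  apply: conn_cross => //; first exact: subsetIl.
    by apply/set0Pn; exists y; rewrite inE yB.
  by apply: contra nBY1 => /eqP/setIidPl.
case/touchP=> u [v [/setIP[uB uY1] /setDP[vB]]].
rewrite in_setI vB /= => vY1 euv.
have vX := subsetP sBX v vB; have vZ : v \notin Z by apply: contra vY1 => /(BZ v vB).
have vC : v \notin C by apply: contra vY1 => vC; rewrite inE vC.
have := uY1; rewrite inE => /orP[uC|/bigcupP[R RC uR]].
  case/negP: vC; apply: (comps_nbr eS CC uC _ euv); by rewrite inE vZ.
case/negP: vY1; rewrite inE; apply/orP; right; apply/bigcupP; exists R => //.
have /andP[RC' _] := RC; apply: (comps_nbr eS RC' uR _ euv).
by rewrite inE vC (subsetP sXV).
Qed.

End Separate.
End Separators.

(** * Treewidth and the Erdos-Posa property *)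

Section Subtrees.
Variables (T : finType) (e : rel T).
Hypothesis eS : symmetric e.
Implicit Types (A B S : {set T}) (SS : {set {set T}}).

Local Notation conn := (conn e).
Local Notation cmp := (cmp e).
Local Notation comps := (comps e).

(** Choose [l] so that some component of [A :\ l] is as large as possible. If this component missed
    a vertex [z] of [A :\ l], deleting [z] instead would leave it together with [l] in one
    component. *)
Lemma conn_delete A : conn A -> A != set0 -> exists2 l, l \in A & conn (A :\ l).
Proof.
move=> cA /set0Pn[a aA].
pose P (p : T * {set T}) := (p.1 \in A) && (p.2 \in comps (A :\ p.1)).
have [p0 Pp0|noP] := pickP P; last first.
  exists a => //; apply/connP => x y xA _.
  by have := noP (a, cmp (A :\ a) x); rewrite /P /= aA mem_comps.
case: (arg_maxnP (fun p : T * {set T} => #|p.2|) Pp0) => -[l C].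
case/andP=> /= lA CA maxC; exists l => //.
apply/connP => x y; suff sAC : A :\ l \subset C.
  by move=> /(subsetP sAC) xC /(subsetP sAC) yC; apply: connectS (comps_sub CA) (connP _ _ (comps_conn eS CA) _ _ xC yC).
apply/subsetP => z zA; apply: contraT => zC.
have sl : [set l] \subset A by rewrite sub1set.
have l0 : [set l] != set0 by apply/set0Pn; exists l; rewrite inE.
have cC : conn (C :|: [set l]) := direction_conn eS cA sl l0 (conn1 _ _) CA.
have := zA; rewrite !inE => /andP[nzl zA'].
have sCz : C :|: [set l] \subset A :\ z.
  rewrite subUset sub1set; apply/andP; split; last by rewrite !inE eq_sym nzl.
  apply/subsetP => u uC; rewrite !inE.
  have := subsetP (comps_sub CA) u uC; rewrite !inE => /andP[_ ->]; rewrite andbT.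
  by apply: contraNneq zC => <-.
have lz : l \in A :\ z by rewrite !inE eq_sym nzl lA.
have := maxC (z, cmp (A :\ z) l); rewrite /P /= zA' mem_comps // => /(_ isT).
rewrite leqNgt => /negP[]; apply: (@leq_trans #|C :|: [set l]|).
  rewrite cardsU cards1 (_ : C :&: [set l] = set0) ?cards0 ?subn0 ?addn1 //.
  apply/setP => u; rewrite !inE; case: eqP => [->|]; rewrite ?andbF ?andbT //.
  by apply/negP => /(subsetP (comps_sub CA)); rewrite !inE eqxx.
by apply/subset_leq_card/conn_sub_comp => //; rewrite !inE eqxx orbT.
Qed.

Hypothesis acyclic : forall c : seq T, 2 < size c -> ~ ucycle e c.

(** Two neighbours of [l], joined by a path avoiding [l], would close a cycle. *)
Lemma leaf_nbr_unique A l p q : conn (A :\ l) -> p \in A :\ l -> q \in A :\ l ->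
  e l p -> e l q -> p = q.
Proof.
move=> /connP cA pA qA elp elq; have /connectP[s0 ps0 E0] := cA p q pA qA.
case/shortenP: ps0 E0 => s ps us _ qE.
case: s ps us qE => [//|z s] ps us qE; case: (@acyclic (l :: p :: z :: s)) => //.
apply/andP; split.
  rewrite (cycle_path l) (_ : last _ _ = q); last by rewrite qE.
  rewrite /= eS elq elp /=.
  by apply: (sub_path _ ps) => u v /and3P[].
rewrite cons_uniq us andbT inE negb_or; apply/andP; split.
  by apply: contraTneq pA => <-; rewrite !inE eqxx.
by apply/negP => /(erel_path_sub ps); rewrite !inE eqxx.
Qed.

Lemma subtree_delete_leaf A l S : l \in A -> conn (A :\ l) -> S \subset A ->
  conn S -> conn (S :\ l).
Proof.
move=> lA cA sSA cS; have [lS|nlS] := boolP (l \in S); last first.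
  by rewrite (setDidPl _) // disjoint_sym disjoints1.
apply/connP => x y xS yS.
have sl : [set l] \subset S by rewrite sub1set.
have l0 : [set l] != set0 by apply/set0Pn; exists l; rewrite inE.
have H z : z \in S :\ l -> exists u, [/\ u \in cmp (S :\ l) z, u \in A :\ l & e l u].
  move=> zS; have := comps_touch eS cS sl l0 (mem_comps e zS).
  case/touchP=> u [v [uC /set1P-> eul]]; exists u; split; rewrite 1?eS //.
  by apply: (subsetP (setSD _ sSA)); apply: (subsetP (comp_sub _ _ _) _ uC).
have [[u [uC uA elu]] [v [vC vA elv]]] := (H x xS, H y yS).
have E := leaf_nbr_unique cA uA vA elu elv; rewrite -{}E in vC.
have := comps_eq eS (mem_comps e xS) (mem_comps e yS) uC vC => E.
by have := comp_refl e yS; rewrite -E inE yS.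
Qed.

(** The greedy step for covering subtrees, by deletion of leaves: unless [[set l]] is itself a
    member, a member through [l] also contains the unique neighbour of [l], so removing [l]
    preserves nonemptiness and all intersections. *)
Lemma subtree_top A SS : conn A -> SS != set0 ->
  (forall S, S \in SS -> [/\ S \subset A, S != set0 & conn S]) ->
  exists S x, [/\ S \in SS, x \in S &
    forall S', S' \in SS -> S' :&: S != set0 -> x \in S'].
Proof.
move: {2}#|A| (erefl #|A|) => n; elim: n A SS => [|n IH] A SS An cA /set0Pn[S0 S0S] HS.
  have [sA S0' _] := HS S0 S0S; move: sA.
  by rewrite (cards0_eq An) subset0 (negPf S0').
have A0 : A != set0 by rewrite -card_gt0 An.
have [l lA cAl] := conn_delete cA A0.
have [lSS|nlSS] := boolP ([set l] \in SS).
  exists [set l], l; rewrite lSS inE eqxx; split=> // S' _ /set0Pn[x].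
  by rewrite !inE => /andP[xS' /eqP <-].
have HSl S : S \in SS -> S :\ l != set0.
  move=> SSS; have [_ S0' _] := HS S SSS; apply: contraNneq nlSS => E.
  suff <- : S = [set l] by [].
  apply/eqP; rewrite eqEsubset; move/eqP: E; rewrite setD_eq0 => sl; rewrite sl.
  have /set0Pn[x xS] := S0'; rewrite sub1set.
  by have /set1P <- := subsetP sl x xS.
have [|//|||S1 [x [/imsetP[S SSS ->] xS Hx]]] := IH (A :\ l) [set S :\ l | S in SS].
- by move: An; rewrite (cardsD1 l) lA => -[].
- by apply/set0Pn; exists (S0 :\ l); apply: imset_f.
- move=> _ /imsetP[S SSS ->]; have [sSA _ cS] := HS S SSS.
  by rewrite setSD // HSl // (subtree_delete_leaf lA).
have xS' : x \in S by move: xS; rewrite !inE => /andP[].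
exists S, x; split=> // S' S'S /set0Pn[y /setIP[yS' yS]].
suff : x \in S' :\ l by rewrite !inE => /andP[].
apply: Hx; first exact: imset_f.
have [nyl|yl] := eqVneq y l; last by apply/set0Pn; exists y; rewrite !inE yl yS' yS.
rewrite {y}nyl in yS' yS.
have nb R : R \in SS -> l \in R -> exists p, [/\ p \in R, p \in A :\ l & e l p].
  move=> RS lR; have [sRA _ cR] := HS R RS.
  have sl : [set l] \subset R by rewrite sub1set.
  have /touchP[u [p [/set1P-> /setDP[pR pl] elp]]] : touch e [set l] (R :\: [set l]).
    apply: conn_cross => //; first by apply/set0Pn; exists l; rewrite inE.
    by apply: contraNneq nlSS => ->.
  by exists p; rewrite inE pl (subsetP sRA).
have [[p [pS pA elp]] [q [qS' qA elq]]] := (nb S SSS yS, nb S' S'S yS').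
have E := leaf_nbr_unique cAl pA qA elp elq; rewrite -{}E in qS'.
by apply/set0Pn; exists p; move: pA; rewrite !inE qS' pS => /andP[-> _].
Qed.

End Subtrees.

(** * Graphs as symmetric relations, and hitting sets made of bags *)

Lemma adj_sym (T : finType) (G : graph T) : symmetric (adj G).
Proof. by move=> x y; rewrite /adj setUC. Qed.

Lemma adj_vset (T : finType) (G : graph T) x y :
  adj G x y -> [/\ x \in vset G, y \in vset G & x != y].
Proof.
move=> xy; have /forall_inP/(_ _ xy)/andP[c2 sV] := graphP G.
move: sV; rewrite subUset !sub1set => /andP[-> ->]; split=> //.
by apply: contraTneq c2 => ->; rewrite setUid cards1.
Qed.

Lemma connected_conn (T : finType) (G : graph T) : connected G ->
  vset G != set0 /\ conn (adj G) (vset G).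
Proof.
case/andP=> G0 /forall_inP H; split=> //; apply/connP => x y xG yG.
have /forall_inP/(_ y yG) := H x xG; apply: connect_sub => u v uv.
by have [uG vG _] := adj_vset uv; apply: connect1; rewrite /erel uG vG.
Qed.

Lemma adj_induced (T : finType) (G : graph T) (A : {set T}) x y :
  adj (induced G A) x y = [&& x \in A, y \in A & adj G x y].
Proof. by rewrite /adj inE subUset !sub1set andbC -andbA. Qed.

Lemma connected_induced (T : finType) (G : graph T) (A : {set T}) :
  connected (induced G A) = (vset G :&: A != set0) && conn (adj G) (vset G :&: A).
Proof.
rewrite /connected vset_induced; congr (_ && _).
apply/forall_inP/connP => [H x y xG yG|H x xG].
  have /forall_inP/(_ y yG) := H x xG; apply: connect_sub => u v.
  rewrite adj_induced => /and3P[uA vA uv]; have [uG vG _] := adj_vset uv.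
  by apply: connect1; rewrite /erel !inE uA vA uG vG.
apply/forall_inP => y yG; apply: connect_sub (H x y xG yG) => u v.
rewrite /erel !inE => /and3P[/andP[_ uA] /andP[_ vA] uv].
by apply: connect1; rewrite adj_induced uA vA.
Qed.

(** A connected set [F] traces a subtree [tr F] on the decomposition tree. For a topmost trace with
    its node [x], every member that misses the bag [B x] is disjoint from [F]; so taking this bag,
    at most [k] vertices, lowers the packing number of what remains to be hit. *)
Lemma tree_decomposition_hittable (T W : finType) (G : graph T) (D : graph W)
    (B : W -> {set T}) k :
  tree_decomposition D G B -> max_bag D B <= k -> hittable (adj G) k (vset G).
Proof.
move=> [[cD acD] _ edgeB vertB] maxB BB n.
have [_ cDD] := connected_conn cD.
have DS := @adj_sym _ D; have GS := @adj_sym _ G.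
pose tr (F : {set T}) := [set x in vset D | B x :&: F != set0].
have trP (F : {set T}) x : reflect (x \in vset D /\ exists2 v, v \in B x & v \in F) (x \in tr F).
  rewrite inE; apply: (iffP andP) => -[xD].
    by case/set0Pn=> v /setIP[vB vF]; split=> //; exists v.
  by case=> v vB vF; split=> //; apply/set0Pn; exists v; rewrite inE vB.
have tr1 v : v \in vset G -> tr [set v] != set0 /\ conn (adj D) (tr [set v]).
  move=> vG; have := vertB v vG; rewrite connected_induced => /andP[].
  suff -> : vset D :&: [set x | v \in B x] = tr [set v] by [].
  apply/setP => x; rewrite !inE; congr (_ && _).
  by apply/idP/set0Pn => [vB|[u /setIP[uB /set1P<-]]//]; exists v; rewrite !inE vB eqxx.
have trS (F F' : {set T}) : F \subset F' -> tr F \subset tr F'.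
  move=> /subsetP sF; apply/subsetP => x /trP[xD [v vB vF]].
  by apply/trP; split=> //; exists v; rewrite ?sF.
have trconn (F : {set T}) : F \subset vset G -> F != set0 -> conn (adj G) F ->
    tr F != set0 /\ conn (adj D) (tr F).
  move=> sFG /set0Pn[v vF] cF; have vG := subsetP sFG v vF.
  have s1 u : u \in F -> [set u] \subset F by rewrite sub1set.
  have [/set0Pn[x xv] cv] := tr1 v vG.
  have xF := subsetP (trS _ _ (s1 v vF)) x xv.
  split; first by apply/set0Pn; exists x.
  apply: (@conn_from _ _ DS x) => // y /trP[yD [u uB uF]].
  have yu : y \in tr [set u] by apply/trP; split=> //; exists u; rewrite ?inE.
  have /connectP[p pp uE] := connP _ _ cF v u vF uF.
  elim: p v vF vG x xv cv xF pp uE => [|w p IH] v vF vG x xv cv xF /= pp uE.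
    apply: connectS (trS _ _ (s1 v vF)) _; rewrite uE in yu.
    exact: (connP _ _ cv).
  have /andP[/and3P[_ wF vw] pw] := pp; have wG := subsetP sFG w wF.
  have [z zD svw] := edgeB _ vw; move: svw; rewrite subUset !sub1set => /andP[vz wz].
  have zv : z \in tr [set v] by apply/trP; split=> //; exists v; rewrite ?inE.
  have zw : z \in tr [set w] by apply/trP; split=> //; exists w; rewrite ?inE.
  have zF := subsetP (trS _ _ (s1 v vF)) z zv.
  have [_ cw] := tr1 w wG.
  apply: connect_trans (IH w wF wG z zw cw zF pw uE).
  by apply: connectS (trS _ _ (s1 v vF)) _; exact: (connP _ _ cv).
elim: n BB => [|n IH] BB HBB pBB.
  exists set0; rewrite ?cards0 // => F FB.
  have [sF F0 _] := HBB F FB; have := pBB [set F].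
  rewrite cards1 sub1set FB => /(_ isT) H.
  suff: 1 <= 0 by []; apply: H => [|_ /set1P->//].
  by apply/trivIsetP => A C /set1P-> /set1P->; rewrite eqxx.
have [->|BB0] := eqVneq BB set0.
  by exists set0; rewrite ?cards0 // => F; rewrite inE.
have [||S [x [/imsetP[F FB ->] xF Hx]]] := subtree_top DS acD (SS := tr @: BB) cDD.
- by have /set0Pn[F FB] := BB0; apply/set0Pn; exists (tr F); apply: imset_f.
- move=> _ /imsetP[F FB ->]; have [sF F0 cF] := HBB F FB.
  have [tF ctF] := trconn F sF F0 cF; split=> //.
  by apply/subsetP => x /trP[].
have Hhit (F' : {set T}) : F' \in BB -> F' :&: B x == set0 -> [disjoint F & F'].
  move=> F'B /eqP F'x; apply: contraTT isT => /pred0Pn[v /andP[/= vF vF']].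
  have [sF F0 _] := HBB F FB; have vG := subsetP sF v vF.
  have [/set0Pn[y /trP[yD [u yu /set1P uv]]] _] := tr1 v vG; rewrite {}uv in yu.
  have /Hx/(_ _) : tr F' \in tr @: BB by apply: imset_f.
  have -> : tr F' :&: tr F != set0.
    apply/set0Pn; exists y; rewrite inE; apply/andP; split; apply/trP; split=> //; by exists v.
  move=> /(_ isT)/trP[_ [w wB wF']]; have /setP/(_ w) := F'x.
  by rewrite !inE wB wF'.
have Fx : F :&: B x != set0.
  by have /trP[_ [v vB vF]] := xF; apply/set0Pn; exists v; rewrite inE vF.
have [||Z Zn HZ] := IH [set F' in BB | F' :&: B x == set0].
- by move=> F'; rewrite inE => /andP[/HBB].
- move=> DD sDD tDD sDG; rewrite -ltnS.
  have nFD : F \notin DD by apply/negP => /(subsetP sDD); rewrite inE (negPf Fx) andbF.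
  have -> : #|DD|.+1 = #|F |: DD| by rewrite cardsU1 nFD.
  apply: pBB.
  - rewrite subUset sub1set FB; apply/subsetP => F' /(subsetP sDD).
    by rewrite inE => /andP[].
  - have dF F' : F' \in DD -> [disjoint F & F'].
      by move=> /(subsetP sDD); rewrite inE => /andP[]; exact: Hhit.
    apply/trivIsetP => A C; rewrite !inE => /orP[/eqP->|AD] /orP[/eqP->|CD].
    + by rewrite eqxx.
    + by move=> _; exact: dF.
    + by rewrite disjoint_sym => _; exact: dF.
    + exact: (trivIsetP tDD).
  - move=> F'; rewrite !inE => /orP[/eqP->|/sDG//].
    by have [] := HBB F FB.
exists (B x :|: Z).
  apply: leq_trans (leq_card_setU _ _) _; rewrite mulSn leq_add //.
  apply: leq_trans maxB; have /trP[xD _] := xF.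
  exact: (@leq_bigmax_cond _ (fun x => x \in vset D) (fun x => #|B x|)).
move=> F' F'B; have [F'x|F'x] := eqVneq (F' :&: B x) set0.
  have /HZ : F' \in [set F' in BB | F' :&: B x == set0] by rewrite inE F'B F'x eqxx.
  by apply: contraNneq; rewrite setIUr => /eqP; rewrite setU_eq0 => /andP[_ /eqP->].
by apply: contraNneq F'x; rewrite setIUr => /eqP; rewrite setU_eq0 => /andP[/eqP->].
Qed.

Lemma tw_hittable (T : finType) (G : graph T) (k : nat) :
  (tw G < k%:Z)%R -> hittable (adj G) k (vset G).
Proof.
rewrite /tw; case: ex_minnP => n /asboolP[W [D [B [tdB maxB]]]] _ nk.
apply: (tree_decomposition_hittable tdB); rewrite maxB.
(* Treewidth is the largest bag size minus one, so [tw G < k] means bags of size at most [k]. *)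
by move: nk; rewrite Num.Theory.ltrBlDr -[1%R]/(Posz 1) -PoszD ltz_nat addn1 ltnS.
Qed.

(** * Weak coloring numbers *)

Lemma card_fibers (T : finType) (L : {set T}) (key : T -> nat) q b :
  (forall v, v \in L -> key v < q) ->
  (forall i, #|[set v in L | key v == i]| <= b) -> #|L| <= q * b.
Proof.
elim: q L => [|q IH] L kq fb.
  by rewrite (_ : L = set0) ?cards0 //; apply/setP => v; rewrite inE; apply/negP => /kq.
rewrite -(cardsID [set v | key v == q] L) mulSn leq_add //.
  apply: leq_trans (fb q); apply/subset_leq_card/subsetP => v.
  by rewrite !inE => /andP[-> ->].
apply: IH => [v|i]; first by rewrite !inE => /andP[n /kq]; rewrite ltnS leq_eqVlt (negPf n).
apply: leq_trans (fb i); apply/subset_leq_card/subsetP => v.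
by rewrite !inE => /andP[/andP[_ ->] ->].
Qed.

Section WeakColoring.
Variables (T : finType) (e : rel T).
Hypothesis eS : symmetric e.
Implicit Types (A B C F V X Y Z R L S : {set T}) (rho lev : T -> nat).

Local Notation cmp := (cmp e).
Local Notation comps := (comps e).
Local Notation erel := (erel e).

(* Walks instead of paths, and ties in [rho]: both can only make more vertices
   reachable. *)
Definition wreach r A S rho u v :=
  v \in S /\ exists p, [/\ u \in A, path (erel A) u p, last u p = v, size p <= r &
    forall w, w \in u :: p -> w \in S -> rho v <= rho w].

(** [wreach] is a proposition, so the bound is stated for every set [L] of reachable vertices. *)
Definition wcol_le r A S b :=
  exists rho, forall u L, (forall v, v \in L -> wreach r A S rho u v) -> #|L| <= b.

Lemma wcol_leW r A S b b' : b <= b' -> wcol_le r A S b -> wcol_le r A S b'.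
Proof. by move=> bb' [rho H]; exists rho => u L /H /leq_trans; apply. Qed.

Lemma wcol_le_card r A S : wcol_le r A S #|S|.
Proof.
exists (fun=> 0) => u L H; apply/subset_leq_card/subsetP => v /H.
by case.
Qed.

Lemma wcol_le0 r A : wcol_le r A set0 0.
Proof. by rewrite -(@cards0 T); exact: wcol_le_card. Qed.

Lemma erel_path_subS A B x p : path (erel A) x p -> x \in B -> {subset p <= B} ->
  path (erel B) x p.
Proof.
elim: p x => //= y p IH x /andP[/and3P[_ _ exy] pp] xB sp.
have yB : y \in B by apply: sp; rewrite inE eqxx.
by rewrite {1}/erel xB yB exy /= IH // => z zp; apply: sp; rewrite inE zp orbT.
Qed.

Lemma wreachS r A S rho u v B S' rho' :
  wreach r A S rho u v -> v \in S' ->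
  (forall p, u \in A -> path (erel A) u p -> last u p = v ->
     (forall w, w \in u :: p -> w \in S -> rho v <= rho w) ->
     {subset u :: p <= B} /\
     forall w, w \in u :: p -> w \in S' -> rho' v <= rho' w) ->
  wreach r B S' rho' u v.
Proof.
move=> [vS [p [uA pp lp sp min]]] vS' H; split=> //; exists p.
have [sB min'] := H p uA pp lp min.
have uB : u \in B by apply: sB; rewrite inE eqxx.
split=> //; apply: erel_path_subS pp uB _ => z zp.
by apply: sB; rewrite inE zp orbT.
Qed.

Lemma erel_path_sub1 A u p : u \in A -> path (erel A) u p -> {subset u :: p <= A}.
Proof. by move=> uA /erel_path_sub sp w; rewrite inE => /predU1P[->|/sp]. Qed.

Lemma wcol_le_restrict r A S S' b : S :&: A = S' :&: A ->
  wcol_le r A S b -> wcol_le r A S' b.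
Proof.
move=> E [rho H]; exists rho => u L HL; apply: (H u) => v vL.
have SS' w : w \in A -> (w \in S) = (w \in S').
  by move=> wA; have /setP/(_ w) := E; rewrite !inE wA !andbT.
have [vS' [p [uA pp lp sp min]]] := HL v vL.
have vA : v \in A by rewrite -lp; apply: (erel_path_sub1 uA pp); exact: mem_last.
apply: (wreachS (HL v vL)); first by rewrite SS'.
move=> q _ pq lq minq; have sq := erel_path_sub1 uA pq; split=> // w wq wS.
by apply: minq => //; rewrite -SS' //; exact: sq.
Qed.

(** All of [S1] is ranked below the rest, so a walk whose minimum lies outside [S1] avoids [S1]
    altogether. *)
Lemma wcol_leU r A S1 S2 b1 b2 :
  wcol_le r A S1 b1 -> wcol_le r (A :\: S1) S2 b2 ->
  wcol_le r A (S1 :|: S2) (b1 + b2).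
Proof.
move=> [rho1 H1] [rho2 H2]; pose M := \max_x rho1 x.
have leM x : rho1 x <= M by exact: leq_bigmax.
exists (fun v => if v \in S1 then rho1 v else M.+1 + rho2 v) => u L HL.
rewrite -(cardsID S1 L) leq_add //.
  apply: (H1 u) => v; rewrite inE => /andP[vL vS1].
  apply: (wreachS (HL v vL)) => // p uA pp _ minp; split; first exact: erel_path_sub1.
  by move=> w wp wS1; have := minp w wp; rewrite inE vS1 wS1; apply.
apply: (H2 u) => v /setDP[vL vS1].
have [vS _] := HL v vL; have vS2 : v \in S2 by move: vS; rewrite inE (negPf vS1).
apply: (wreachS (HL v vL)) => // p uA pp _ minp.
have nS1 w : w \in u :: p -> w \notin S1.
  move=> wp; apply/negP => wS1; have := minp w wp.
  rewrite inE wS1 (negPf vS1) => /(_ isT); apply/negP; rewrite -ltnNge addSn ltnS.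
  exact: leq_trans (leM w) (leq_addr _ _).
split=> [w wp|w wp wS2]; first by rewrite inE nS1 //; exact: (erel_path_sub1 uA pp).
have := minp w wp; rewrite inE wS2 orbT (negPf vS1) (negPf (nS1 w wp)) leq_add2l.
exact.
Qed.

Lemma wcol_le_comps r A S b :
  (forall C, C \in comps A -> wcol_le r C S b) -> wcol_le r A S b.
Proof.
move=> H; have /choice[rho Hrho] : forall C, exists rho, C \in comps A ->
    forall u L, (forall v, v \in L -> wreach r C S rho u v) -> #|L| <= b.
  move=> C; have [CA|] := boolP (C \in comps A); last by exists (fun=> 0).
  by have [rho Hr] := H C CA; exists rho.
exists (fun v => rho (cmp A v) v) => u L HL.
have [->|/set0Pn[v0 v0L]] := eqVneq L set0; first by rewrite cards0.
have [_ [p0 [uA _ _ _ _]]] := HL v0 v0L.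
apply: (Hrho _ (mem_comps e uA) u) => v vL; have [vS _] := HL v vL.
apply: (wreachS (HL v vL)) => // p _ pp lp minp.
have sp w : w \in u :: p -> w \in cmp A u.
  move=> wp; have wA := erel_path_sub1 uA pp wp.
  by rewrite inE wA (path_connect pp wp).
have cE w : w \in u :: p -> cmp A w = cmp A u.
  by move=> /sp wu; apply/esym/comp_eq.
split=> // w wp wS; have := minp w wp wS.
by rewrite (cE w wp) cE // -lp; exact: mem_last.
Qed.

(** The cost [b2] is paid once, whatever the number of components: after [S1], a walk sees a single
    component. *)
Lemma wcol_le_refine r A S1 (S_ : {set T} -> {set T}) b1 b2 :
  wcol_le r A S1 b1 ->
  (forall C, C \in comps (A :\: S1) -> S_ C \subset C /\ wcol_le r C (S_ C) b2) ->
  wcol_le r A (S1 :|: \bigcup_(C in comps (A :\: S1)) S_ C) (b1 + b2).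
Proof.
move=> H1 H2; apply: wcol_leU => //; apply: wcol_le_comps => C CA.
have [sC] := H2 C CA; apply: wcol_le_restrict; apply/setP => x.
rewrite !inE; case xC: (x \in C); rewrite ?andbF // !andbT.
apply/idP/bigcupP => [xS|[C' C'A xS]]; first by exists C.
have [sC' _] := H2 C' C'A.
by rewrite (comps_eq eS CA C'A xC (subsetP sC' x xS)).
Qed.

Lemma comps_refine A S1 (S_ : {set T} -> {set T}) D :
  (forall C, C \in comps (A :\: S1) -> S_ C \subset C) ->
  D \in comps (A :\: (S1 :|: \bigcup_(C in comps (A :\: S1)) S_ C)) ->
  exists2 C, C \in comps (A :\: S1) & D \in comps (C :\: S_ C).
Proof.
set S2 := \bigcup_(C in _) _ => sS DA; have cD := comps_conn eS DA.
have /set0Pn[d dD] := comps_neq0 DA; have sD := comps_sub DA.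
have sD1 : D \subset A :\: S1 by apply: subset_trans sD _; rewrite setDS // subsetUl.
have dA := subsetP sD1 d dD; set C := cmp (A :\: S1) d.
have CA : C \in comps (A :\: S1) by exact: mem_comps.
have sDC : D \subset C by exact: conn_sub_comp.
exists C => //; apply: conn_comps (comps_neq0 DA) cD _.
  rewrite subsetD sDC; apply/pred0P => x /=; apply/negP => /andP[xD xS].
  have := subsetP sD x xD; rewrite !inE negb_or => /andP[/andP[_ nS2] _].
  by case/negP: nS2; apply/bigcupP; exists C.
move=> x y xD; rewrite inE => /andP[yS yC] exy; apply: (comps_nbr eS DA xD _ exy).
have := subsetP (comps_sub CA) y yC; rewrite inE => /andP[yS1 yA].
rewrite in_setD in_setU negb_or yS1 yA andbT /=.
apply/bigcupP => -[C' C'A yS'].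
by move: yS; rewrite (comps_eq eS CA C'A yC (subsetP (sS C' C'A) y yS')) yS'.
Qed.

(* Levels increase only across edges leaving [S], so a walk can climb down to a
   vertex of [S] of minimum level only one level at a time. *)
Definition levelled A S lev :=
  forall x y, x \in A -> y \in A -> e x y -> lev x < lev y ->
  lev y = (lev x).+1 /\ x \in S.

(** * Weak colouring along levels *)

Section Levels.
Variables (A S : {set T}) (lev : T -> nat).
Hypothesis levP : levelled A S lev.

(** The last vertex below level [n] would start an upward edge and hence lie in [S]. *)
Lemma levelled_path_ge n u p : u \in A -> path (erel A) u p ->
  (forall w, w \in u :: p -> w \in S -> n <= lev w) -> n <= lev (last u p) ->
  forall w, w \in u :: p -> n <= lev w.
Proof.
elim: p u => [|z p IH] u uA /= pp HS Hl w; first by rewrite inE => /eqP->.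
case/andP: pp => /and3P[_ zA euz] pp.
have Hz : forall w, w \in z :: p -> n <= lev w.
  by apply: IH => // x xp; apply: HS; rewrite inE xp orbT.
rewrite inE => /predU1P[->|/Hz//].
have [zu|uz] := leqP (lev z) (lev u).
  by apply: leq_trans zu; apply: Hz; rewrite inE eqxx.
have [_ uS] := levP uA zA euz uz; apply: HS => //; by rewrite inE eqxx.
Qed.

Lemma levelled_edge x y : x \in A -> y \in A -> e x y -> lev y <= (lev x).+1.
Proof.
move=> xA yA exy; have [yx|xy] := leqP (lev y) (lev x); first exact: leqW.
by have [-> _] := levP xA yA exy xy.
Qed.

Lemma levelled_path_size u p : u \in A -> path (erel A) u p ->
  lev u <= lev (last u p) + size p /\ lev (last u p) <= lev u + size p.
Proof.
elim: p u => [|z p IH] u uA /=; first by rewrite addn0.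
case/andP=> /and3P[_ zA euz] pp; have [h1 h2] := IH z zA pp.
have uz := levelled_edge uA zA euz; rewrite eS in euz.
have zu := levelled_edge zA uA euz; rewrite !addnS; split.
  by apply: leq_trans zu _; rewrite ltnS.
by apply: leq_trans h2 _; rewrite -addSn leq_add2r.
Qed.

(** Whichever way a walk passes between levels [n] and [n + 1], the lower end of the edge used lies
    in [S]. *)
Lemma levelled_path_cross u p n : u \in A -> path (erel A) u p ->
  (lev u <= n < lev (last u p)) || (lev (last u p) <= n < lev u) ->
  exists w, [/\ w \in u :: p, w \in S & lev w = n].
Proof.
elim: p u => [|z p IH] u uA /= pp.
  by case/orP=> /andP[h1 h2]; have := leq_ltn_trans h1 h2; rewrite ltnn.
case/andP: pp => /and3P[_ zA euz] pp.
have zu : e z u by rewrite eS.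
case/orP=> /andP[h1 h2].
  have [zn|nz] := leqP (lev z) n.
    have [|w [wp wS wn]] := IH z zA pp; first by rewrite zn h2.
    by exists w; rewrite inE wp orbT.
  have uz : lev u < lev z by exact: leq_ltn_trans nz.
  have [E uS] := levP uA zA euz uz; exists u; rewrite inE eqxx uS; split=> //.
  by apply/eqP; rewrite eqn_leq h1 -ltnS -E.
have [zn|nz] := leqP (lev z) n; last first.
  have [|w [wp wS wn]] := IH z zA pp; first by rewrite h1 nz orbT.
  by exists w; rewrite inE wp orbT.
have uz : lev z < lev u by exact: leq_ltn_trans h2.
have [E zS] := levP zA uA zu uz; exists z; rewrite !inE eqxx orbT zS; split=> //.
by apply/eqP; rewrite eqn_leq zn -ltnS -E.
Qed.

(** Vertices are ranked by level first and by [rho] within a level. A walk with minimum [v] then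
    stays on levels at least [lev v], and since an edge changes the level by at most one, [lev v]
    takes at most [r + 1] values for a given start. *)
Lemma wcol_le_levels r b :
  (forall n, wcol_le r [set x in A | n <= lev x] [set x in S | lev x == n] b) ->
  wcol_le r A S (r.+1 * b).
Proof.
move=> /choice[rho Hrho]; pose M := \max_x rho (lev x) x.
have leM x : rho (lev x) x <= M by exact: (leq_bigmax (F := fun x => rho (lev x) x)).
exists (fun v => lev v * M.+1 + rho (lev v) v) => u L HL.
have rhoP v w : lev v * M.+1 + rho (lev v) v <= lev w * M.+1 + rho (lev w) w ->
    lev v <= lev w /\ (lev w = lev v -> rho (lev v) v <= rho (lev v) w).
  move=> h; split; last by move=> E; move: h; rewrite E leq_add2l.
  rewrite leqNgt; apply/negP => wv; move: h; apply/negP; rewrite -ltnNge.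
  apply: (@leq_trans ((lev w).+1 * M.+1)); last by rewrite (leq_trans _ (leq_addr _ _)) // leq_mul2r wv orbT.
  by rewrite mulSn addnC ltn_add2r ltnS.
have HL' v : v \in L -> lev v <= lev u <= lev v + r /\
    wreach r [set x in A | lev v <= lev x] [set x in S | lev x == lev v] (rho (lev v)) u v.
  move=> vL; have [vS [p [uA pp lp sp minp]]] := HL v vL.
  have ge q : path (erel A) u q -> last u q = v ->
      (forall w, w \in u :: q -> w \in S ->
        lev v * M.+1 + rho (lev v) v <= lev w * M.+1 + rho (lev w) w) ->
      forall w, w \in u :: q -> lev v <= lev w.
    move=> pq lq minq; apply: levelled_path_ge => //; last by rewrite lq.
    by move=> w wq wS; have [] := rhoP _ _ (minq w wq wS).
  have [h1 _] := levelled_path_size uA pp; rewrite lp in h1; split.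
    rewrite (ge p) ?inE ?eqxx //=; exact: leq_trans h1 (leq_add _ _).
  apply: (wreachS (HL v vL)); first by rewrite inE vS eqxx.
  move=> q _ pq lq minq; split=> [w wq|w wq].
    by rewrite inE (ge q) // andbT; exact: (erel_path_sub1 uA pq).
  by rewrite inE => /andP[wS /eqP E]; have [_ /(_ E)] := rhoP _ _ (minq w wq wS).
apply: (card_fibers (key := fun v => lev u - lev v)) => [v /HL'[/andP[_ h] _]|i].
  by rewrite ltnS leq_subLR.
apply: (Hrho (lev u - i) u) => v; rewrite inE => /andP[vL /eqP E].
have [/andP[h1 h2] h3] := HL' v vL.
by have -> : lev u - i = lev v by rewrite -E subKn.
Qed.

(* Ranking the levels by the 2-adic valuation of their index: the levels seen
   from a given one are records of the valuation, of which there are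
   logarithmically many within distance [r]. *)
Lemma higher_valuation_between a b : a < b -> 0 < a -> logn 2 a = logn 2 b ->
  exists2 j, a < j < b & logn 2 a < logn 2 j.
Proof.
move=> ab a0 E; have b0 : 0 < b by exact: leq_ltn_trans ab.
have [[|x] x2 Ex] := pfactor_coprime (isT : prime 2) a0; first by move: x2; rewrite coprime_sym.
have [y y2 Ey] := pfactor_coprime (isT : prime 2) b0.
rewrite -E in Ey; set m := logn 2 a in Ex Ey *.
have m0 : 0 < 2 ^ m by rewrite expn_gt0.
have ox : odd x.+1 by move: x2; rewrite coprime2n.
have oy : odd y by move: y2; rewrite coprime2n.
have xy : x.+1 < y by move: ab; rewrite Ex Ey ltn_pmul2r.
have xy2 : x.+2 < y.
  by rewrite ltn_neqAle xy andbT; apply: contraTneq oy => <-; rewrite oddS ox.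
(* Here [a] and [b] are odd multiples of [2 ^ m]; the even multiple right after [a] lies strictly
   between them. *)
exists (x.+2 * 2 ^ m); first by rewrite Ex Ey !ltn_pmul2r // ltnSn.
rewrite lognM // pfactorK // -[X in X < _]add0n ltn_add2r.
by rewrite logn_gt0 mem_primes /= dvdn2 oddS ox.
Qed.

(** [2 ^ c] divides the positive number [b - a], which is at most [r]. *)
Lemma valuation_small a b r c : a < b -> 0 < a -> 0 < r -> b <= a + r ->
  c <= logn 2 a -> c <= logn 2 b -> c <= trunc_log 2 r.
Proof.
move=> ab a0 r0 bar ca cb; apply: trunc_log_max => //.
have b0 : 0 < b by exact: leq_ltn_trans ab.
apply: (@leq_trans (b - a)); last by rewrite leq_subLR.
apply: dvdn_leq; first by rewrite subn_gt0.
by rewrite dvdn_sub // pfactor_dvdn.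
Qed.

Lemma wcol_le_log_levels r b : 0 < r ->
  (forall n, #|[set x in S | lev x == n]| <= b) ->
  wcol_le r A S (((trunc_log 2 r).+2.*2).+1 * b).
Proof.
(* Levels start at 0, so the valuation is taken of the index plus one; subtracting it from [M] ranks
   high valuations first. *)
move=> r0 Hb; pose val n := logn 2 n.+1; pose M := \max_x val (lev x).
have leM x : val (lev x) <= M by exact: (leq_bigmax (F := fun x => val (lev x))).
exists (fun v => M - val (lev v)) => u L HL.
set s := trunc_log 2 r; set m := lev u.
have rec v : v \in L -> [/\ v \in S, lev v <= m + r, m <= lev v + r &
    forall n, (m <= n < lev v) || (lev v <= n < m) -> val n <= val (lev v)].
  move=> vL; have [vS [p [uA pp lp sp minp]]] := HL v vL.
  have [h1 h2] := levelled_path_size uA pp; rewrite lp in h1 h2; split=> //.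
  - by apply: leq_trans h2 _; rewrite leq_add2l.
  - by apply: leq_trans h1 _; rewrite leq_add2l.
  move=> n hn; have [|w [wp wS <-]] := levelled_path_cross (n := n) uA pp; first by rewrite lp.
  by have := minp w wp wS; rewrite leq_subCl subKn.
(* On each side of level [m], the valuations of the seen levels increase strictly away from [m], and
   all but the farthest are at most [s]; truncation at [s + 1] therefore keeps them distinct. Each
   side uses [s + 2] keys and level [m] one more. *)
pose key v := if lev v == m then s.+2.*2 else
  (if lev v < m then 0 else s.+2) + minn (val (lev v)) s.+1.
have between x y : x < y -> val x = val y -> exists2 n, x < n < y & val x < val n.
  move=> xy E; have [[//|j] hj h] := higher_valuation_between (xy : x.+1 < y.+1) isT E.
  by exists j.
have below v w : v \in L -> w \in L -> lev v < lev w < m -> val (lev w) < minn (val (lev v)) s.+1.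
  move=> vL wL /andP[vw wm]; have [_ _ hm Hv] := rec v vL.
  have le : val (lev w) <= val (lev v) by apply: Hv; rewrite (ltnW vw) wm orbT.
  have lt : val (lev w) < val (lev v).
    rewrite ltn_neqAle le andbT; apply/eqP => E.
    have [n /andP[vn nw] h] := between _ _ vw (esym E).
    by have := Hv n; rewrite (ltnW vn) (ltn_trans nw wm) orbT leqNgt h => /(_ isT).
  rewrite leq_min lt ltnS; apply: (@valuation_small (lev v).+1 (lev w).+1 r) => //.
  by rewrite addSn; exact: leq_trans wm (leqW hm).
have above v w : v \in L -> w \in L -> m < lev v < lev w -> val (lev v) < minn (val (lev w)) s.+1.
  move=> vL wL /andP[mv vw]; have [_ hm _ Hw] := rec w wL.
  have le : val (lev v) <= val (lev w) by apply: Hw; rewrite (ltnW mv) vw.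
  have lt : val (lev v) < val (lev w).
    rewrite ltn_neqAle le andbT; apply/eqP => E.
    have [n /andP[vn nw] h] := between _ _ vw E.
    by have := Hw n; rewrite nw (ltnW (ltn_trans mv vn)) => /(_ isT); rewrite -E leqNgt h.
  rewrite leq_min lt ltnS; apply: (@valuation_small (lev v).+1 (lev w).+1 r) => //.
  by rewrite addSn ltnS; apply: leq_trans hm _; rewrite leq_add2r ltnW.
have min_s x : minn x s.+1 < s.+2 by rewrite ltnS geq_minr.
have s2 : s.+2.*2 = s.+2 + s.+2 by rewrite addnn.
have key_lt v : key v < (s.+2.*2).+1.
  rewrite /key; case: eqP => // _; rewrite ltnW // s2 ltnS.
  case: ifP => _; last by rewrite ltn_add2l min_s.
  by rewrite add0n; apply: leq_trans (min_s _) (leq_addr _ _).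
have key_neq v w : v \in L -> w \in L -> lev v < lev w -> key v != key w.
  move=> vL wL vw; rewrite /key.
  have [vm|vm|vm] := ltngtP (lev v) m.
  - have [wm|wm|wm] := ltngtP (lev w) m.
    + rewrite !add0n; have := below v w vL wL; rewrite vw wm => /(_ isT) h.
      by rewrite gtn_eqF // (leq_ltn_trans (geq_minl _ _)).
    + by rewrite add0n ltn_eqF // (leq_trans (min_s _)) ?leq_addr.
    + by rewrite add0n ltn_eqF // (leq_trans (min_s _)) // s2 leq_addr.
  - have mw := ltn_trans vm vw; rewrite (gtn_eqF mw) ltnNge (ltnW mw) /=.
    have := above v w vL wL; rewrite vm vw => /(_ isT) h.
    by rewrite eqn_add2l ltn_eqF // (leq_ltn_trans (geq_minl _ _)).
  - rewrite -vm in vw *; rewrite (gtn_eqF vw) ltnNge (ltnW vw) /=.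
    by rewrite gtn_eqF // s2 ltn_add2l.
apply: (card_fibers (key := key)) => [v _|i]; first exact: key_lt.
set Li := [set v in L | _]; have [->|/set0Pn[v0 v0L]] := eqVneq Li set0; first by rewrite cards0.
apply: leq_trans (Hb (lev v0)); apply/subset_leq_card/subsetP => v.
move: v0L; rewrite !inE => /andP[v0L k0] /andP[vL kv]; have [-> _ _ _] := rec v vL.
have E : key v = key v0 by rewrite (eqP kv) (eqP k0).
by case: ltngtP => // h; [have := key_neq _ _ vL v0L h|have := key_neq _ _ v0L vL h]; rewrite E eqxx.
Qed.

End Levels.
End WeakColoring.

(** * Universal graphs of bounded rooted 2-treedepth *)

(** An edge may be listed in one orientation only, as in [apex]; contact between branch sets is
    symmetric. *)
Record pattern := Pattern { pvertex :> finType; pedge : rel pvertex }.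

Definition embeds (P Q : pattern) := exists f : P -> Q,
  injective f /\ forall x y, pedge x y -> pedge (f x) (f y).

Lemma embeds_refl P : embeds P P.
Proof. by exists id; split. Qed.

Definition edgeless n := @Pattern 'I_n (fun _ _ => false).

Definition psum (P Q : pattern) := @Pattern (P + Q)%type (fun x y =>
  match x, y with
  | inl u, inl v => pedge u v
  | inr u, inr v => pedge u v
  | _, _ => false
  end).

Definition copies d (P : pattern) := @Pattern ('I_d * P)%type
  (fun x y => (x.1 == y.1) && pedge x.2 y.2).

Definition apex (P : pattern) := @Pattern (option P) (fun x y =>
  match x, y with
  | None, Some _ => true
  | Some u, Some v => pedge u v
  | _, _ => false
  end).

(** [None] is the root, and [Some (i, u, z)] is the vertex [z] of the smaller tree rooted at the
    vertex [u] of copy [i]. *)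
Fixpoint tree_vertex (h d : nat) (U : finType) : finType :=
  if h is h'.+1 then option ('I_d * U * tree_vertex h' d U)%type else unit.

Definition tree_root h d U : tree_vertex h d U :=
  match h with 0 => tt | _.+1 => None end.

Fixpoint tree_edge h d (U : finType) (E : rel U) : rel (tree_vertex h d U) :=
  match h return rel (tree_vertex h d U) with
  | 0 => fun _ _ => false
  | h'.+1 => fun x y =>
    match x, y with
    | None, Some (_, z) | Some (_, z), None => z == tree_root h' d U
    | Some (i, u, z), Some (j, v, w) => (i == j) &&
        ((u == v) && tree_edge E z w ||
         [&& E u v, z == tree_root h' d U & w == tree_root h' d U])
    | None, None => false
    end
  end.

(* A root joined to [d] disjoint copies of [P], each vertex of which is the root
   of a tree of height [h - 1] of the same kind. *)
Definition ptree h d (P : pattern) := Pattern (@tree_edge h d P (@pedge P)).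

Inductive universal : nat -> pattern -> Prop :=
  | Universal1 n : universal 1 (edgeless n.+1)
  | UniversalS t P h d : universal t P -> universal t.+1 (ptree h d P).

Lemma universal_inhabited t P : universal t P -> inhabited P.
Proof.
by case=> [n|t' Q h d _]; [exists; exact: ord0|exists; exact: (tree_root h d Q)].
Qed.

Lemma ptree_mono h h' d d' (P Q : pattern) : h <= h' -> d <= d' -> embeds P Q ->
  exists f : ptree h d P -> ptree h' d' Q, [/\ injective f,
    f (tree_root h d P) = tree_root h' d' Q &
    forall x y, pedge x y -> pedge (f x) (f y)].
Proof.
move=> + led [f [fI fE]].
elim: h h' => [|h IH] h' leh.
  by exists (fun=> tree_root h' d' Q); split=> // -[] [].
case: h' leh => // h' leh; have [g [gI g0 gE]] := IH h' leh.
exists (fun x => if x is Some (j, u, z) then Some (widen_ord led j, f u, g z) else None).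
split=> //.
- move=> [[[i u] z]|] [[[j v] w]|] //= [/ord_inj -> /fI -> /gI ->] //.
- move=> [[[i u] z]|] [[[j v] w]|] //=; try by move=> /eqP->; rewrite g0.
  case/andP=> /eqP->; rewrite eqxx /= => /orP[/andP[/eqP-> zw]|/and3P[uv /eqP-> /eqP->]].
    by rewrite eqxx; have /= -> := gE _ _ zw.
  by rewrite fE // g0 eqxx orbT.
Qed.

Lemma ptree_attach h d (P1 P2 Q : pattern) : embeds (psum P1 P2) Q ->
  exists (f : ptree h d P1 -> ptree h.+1 d.+1 Q) (g : ptree h d P1 -> P2 -> ptree h.+1 d.+1 Q),
  [/\ injective f /\ f (tree_root h d P1) = None,
      forall x y, pedge x y -> pedge (f x) (f y),
      forall x, injective (g x) /\ forall u v, pedge u v -> pedge (g x u) (g x v),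
      forall x u, pedge (f x) (g x u) /\ pedge (g x u) (f x) &
      forall x y u, f x <> g y u].
Proof.
move=> [q [qI qE]].
have qE1 u v : pedge u v -> pedge (q (inl u)) (q (inl v)) by move=> uv; apply: qE.
have qE2 u v : pedge u v -> pedge (q (inr u)) (q (inr v)) by move=> uv; apply: qE.
elim: h => [|h [f [g [[fI f0] fE gP fg fg']]]].
  exists (fun=> None), (fun _ u => Some (ord0, q (inr u), tree_root 0 d.+1 Q)); split=> //.
  - by split=> // -[] [].
  - by move=> x; split=> [u v [/qI[]]//|u v uv] /=; rewrite qE2 ?orbT.
exists (fun x => if x is Some (j, u, z) then Some (widen_ord (leqnSn d) j, q (inl u), f z) else None).
exists (fun x v => if x is Some (j, u, z) then Some (widen_ord (leqnSn d) j, q (inl u), g z v)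
  else Some (ord_max, q (inr v), tree_root h.+1 d.+1 Q)).
split.
- split=> // -[[[i u] z]|] [[[j v] w]|] //= [/ord_inj -> /qI[->] /fI -> //].
- move=> [[[i u] z]|] [[[j v] w]|] //=; try by move=> /eqP->; rewrite f0.
  case/andP=> /eqP->; rewrite eqxx /= => /orP[/andP[/eqP-> zw]|/and3P[uv /eqP-> /eqP->]].
    by rewrite eqxx; have /= -> := fE _ _ zw.
  by rewrite qE1 // f0 eqxx orbT.
- move=> [[[i u] z]|]; split=> [x y|x y xy] /=.
  + by case=> /(proj1 (gP z)).
  + by rewrite !eqxx; have /= -> := proj2 (gP z) _ _ xy.
  + by case=> /qI[].
  + by rewrite !eqxx qE2 ?orbT.
- move=> [[[i u] z]|] x /=; last by rewrite eqxx.
  by rewrite !eqxx; have /= [-> ->] := fg z x.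
- move=> [[[i u] z]|] [[[j v] w]|] x //= [].
    by move=> _ _; exact: fg'.
  by move=> E; have := ltn_ord i; rewrite E ltnn.
Qed.

(** The two trees are hung at the same vertex [r] of the first two copies of [R] in a tree one level
    higher; hence [.+1] on the height and [.+2] on the number of copies. *)
Lemma universal_sum t P Q : universal t P -> universal t Q ->
  exists2 R, universal t R & embeds (psum P Q) R.
Proof.
move=> tP; elim: tP Q => {t P} [n|t P h d tP IH] Q tQ; inversion tQ as [m E1 E2|t' Q' h' d' tQ' E1 E2].
- exists (edgeless (n.+1 + m).+1); first exact: Universal1.
  rewrite -addnS; exists (fun x => unsplit x); split; first exact: can_inj (@unsplitK _ _).
  by move=> [x|x] [y|y].
- by inversion tQ'.
- by move: tP; rewrite -E1 => tP; inversion tP.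
have [R tR PQR] := IH Q' tQ'; have [r] := universal_inhabited tR.
exists (ptree (maxn h h').+1 (maxn d d').+2 R); first exact: UniversalS.
have [q [qI qE]] := PQR.
have PR : embeds P R.
  by exists (q \o inl); split=> [x y /qI[]//|x y xy]; exact: (qE (inl x) (inl y)).
have QR : embeds Q' R.
  by exists (q \o inr); split=> [x y /qI[]//|x y xy]; exact: (qE (inr x) (inr y)).
have led : maxn d d' <= (maxn d d').+2 by rewrite !leqW.
have [f [fI _ fE]] := ptree_mono (leq_maxl h h') (leq_trans (leq_maxl d d') led) PR.
have [g [gI _ gE]] := ptree_mono (leq_maxr h h') (leq_trans (leq_maxr d d') led) QR.
exists (fun x => match x with inl u => Some (ord0, r, f u)
  | inr u => Some (lift ord0 ord0, r, g u) end); split.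
  by move=> [x|x] [y|y] // [] => [/fI->|/gI->].
by move=> [x|x] [y|y] //= xy; rewrite !eqxx; [have /= -> := fE _ _ xy|have /= -> := gE _ _ xy].
Qed.

Lemma universal_copies t P d : universal t P ->
  exists2 Q, universal t Q & embeds (copies d P) Q.
Proof.
move=> tP; elim: d => [|d [Q tQ [f [fI fE]]]].
  have [p] := universal_inhabited tP; exists P => //; exists (fun=> p).
  by split=> [[[]]|[[]]].
have [R tR [q [qI qE]]] := universal_sum tP tQ; exists R => //.
exists (fun x => q (if unlift ord0 x.1 is Some j then inr (f (j, x.2)) else inl x.2)).
split=> [[i u] [j v] /qI /=|[i u] [j v] /= /andP[/eqP-> uv]].
  case: unliftP => [i' ->|->]; case: unliftP => [j' ->|->] //.
    by case=> /fI[-> ->].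
  by case=> ->.
apply: qE => /=; case: unliftP => [j' _|//].
by apply: fE; rewrite /= eqxx.
Qed.

Lemma embeds_apex P Q : embeds P Q -> embeds (apex P) (apex Q).
Proof.
move=> [f [fI fE]]; exists (omap f); split.
  by move=> [x|] [y|] //= [/fI->].
by move=> [x|] [y|] //=; exact: fE.
Qed.

(** * Embedding into universal patterns *)

Lemma rtd2_gt0 (U : finType) (X : graph U) : vset X != set0 -> 0 < rtd2 X.
Proof.
move: {2}#|vset X|.+1 (ltnSn #|vset X|) => n; elim: n X => // n IH X nX X0.
have [X1|X1] := leqP #|vset X| 1; first by rewrite rtd2_small // card_gt0.
have [[A B] /= sep ->] := rtd2_attained X1.
rewrite /rtd2_value leq_max IH //; last by case/and5P: sep => _ _ _ _ /andP[].
exact: leq_trans (rtd2_separation_ltl sep) nX.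
Qed.

Lemma universal_nonempty t : 0 < t -> exists P, universal t P.
Proof.
elim: t => // -[|t] IH _; first by exists (edgeless 1); exact: Universal1.
by have [P tP] := IH isT; exists (ptree 0 0 P); exact: UniversalS.
Qed.

Definition graph_embeds (U : finType) (X : graph U) (P : pattern) :=
  exists f : U -> P, {in vset X &, injective f} /\
    forall x y, adj X x y -> pedge (f x) (f y).

(** A separation of order zero gives a disjoint sum. For one with a common vertex [u], the rest [B']
    has smaller rooted 2-treedepth and is hung at the image of [u] by [ptree_attach]; all neighbours
    of [u] in [B'] are then served at once. *)
Lemma rtd2_universal t (U : finType) (X : graph U) : 0 < t -> rtd2 X <= t ->
  exists2 P, universal t P & graph_embeds X P.
Proof.
move: {2}#|vset X|.+1 (ltnSn #|vset X|) => n; elim: n t X => // n IH t X nX t0 Xt.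
have [X1|X1] := leqP #|vset X| 1.
  have [P tP] := universal_nonempty t0; have [p] := universal_inhabited tP.
  exists P => //; exists (fun=> p); split=> [x y xX yX _|x y].
    by have /card_le1_eqP := X1; apply.
  by case/adj_vset=> xX yX /eqP[]; have /card_le1_eqP := X1; apply.
have [[A B] /= sep XE] := rtd2_attained X1.
move: Xt; rewrite XE /rtd2_value geq_max => /andP[At Bt].
set B' := delete B (vset A) in Bt.
have ltA := leq_trans (rtd2_separation_ltl sep) (nX : #|vset X| <= n).
have ltB := leq_trans (rtd2_separation_ltr sep) (nX : #|vset X| <= n).
have [/eqP VE /eqP EE _ AB1] := and5P sep; move=> /andP[A0 BA0].
have [P1 tP1 [f1 [f1I f1E]]] := IH t A ltA t0 At.
have inB' x : x \in vset X -> x \notin vset A -> x \in vset B'.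
  by rewrite -VE vset_delete !inE => /orP[->//|->] ->.
have adjX x y : adj X x y -> adj A x y \/ adj B x y.
  by rewrite /adj -EE inE => /orP[]; [left|right].
have adjB' x y : adj B x y -> x \notin vset A -> y \notin vset A -> adj B' x y.
  by move=> xy xA yA; rewrite adj_induced !inE xA yA.
have [AB0|[u uE]] : #|vset A :&: vset B| = 0 \/ exists u, vset A :&: vset B = [set u].
- move: AB1; rewrite leq_eqVlt ltnS leqn0 => /orP[/cards1P[u ->]|/eqP]; last by left.
  by right; exists u.
- have [|P2 tP2 [f2 [f2I f2E]]] := IH t B' ltB t0; first by move: Bt; rewrite AB0 addn0.
  have [Q tQ [q [qI qE]]] := universal_sum tP1 tP2; exists Q => //.
  exists (fun x => q (if x \in vset A then inl (f1 x) else inr (f2 x))); split.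
    move=> x y xX yX /qI; case: ifPn => xA; case: ifPn => yA // -[].
      exact: f1I.
    by apply: f2I; exact: inB'.
  have nA x : x \in vset B -> x \notin vset A.
    move=> xB; apply/negP => xA; move/eqP: AB0; rewrite cards_eq0 => /eqP/setP/(_ x).
    by rewrite !inE xA xB.
  move=> x y /adjX[xy|xy]; apply: qE.
    by have [-> -> _] := adj_vset xy; exact: f1E.
  have [/nA xA /nA yA _] := adj_vset xy; rewrite (negPf xA) (negPf yA).
  exact/f2E/adjB'.
(* [B'] is nonempty, so its value is positive and [t] is at least 2; the pattern for [A] is then a
   tree. *)
have [s tE s0] : exists2 s, t = s.+1 & 0 < s.
  have B'0 : 0 < rtd2 B' by apply: rtd2_gt0; rewrite vset_delete.
  move: Bt; rewrite uE cards1 addn1 => B't.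
  by case: t t0 B't {At tP1} => // s _ B's; exists s => //; apply: leq_trans B'0 _.
have [|P2 tP2 [f2 [f2I f2E]]] := IH s B' ltB s0; first by move: Bt; rewrite uE cards1 addn1 tE.
rewrite tE in tP1 *; inversion tP1 as [m E1 E2|s' P0 h d tP0 E1 E2].
  by rewrite -E1 in s0.
rewrite -{}E2 in f1 f1I f1E tP1 *.
have [Q tQ PQ] := universal_sum tP0 tP2.
have [f [g [[fI _] fE gP fg fg']]] := ptree_attach h d PQ.
exists (ptree h.+1 d.+1 Q); first exact: UniversalS.
exists (fun x => if x \in vset A then f (f1 x) else g (f1 u) (f2 x)); split.
  move=> x y xX yX; case: ifPn => xA; case: ifPn => yA.
  - by move/fI/f1I; apply.
  - by move/fg'.
  - by move/esym/fg'.
  - by move/(proj1 (gP _))/f2I; apply; exact: inB'.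
have uA x : x \in vset B -> x \in vset A -> x = u.
  by move=> xB xA; apply/set1P; rewrite -uE inE xA.
move=> x y /adjX[xy|xy].
  by have [-> -> _] := adj_vset xy; apply/fE/f1E.
have [xB yB nxy] := adj_vset xy.
case: ifPn => xA; case: ifPn => yA.
- by move: nxy; rewrite (uA x) // (uA y) // eqxx.
- by rewrite (uA x) //; have [] := fg (f1 u) (f2 y).
- by rewrite (uA y) //; have [] := fg (f1 u) (f2 x).
- by apply: (proj2 (gP _)); exact/f2E/adjB'.
Qed.

(** * Rich models and gluing along trees *)

Section Solutions.
Variables (T : finType) (e : rel T).
Hypothesis eS : symmetric e.
Implicit Types (A B C D F V X Y Z R S : {set T}) (FF : {set {set T}}) (P Q : pattern).

Local Notation conn := (conn e).
Local Notation cmp := (cmp e).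
Local Notation comps := (comps e).
Local Notation ncomp := (ncomp e).
Local Notation touch := (touch e).

Definition rmodel FF V P (B : P -> {set T}) :=
  [/\ forall x, [/\ B x \subset V, conn (B x) & exists2 F, F \in FF & F \subset B x],
      forall x y, x != y -> [disjoint B x & B y] &
      forall x y, pedge x y -> touch (B x) (B y)].

Definition rich FF V P := exists B : P -> {set T}, rmodel FF V B.

Lemma richS FF V V' P : V \subset V' -> rich FF V P -> rich FF V' P.
Proof.
move=> sV [B [B1 B2 B3]]; exists B; split=> // x.
by have [sB cB FB] := B1 x; split=> //; exact: subset_trans sV.
Qed.

Lemma rich_embeds FF V P Q : embeds P Q -> rich FF V Q -> rich FF V P.
Proof.
move=> [f [fI fE]] [B [B1 B2 B3]]; exists (B \o f); split=> [x|x y nxy|x y /fE/B3//].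
  exact: B1.
by apply: B2; apply: contra nxy => /eqP/fI->.
Qed.

(** Condition (B) appears as a count of all components of [V :\: C]; this is used for connected [V],
    where each of them contains a neighbour of [C]. *)
Definition solution V FF (b : nat -> nat) := exists S,
  [/\ S \subset V, forall F, F \in FF -> F \subset V -> F :&: S != set0,
      forall C, C \in comps (V :\: S) -> ncomp (V :\: C) <= 2 &
      forall r, 1 < r -> wcol_le e r V S (b r)].

Lemma solutionW V FF b b' : (forall r, 1 < r -> b r <= b' r) ->
  solution V FF b -> solution V FF b'.
Proof.
move=> bb' [S [sS hS cS wS]]; exists S; split=> // r r1.
exact: wcol_leW (bb' r r1) (wS r r1).
Qed.

Lemma unhit_in_comp V S F : F \subset V -> F != set0 -> conn F -> F :&: S = set0 ->
  exists2 C, C \in comps (V :\: S) & F \subset C.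
Proof.
move=> sFV /set0Pn[x xF] cF FS.
have sF : F \subset V :\: S by rewrite subsetD sFV -setI_eq0 FS eqxx.
exists (cmp (V :\: S) x); first by apply: mem_comps; exact: (subsetP sF).
exact: conn_sub_comp.
Qed.

Lemma setD_trans V C D : D \subset C -> C \subset V ->
  V :\: D = (V :\: C) :|: (C :\: D).
Proof.
move=> sDC sCV; apply/setP => x; rewrite !inE.
have := subsetP sDC x; have := subsetP sCV x.
by case: (x \in V); case: (x \in C); case: (x \in D) => //= h1 h2; (by have := h1 isT) || (by have := h2 isT).
Qed.

(** The complement of a component [D] of [C :\: S_ C] is the union of [V :\: C] and [C :\: D], so it
    has at most [m1 + m2] components. Applying [separate] with the empty family inside [D] brings
    this back to two at the price of [(m1 + m2) * k] vertices. *)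
Lemma refine_fix V A k S1 (S_ : {set T} -> {set T}) m1 m2 (b1 b2 : nat -> nat) :
  conn V -> hittable e k V -> A \subset V -> S1 \subset A ->
  (forall C, C \in comps (A :\: S1) -> ncomp (V :\: C) <= m1) ->
  (forall r, 1 < r -> wcol_le e r A S1 (b1 r)) ->
  (forall C, C \in comps (A :\: S1) -> [/\ S_ C \subset C,
     forall D, D \in comps (C :\: S_ C) -> ncomp (C :\: D) <= m2 &
     forall r, 1 < r -> wcol_le e r C (S_ C) (b2 r)]) ->
  exists S, [/\ S1 \subset S /\ forall C, C \in comps (A :\: S1) -> S_ C \subset S,
    S \subset A, forall C, C \in comps (A :\: S) -> ncomp (V :\: C) <= 2 &
    forall r, 1 < r -> wcol_le e r A S (b1 r + b2 r + (m1 + m2) * k)].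
Proof.
move=> cV hV sAV sS1 cS1 wS1 HS_; pose S2 := S1 :|: \bigcup_(C in comps (A :\: S1)) S_ C.
have sS_ C : C \in comps (A :\: S1) -> S_ C \subset C by move=> /HS_[].
have sS2 : S2 \subset A.
  rewrite subUset sS1; apply/bigcupsP => C CA; apply: subset_trans (sS_ C CA) _.
  by apply: subset_trans (comps_sub CA) (subsetDl _ _).
have wS2 r : 1 < r -> wcol_le e r A S2 (b1 r + b2 r).
  move=> r1; apply: wcol_le_refine => // [|C CA]; first exact: wS1.
  by have [sC _ wC] := HS_ C CA; split=> //; exact: wC.
have sub C S : C \in comps (A :\: S) -> C \subset V.
  by move=> CA; apply: subset_trans (comps_sub CA) (subset_trans (subsetDl _ _) sAV).
have cS2 D : D \in comps (A :\: S2) -> ncomp (V :\: D) <= m1 + m2.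
  move=> DA; have [C CA DC] := comps_refine eS sS_ DA.
  have [_ HC _] := HS_ C CA.
  have sDC : D \subset C by apply: subset_trans (comps_sub DC) (subsetDl _ _).
  rewrite (setD_trans sDC (sub _ _ CA)).
  apply: leq_trans (ncompU eS _ _) _; rewrite leq_add ?HC //; exact: cS1.
have /choice[Z_ HZ] : forall C, exists Z, C \in comps (A :\: S2) ->
    [/\ Z \subset C, #|Z| <= (m1 + m2) * k & forall D, D \in comps (C :\: Z) -> ncomp (V :\: D) <= 2].
  move=> C; have [CA|] := boolP (C \in comps (A :\: S2)); last by exists set0.
  have pk : packing (set0 : {set {set T}}) C 0.
    by move=> DD; rewrite subset0 => /eqP-> _ _; rewrite cards0.
  have [|Z [sZ cZ _ HZ]] := separate eS cV (sub _ _ CA) (cS2 C CA) pk _ hV.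
    by move=> F; rewrite inE.
  by exists Z.
exists (S2 :|: \bigcup_(C in comps (A :\: S2)) Z_ C); split.
- split=> [|C CA]; first by rewrite -setUA subsetUl.
  apply: subset_trans (subsetUl _ _); apply: subset_trans (subsetUr _ _).
  exact: (bigcup_sup C).
- rewrite subUset sS2; apply/bigcupsP => C CA; have [sZ _ _] := HZ C CA.
  apply: subset_trans sZ _.
  by apply: subset_trans (comps_sub CA) (subsetDl _ _).
- move=> D DA; have [C CA DC] : exists2 C, C \in comps (A :\: S2) & D \in comps (C :\: Z_ C).
    by apply: (comps_refine eS) DA => C /HZ[].
  by have [_ _] := HZ C CA; apply.
move=> r r1; apply: wcol_le_refine => // [|C CA]; first exact: wS2.
have [sZ cZ _] := HZ C CA; split=> //.
exact: wcol_leW cZ (wcol_le_card _ _ _ _).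
Qed.

Lemma conn_bigcup_over (I : finType) (P : pred I) (G : I -> {set T}) A :
  A != set0 -> conn A -> (forall i, P i -> conn (G i) /\ A \subset G i) ->
  conn (A :|: \bigcup_(i | P i) G i).
Proof.
move=> /set0Pn[a aA] cA cG; apply: (@conn_from _ _ eS a); first by rewrite inE aA.
move=> y /setUP[yA|/bigcupP[i Pi yi]].
  by apply: connectS (subsetUl _ _) (connP _ _ cA _ _ aA yA).
have [cGi sA] := cG i Pi.
have sG : G i \subset A :|: \bigcup_(i | P i) G i.
  by apply: subset_trans (subsetUr _ _); exact: (bigcup_sup i).
by apply: connectS sG (connP _ _ cGi _ _ (subsetP sA a aA) yi).
Qed.

Section Trees.
Variables (FF : {set {set T}}) (P : pattern).

Lemma ptree_submodel h d V (B : ptree h.+1 d P -> {set T}) j u :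
  rmodel FF V B -> rmodel FF V (P := ptree h d P) (fun z => B (Some (j, u, z))).
Proof.
move=> [B1 B2 B3]; split=> [x|x y nxy|x y xy]; first exact: B1.
  by apply: B2; apply: contra nxy => /eqP[->].
by apply: B3; rewrite /= !eqxx; move: xy => /= ->.
Qed.

Lemma ptree_cover_conn h d V (B : ptree h d P -> {set T}) :
  rmodel FF V B -> conn (\bigcup_x B x).
Proof.
elim: h B => [|h IH] B mB; have [B1 _ B3] := mB.
  by rewrite (big_pred1 tt) => [|[]]; have [] := B1 tt.
have -> : \bigcup_x B x = B None :|: \bigcup_(p : 'I_d * P) \bigcup_z B (Some (p, z)).
  apply/setP => v; rewrite inE; apply/bigcupP/orP => [[[[p z]|] _ vB]|[vB|]].
  - by right; apply/bigcupP; exists p => //; apply/bigcupP; exists z.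
  - by left.
  - by exists None.
  - by case/bigcupP=> p _ /bigcupP[z _ vB]; exists (Some (p, z)).
apply: conn_bigcup => // [|[j u] _]; first by have [] := B1 None.
split; first exact: IH (ptree_submodel j u mB).
apply: touchS (subxx _) _ (B3 None (Some (j, u, tree_root h d P)) _); last by rewrite /= eqxx.
exact: (bigcup_sup (tree_root h d P)).
Qed.

Lemma disjoint_bigcupr (I : finType) (p : pred I) A (G : I -> {set T}) :
  (forall i, p i -> [disjoint A & G i]) -> [disjoint A & \bigcup_(i | p i) G i].
Proof.
move=> H; apply/pred0P => x /=; apply/negP => /andP[xA /bigcupP[i pi xG]].
by have /pred0P/(_ x)/= := H i pi; rewrite xA xG.
Qed.

Lemma disjoint_setU A B C : [disjoint A & C] -> [disjoint B & C] ->
  [disjoint A :|: B & C].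
Proof. by rewrite -!setI_eq0 setIUl => /eqP-> /eqP->; rewrite setU0. Qed.

Hypothesis HFF : forall F, F \in FF -> F != set0.

Lemma rmodel_neq0 V Q (B : Q -> {set T}) x : rmodel FF V B -> B x != set0.
Proof.
move=> [B1 _ _]; have [_ _ [F /HFF/set0Pn[v vF] sF]] := B1 x.
by apply/set0Pn; exists v; exact: (subsetP sF).
Qed.

(* All blocks below the root that a point of [W] lies in, or is linked to, are
   merged into the root; there remain enough intact blocks. *)
Lemma ptree_reroot h d N C (W : {set T}) (B : ptree h (d + N) P -> {set T}) :
  conn C -> rmodel FF C B -> W \subset C -> #|W| <= N ->
  exists2 B' : ptree h d P -> {set T}, rmodel FF C B' & W \subset B' (tree_root h d P).
Proof.
move=> cC mB sWC WN; have [B1 B2 B3] := mB.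
case: h B mB B1 B2 B3 => [|h] B mB B1 B2 B3.
  exists (fun=> C) => //; split=> [_|[] []|] //; split=> //.
  have [sB _ [F FFF sF]] := B1 tt; exists F => //; exact: subset_trans sB.
pose block j := \bigcup_(u : P) \bigcup_z B (Some (j, u, z)).
pose R0 := B None.
have cR0 : conn R0 by have [] := B1 None.
have R00 : R0 != set0 by exact: rmodel_neq0 mB.
have R0block j : [disjoint R0 & block j].
  by apply: disjoint_bigcupr => u _; apply: disjoint_bigcupr => z _; exact: B2.
have dblock i j : i != j -> [disjoint block i & block j].
  move=> nij; apply: disjoint_bigcupr => u _; apply: disjoint_bigcupr => z _.
  rewrite disjoint_sym; apply: disjoint_bigcupr => v _; apply: disjoint_bigcupr => w _.
  by apply: B2; apply: contra nij => /eqP[->].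
have cblock j : conn (R0 :|: block j).
  apply: conn_bigcup => // u _; split; first exact: ptree_cover_conn (ptree_submodel j u mB).
  apply: touchS (subxx _) _ (B3 None (Some (j, u, tree_root h (d + N) P)) _); last by rewrite /= eqxx.
  exact: (bigcup_sup (tree_root h (d + N) P)).
have sblock j : block j \subset C.
  by apply/bigcupsP => u _; apply/bigcupsP => z _; have [] := B1 (Some (j, u, z)).
have sR0 : R0 \subset C by have [] := B1 None.
pose U0 := R0 :|: \bigcup_j block j.
(* [Q] joins [w] to the root set and meets at most one block: [w] lies in the root set, in a block,
   or in a component [K] outside the model, and [K] touches the root set or a block. *)
have HQ w : w \in C -> exists (Q : {set T}) (J : {set 'I_(d + N)}), [/\ Q \subset C, conn Q /\ R0 \subset Q,
    w \in Q, #|J| <= 1 & forall j, j \notin J -> [disjoint Q & block j]].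
  move=> wC.
  have [wR0|wR0] := boolP (w \in R0).
    by exists R0, set0; rewrite cards0; split.
  have Hj j A : A \subset C -> conn (R0 :|: block j :|: A) -> w \in R0 :|: block j :|: A ->
      (forall i, [disjoint A & block i]) \/ A = set0 ->
      exists (Q : {set T}) (J : {set 'I_(d + N)}), [/\ Q \subset C, conn Q /\ R0 \subset Q,
        w \in Q, #|J| <= 1 & forall j, j \notin J -> [disjoint Q & block j]].
    move=> sA cA wA dA; exists (R0 :|: block j :|: A), [set j]; rewrite cards1; split=> //.
    - by rewrite !subUset sR0 sblock sA.
    - by split=> //; rewrite -setUA subsetUl.
    - move=> i; rewrite inE => nij; apply: disjoint_setU; first by apply: disjoint_setU; rewrite ?dblock 1?eq_sym.
      by case: dA => [//|->]; rewrite -setI_eq0 set0I.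
  have [/bigcupP[j _ wj]|wb] := boolP (w \in \bigcup_j block j).
    by apply: (Hj j set0); rewrite ?sub0set ?setU0 //; [rewrite inE wj orbT|right].
  have wU0 : w \in C :\: U0 by rewrite !inE negb_or wR0 wb.
  have sU0 : U0 \subset C by rewrite subUset sR0; apply/bigcupsP.
  have U00 : U0 != set0.
    by have /set0Pn[x xR] := R00; apply/set0Pn; exists x; rewrite inE xR.
  have KC := mem_comps e wU0; set K := cmp _ w in KC.
  have wK : w \in K by exact: comp_refl.
  have sKC := comps_sub KC; have sK : K \subset C by apply: subset_trans sKC (subsetDl _ _).
  have dK : [disjoint K & U0] by move: sKC; rewrite subsetD => /andP[].
  have dKR : [disjoint K & R0] by apply: disjointWr dK; rewrite subsetUl.
  have dKb j : [disjoint K & block j].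
    apply: disjointWr dK; apply: subset_trans (subsetUr _ _); exact: (bigcup_sup j).
  have /touchP[x [y [xK yU0 exy]]] := comps_touch eS cC sU0 U00 KC.
  have cK := comps_conn eS KC.
  move: yU0; rewrite inE => /orP[yR|/bigcupP[j _ yj]].
    exists (R0 :|: K), set0; rewrite cards0; split=> //.
    - by rewrite subUset sR0.
    - split; last exact: subsetUl.
      by apply: connU_touch => //; rewrite touchC //; apply/touchP; exists x, y.
    - by rewrite in_setU wK orbT.
    - by move=> j _; exact: disjoint_setU.
  apply: (Hj j K) => //; last by left.
    apply: connU_touch => //; rewrite touchC //; apply/touchP; exists x, y.
    by split=> //; rewrite in_setU yj orbT.
  by rewrite in_setU wK orbT.
have /choice[QJ HQJ] : forall w, exists QJ : {set T} * {set 'I_(d + N)}, w \in C ->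
    [/\ QJ.1 \subset C, conn QJ.1 /\ R0 \subset QJ.1, w \in QJ.1, #|QJ.2| <= 1 &
      forall j, j \notin QJ.2 -> [disjoint QJ.1 & block j]].
  move=> w; have [wC|] := boolP (w \in C); last by exists (set0, set0).
  by have [Q [J HQJ]] := HQ w wC; exists (Q, J).
pose J := \bigcup_(w in W) (QJ w).2.
have Jle : #|J| <= N.
  apply: leq_trans WN; rewrite -[X in _ <= X]sum1_card /J.
  apply: (big_rec2 (fun (A : {set 'I_(d + N)}) n => #|A| <= n)) => [|w n A wW An].
    by rewrite cards0.
  apply: leq_trans (leq_card_setU _ _) _; rewrite leq_add //.
  by have [] := HQJ w (subsetP sWC w wW).
have dJ : d <= #|~: J|.
  by rewrite -(leq_add2l #|J|) cardsC card_ord addnC leq_add2l.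
pose iota (i : 'I_d) := enum_val (widen_ord dJ i).
have iotaI : injective iota.
  by move=> i j /enum_val_inj E; apply: ord_inj; have := congr1 val E.
have iotaJ i : iota i \notin J by have := enum_valP (widen_ord dJ i); rewrite inE.
pose R' := R0 :|: \bigcup_(w in W) (QJ w).1.
have [phi [phiI phi0 phiE]] := ptree_mono (leqnn h) (leq_addr N d) (embeds_refl P).
exists (fun x => if x is Some (j, u, z) then B (Some (iota j, u, phi z)) else R'); last first.
  apply/subsetP => w wW; rewrite inE; apply/orP; right; apply/bigcupP; exists w => //.
  by have [] := HQJ w (subsetP sWC w wW).
have R'B i u z : [disjoint R' & B (Some (iota i, u, z))].
  have sB : B (Some (iota i, u, z)) \subset block (iota i).
    by apply: (bigcup_max u) => //; exact: (bigcup_sup z).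
  apply: disjointWr sB _; rewrite disjoint_sym -setI_eq0 setIUr setU_eq0 !setI_eq0.
  rewrite disjoint_sym R0block; apply: disjoint_bigcupr => w wW.
  have [_ _ _ _ H] := HQJ w (subsetP sWC w wW); rewrite disjoint_sym H //.
  by apply: contra (iotaJ i) => wJ; apply/bigcupP; exists w.
split.
- move=> [[[j u] z]|]; first exact: B1.
  split.
  + rewrite subUset sR0; apply/bigcupsP => w wW.
    by have [] := HQJ w (subsetP sWC w wW).
  + apply: conn_bigcup_over => // w wW.
    by have [] := HQJ w (subsetP sWC w wW).
  + have [_ _ [F FFF sF]] := B1 None; exists F => //.
    by apply: subset_trans sF (subsetUl _ _).
- move=> [[[i u] z]|] [[[j v] w]|] // nxy; last by rewrite disjoint_sym.
  by apply: B2; apply: contra nxy => /eqP[/iotaI-> -> /phiI->].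
- move=> [[[i u] z]|] [[[j v] w]|] //= xy.
  + have := B3 (Some (iota i, u, phi z)) (Some (iota j, v, phi w)); apply.
    case/andP: xy => /eqP->; rewrite /= eqxx /= => /orP[/andP[/eqP-> zw]|/and3P[uv /eqP-> /eqP->]].
      by rewrite eqxx; have /= -> := phiE _ _ zw.
    by rewrite uv phi0 eqxx orbT.
  + apply: touchS (subxx _) _ (B3 (Some (iota i, u, phi z)) None _); first exact: subsetUl.
    by rewrite /= (eqP xy) phi0.
  + apply: touchS _ (subxx _) (B3 None (Some (iota j, v, phi w)) _); first exact: subsetUl.
    by rewrite /= (eqP xy) phi0.
Qed.

End Trees.

(* A branch set needs at most one attachment point per neighbour and orientation
   of the edge; rerooting puts these points into the branch set of the root, at
   the cost of [#|apex (copies d P)|.*2] blocks. *)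
Lemma rich_ptreeS FF FF' V P h d : (forall F, F \in FF -> F != set0) ->
  (forall F', F' \in FF' ->
    rich FF F' (ptree h (d + (#|apex (copies d P)|).*2) P)) ->
  rich FF' V (apex (copies d P)) -> rich FF V (ptree h.+1 d P).
Proof.
move=> HFF HFF' [B [B1 B2 B3]].
pose r0 : ptree h (d + (#|apex (copies d P)|).*2) P := tree_root _ _ _.
have /choice[ab Hab] : forall xy, exists p : T * T, pedge xy.1 xy.2 ->
    [/\ p.1 \in B xy.1, p.2 \in B xy.2 & e p.1 p.2].
  move=> [x y] /=; have [xy|nxy] := boolP (pedge x y).
    by have /touchP[a [b Hp]] := B3 x y xy; exists (a, b).
  have /set0Pn[a _] : B x != set0.
    have [_ _ [F' /HFF'[B0 mB0] sF]] := B1 x.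
    have /set0Pn[v vB] := rmodel_neq0 HFF r0 mB0.
    have [sB _ _] := mB0; have [sB' _ _] := sB r0.
    by apply/set0Pn; exists v; apply: (subsetP sF); exact: (subsetP sB').
  by exists (a, a) => xy; case/negP: nxy.
pose W x := [set (ab (x, y)).1 | y in [pred y | pedge x y]] :|:
            [set (ab (y, x)).2 | y in [pred y | pedge y x]].
have sW x : W x \subset B x.
  by rewrite subUset; apply/andP; split; apply/subsetP => _ /imsetP[y yx ->];
    [have [] := Hab (x, y) yx | have [] := Hab (y, x) yx].
have cW x : #|W x| <= (#|apex (copies d P)|).*2.
  rewrite -addnn; apply: leq_trans (leq_card_setU _ _) _.
  by rewrite leq_add // (leq_trans (leq_imset_card _ _)) ?max_card.
have /choice[B' HB'] : forall x, exists B' : ptree h d P -> {set T},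
    rmodel FF (B x) B' /\ W x \subset B' (tree_root h d P).
  move=> x; have [sB cB [F' F'FF' sF']] := B1 x.
  have [B0 mB0] := richS sF' (HFF' F' F'FF').
  by have [B' mB' sB'] := ptree_reroot HFF cB mB0 (sW x) (cW x); exists B'.
have mB' x := proj1 (HB' x); have rB' x := proj2 (HB' x).
have sB' x z : B' x z \subset B x by have [B1' _ _] := mB' x; have [] := B1' z.
have touchroot x y : pedge x y -> touch (B' x (tree_root h d P)) (B' y (tree_root h d P)).
  move=> xy; have [_ _ eab] := Hab (x, y) xy; apply/touchP.
  exists (ab (x, y)).1, (ab (x, y)).2; split=> //.
    by apply: (subsetP (rB' x)); rewrite inE; apply/orP; left; apply/imsetP; exists y.
  by apply: (subsetP (rB' y)); rewrite inE; apply/orP; right; apply/imsetP; exists x.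
exists (fun x => if x is Some (j, u, z) then B' (Some (j, u)) z else B None); split.
- move=> [[[j u] z]|].
    have [B1' _ _] := mB' (Some (j, u)); have [sz cz Fz] := B1' z.
    split=> //; apply: subset_trans sz _; by have [] := B1 (Some (j, u)).
  have [sB cB [F' F'FF' sF']] := B1 None; split=> //.
  have [B0 [B01 _ _]] := HFF' F' F'FF'; have [sB0 _ [F FFF sF]] := B01 r0.
  by exists F => //; apply: subset_trans sF (subset_trans sB0 sF').
- move=> [[[i u] z]|] [[[j v] w]|] // nxy.
  + have [[Ei Eu]|nE] := eqVneq (i, u) (j, v).
      rewrite -Ei -Eu in nxy *; have [_ B2' _] := mB' (Some (i, u)).
      by apply: B2'; apply: contra nxy => /eqP->.
    by apply: disjointW (sB' _ _) (sB' _ _) _; apply: B2; apply: contra nE => /eqP[-> ->].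
  + by apply: disjointWl (sB' _ _) _; apply: B2.
  + by apply: disjointWr (sB' _ _) _; apply: B2.
- have troot (x : copies d P) : touch (B None) (B' (Some x) (tree_root h d P)).
    by apply: touchS (sB' _ _) (subxx _) (touchroot None (Some x) isT).
  move=> [[[i u] z]|] [[[j v] w]|] //=.
  + case/andP=> /eqP-> /orP[/andP[/eqP-> zw]|/and3P[uv /eqP-> /eqP->]].
      by have [_ _ B3'] := mB' (Some (j, v)); exact: B3'.
    by apply: touchroot; rewrite /= eqxx.
  + by move=> /eqP->; rewrite touchC //; exact: troot.
  + by move=> /eqP->; exact: troot.
Qed.

End Solutions.

(** * Nice patterns and the reduction of trees to apex graphs *)

(** The constant is chosen before the set [V] and the family, because the inductions apply niceness
    to components and to derived families. *)
Definition nice (g : nat -> nat) (P : pattern) := exists c, forall (T : finType)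
    (e : rel T) k (V : {set T}) (FF : {set {set T}}),
  symmetric e -> hittable e k V -> conn e V ->
  (forall F, F \in FF -> F != set0 /\ conn e F) ->
  ~ rich e FF V P -> solution e V FF (fun r => c * k * g r).

Lemma nice_embeds g P Q : embeds P Q -> nice g Q -> nice g P.
Proof.
move=> PQ [c Hc]; exists c => T e k V FF eS hV cV HFF nr.
by apply: Hc => //; apply: contra_not nr; exact: rich_embeds.
Qed.

(** The induction on [h] leaves [d] free since rerouting in [rich_ptreeS] consumes blocks. No
    component of [V :\: S1] holds a rich model of the lower tree with its additional blocks, as it
    would be an unhit member of [FF']; so the induction hypothesis applies in each. *)
Lemma nice_ptree g P : (forall r, 1 < r -> 0 < g r) ->
  (forall d, nice g (apex (copies d P))) -> forall h d, nice g (ptree h d P).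
Proof.
move=> g0 Hg; elim=> [|h IH] d.
  (* Height 0 is a single vertex: if [V] contained a member of the family, [V] itself would be a
     rich model, so there is nothing to hit. *)
  exists 0 => T e k V FF eS hV cV HFF nr; exists set0; split.
  - exact: sub0set.
  - move=> F FFF sF; case: nr; exists (fun=> V); split=> [_|[] []|] //.
    by split=> //; exists F.
  - move=> C; rewrite setD0; have [->|V0] := eqVneq V set0; first by rewrite comps0 inE.
    by rewrite comps_full // => /set1P->; rewrite setDv /ncomp comps0 cards0.
  - by move=> r _; exact: wcol_le0.
have [c1 H1] := Hg d; have [c2 H2] := IH (d + (#|apex (copies d P)|).*2).
(* The 4 comes from [refine_fix] with [m1 = m2 = 2]. *)
exists (c1 + c2 + 4) => T e k V FF eS hV cV HFF nr.
have FF0 F : F \in FF -> F != set0 by case/HFF.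
pose FF' := [set C : {set T} | [&& C != set0, conn e C, C \subset V &
  `[< rich e FF C (ptree h (d + (#|apex (copies d P)|).*2) P) >]]].
have [|/(rich_ptreeS eS FF0)H|S1 [sS1 hS1 cS1 wS1]] := H1 T e k V FF' eS hV cV.
- by move=> F; rewrite inE => /and4P[].
- by apply: nr; apply: H => F; rewrite inE => /and4P[_ _ _ /asboolP].
have /choice[S_ HS_] : forall C : {set T}, exists S : {set T}, C \in comps e (V :\: S1) ->
   [/\ S \subset C, forall F, F \in FF -> F \subset C -> F :&: S != set0,
      forall D, D \in comps e (C :\: S) -> ncomp e (C :\: D) <= 2 &
      forall r, 1 < r -> wcol_le e r C S (c2 * k * g r)].
  move=> C; have [CV|] := boolP (C \in comps e (V :\: S1)); last by exists set0.
  have sC1 := comps_sub CV.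
  have sCV : C \subset V by apply: subset_trans sC1 (subsetDl _ _).
  have [|S HS] := H2 T e k C FF eS (hittableS sCV hV) (comps_conn eS CV) HFF; last by exists S.
  move=> rC; have CFF' : C \in FF'.
    by rewrite inE (comps_neq0 CV) (comps_conn eS CV) sCV; apply/asboolP.
  have := hS1 C CFF' sCV; rewrite setI_eq0.
  by move: sC1; rewrite subsetD => /andP[_ ->].
have [|S [[sS1S sS_S] sSV cS wS]] := refine_fix (S_ := S_) (m2 := 2) eS cV hV (subxx _) sS1 cS1 wS1 (b2 := fun r => c2 * k * g r).
  by move=> C /HS_[].
exists S; split=> // [F FFF sFV|r r1].
  have [F0 cF] := HFF F FFF; apply: contraT => /negPn/eqP FS.
  have FS1 : F :&: S1 = set0 by apply/eqP; rewrite -subset0 -FS setIS.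
  have [C CV sFC] := unhit_in_comp sFV F0 cF FS1.
  have [_ /(_ F FFF sFC)/negP[]] := HS_ C CV.
  by rewrite -subset0 -FS setIS // sS_S.
have E : (c1 + c2 + 4) * k * g r = c1 * k * g r + c2 * k * g r + (2 + 2) * k * g r.
  by rewrite -!mulnDl -addnA.
by apply: wcol_leW (wS r r1); rewrite E leq_add2l leq_pmulr ?g0.
Qed.

(** * Excluding a rich star *)

Section Attached.
Variables (T : finType) (e : rel T).
Hypothesis eS : symmetric e.
Implicit Types (A B C D F H K V X Y Z R S : {set T}) (FF DD : {set {set T}}).

Local Notation conn := (conn e).
Local Notation comps := (comps e).
Local Notation touch := (touch e).

Definition attached FF C D := [set H : {set T} |
  [&& H \subset C, conn H, touch D H & [exists F in FF, F \subset H]]].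

Lemma attachedP FF C D H : reflect
  [/\ H \subset C, conn H, touch D H & exists2 F, F \in FF & F \subset H]
  (H \in attached FF C D).
Proof. by rewrite inE; apply: (iffP and4P) => -[-> -> -> /exists_inP]. Qed.

Lemma attached_neq0 FF C D H : H \in attached FF C D -> H != set0 /\ conn H.
Proof.
case/attachedP=> _ cH /touchP[x [y [_ yH _]]] _; split=> //.
by apply/set0Pn; exists y.
Qed.

(* The branch set of the apex consists of [D] and one spare branch set, which
   makes it rich. *)
Lemma rich_apex FF V C D (P Q : pattern) (f : P -> Q) q0 : injective f ->
  (forall x y, pedge x y -> pedge (f x) (f y)) -> (forall x, f x != q0) ->
  D \subset V -> C \subset V -> [disjoint D & C] -> conn D ->
  rich e (attached FF C D) C Q -> rich e FF V (apex P).
Proof.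
move=> fI fE fq0 sD sC dDC cD [B [B1 B2 B3]].
have HB q : [/\ B q \subset V, conn (B q), touch D (B q), [disjoint D & B q] &
    exists2 F, F \in FF & F \subset B q].
  have [sB cB [H /attachedP[_ _ tH [F FFF sF]] sH]] := B1 q; split=> //.
  - exact: subset_trans sC.
  - exact: touchS (subxx _) sH tH.
  - exact: disjointWr sB dDC.
  - by exists F => //; exact: subset_trans sH.
exists (fun x => if x is Some u then B (f u) else D :|: B q0); split.
- move=> [u|]; first by have [? ? _ _ ?] := HB (f u).
  have [sB cB tB _ [F FFF sF]] := HB q0; split.
  + by rewrite subUset sD.
  + exact: connU_touch.
  + by exists F => //; apply: subset_trans sF (subsetUr _ _).
- have H u : [disjoint D :|: B q0 & B (f u)].
    have [_ _ _ dD _] := HB (f u); apply: disjoint_setU => //.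
    by apply: B2; rewrite eq_sym.
  move=> [u|] [v|] // nuv; last by rewrite disjoint_sym.
  by apply: B2; apply: contra nuv => /eqP/fI->.
move=> [u|] [v|] //= uv; first by apply: B3; exact: fE.
have [_ _ tB _ _] := HB (f v); exact: touchS (subsetUl _ _) (subxx _) tB.
Qed.

Lemma rich_edgeless FF V DD n : DD \subset FF -> trivIset DD ->
  (forall F, F \in DD -> F \subset V) -> (forall F, F \in FF -> conn F) ->
  n <= #|DD| -> rich e FF V (edgeless n).
Proof.
move=> sDD tDD sV cF nD; pose B (i : 'I_n) := enum_val (widen_ord nD i).
have BD i : B i \in DD by exact: enum_valP.
exists B; split=> // [i|i j nij].
  have BF := subsetP sDD _ (BD i).
  by split; [exact: sV|exact: cF|exists (B i)].
apply: (trivIsetP tDD) => //; apply: contra nij => /eqP/enum_val_inj E.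
by apply/eqP/ord_inj; have := congr1 val E.
Qed.

(** [V :\: X] consists of [K] and the other components, each of which touches [K]. It gives the
    starting bound of one complementary component. *)
Lemma conn_compl_comp V K X : conn V -> K \subset V -> K != set0 -> conn K ->
  X \in comps (V :\: K) -> conn (V :\: X).
Proof.
move=> cV sK K0 cK XK; have sX : [set X] \subset comps (V :\: K) by rewrite sub1set.
have := conn_with_comps eS [set X] cV sK K0 cK.
have := compl_cover_dirs eS sK sX; rewrite /cover big_set1; set Y := _ :|: _ => E.
suff -> : V :\: X = Y by [].
have sY : Y \subset V.
  rewrite subUset sK; apply/bigcupsP => R /andP[RK _].
  by apply: subset_trans (comps_sub RK) (subsetDl _ _).
by rewrite -E setDDr setDv set0U; apply/setIidPr.
Qed.

End Attached.

Section StarLevels.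
Variables (T : finType) (e : rel T) (k d : nat) (V : {set T}) (FF : {set {set T}}).
Hypotheses (eS : symmetric e) (hV : hittable e k V) (cV : conn e V).
Hypothesis HFF : forall F, F \in FF -> F != set0 /\ conn e F.
Hypothesis noStar : ~ rich e FF V (apex (edgeless d)).
Implicit Types (A B C D F H K X Y Z R S : {set T}) (DD : {set {set T}}).

Local Notation conn := (conn e).
Local Notation cmp := (cmp e).
Local Notation comps := (comps e).
Local Notation ncomp := (ncomp e).
Local Notation touch := (touch e).

(** Of [d + 1] disjoint attached sets, one is merged with [K] into a rich centre and the other [d]
    are the leaves of a star. *)
Lemma packing_attached K X : K \subset V -> conn K -> X \subset V :\: K ->
  packing (attached e FF (V :\: K) K) X d.
Proof.
move=> sK cK sX DD sDD tDD sDX; rewrite leqNgt; apply/negP => dD; apply: noStar.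
have dK : [disjoint K & V :\: K].
  by rewrite -setI_eq0 setIDA setDIl setDv set0I.
apply: (@rich_apex _ e eS FF V (V :\: K) K (edgeless d) (edgeless d.+1)
  (widen_ord (leqnSn d)) ord_max) => //.
- by move=> i j E; apply: ord_inj; have := congr1 val E.
- by move=> i; apply/eqP => /(congr1 val) /= E; have := ltn_ord i; rewrite E ltnn.
- exact: subsetDl.
apply: rich_edgeless sDD tDD _ _ dD => [F /sDX sF|F /attached_neq0[]//].
exact: subset_trans sF sX.
Qed.

(* [K] grows: a small set hits the connected sets that touch [K] and contain a
   member of [FF], and [K] absorbs what it can still reach, together with the
   vertices [S2] of the hitting set that stop it.  As [K] stays connected, a
   packing of size [d + 1] of such sets would be a rich star. *)
Lemma star_levels K : K \subset V -> K != set0 -> conn K ->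
  exists S (lev : T -> nat), [/\ S \subset V :\: K,
    forall F, F \in FF -> F \subset V :\: K -> F :&: S != set0,
    forall C, C \in comps (V :\: K :\: S) -> ncomp (V :\: C) <= 2,
    (forall x y, x \in V :\: K -> y \in K -> e x y -> lev x = 0) /\
      levelled e (V :\: K) S lev &
    forall n, #|[set x in S | lev x == n]| <= d * ((d.*2 + 1) * k)].
Proof.
move: {2}#|V :\: K|.+1 (ltnSn #|V :\: K|) => m; elim: m K => // m IH K Km sK K0 cK.
have [E|VK0] := eqVneq (V :\: K) set0.
  exists set0, (fun=> 0); split=> //.
  - exact: sub0set.
  - move=> F FFF; rewrite E subset0 => /eqP F0; have [] := HFF FFF.
    by rewrite F0 eqxx.
  - by move=> C; rewrite E set0D comps0 inE.
  - by move=> n; rewrite (_ : [set _ in _ | _] = set0) ?cards0 //; apply/setP => x; rewrite !inE.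
set FA := attached e FF (V :\: K) K.
pose alive := [set X in comps (V :\: K) | [exists F in FF, F \subset X]].
have sVK : V :\: K \subset V := subsetDl V K.
have XT X : X \in comps (V :\: K) -> touch K X.
  by move=> XK; rewrite touchC //; exact: comps_touch XK.
(* Live components are themselves disjoint attached sets. *)
have dalive : #|alive| <= d.
  apply: (packing_attached sK cK (subxx _)).
  - apply/subsetP => X; rewrite inE => /andP[XK /exists_inP XF].
    by apply/attachedP; rewrite (comps_sub XK) (comps_conn eS XK) XT.
  - apply/trivIsetP => X Y; rewrite !inE => /andP[XK _] /andP[YK _].
    exact: (comps_disj eS XK YK).
  - by move=> X; rewrite inE => /andP[/comps_sub].
have /choice[Z_ HZ_] : forall X, exists Z : {set T}, X \in alive ->
    [/\ Z \subset X, #|Z| <= (d.*2 + 1) * k,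
        forall H, H \in FA -> H \subset X -> H :&: Z != set0 &
        forall C, C \in comps (X :\: Z) -> ncomp (V :\: C) <= 2].
  move=> X; have [|] := boolP (X \in alive); last by exists set0.
  rewrite inE => /andP[XK _]; have sX := subset_trans (comps_sub XK) sVK.
  (* [V :\: X] is connected, whence [m = 1] and the bound [(d.*2 + 1) * k] per live component. *)
  have [|Z [sZ cZ hZ HZ]] := separate eS cV sX _
    (packing_attached sK cK (comps_sub XK)) (@attached_neq0 _ _ FF (V :\: K) K) hV (m := 1).
    by apply: (ncomp_conn eS); exact: (conn_compl_comp eS cV sK K0 cK XK).
  by exists Z.
pose Z := \bigcup_(X in alive) Z_ X.
have aliveK X : X \in alive -> X \in comps (V :\: K) by rewrite inE => /andP[].
have sZ : Z \subset V :\: K.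
  apply/bigcupsP => X XA; have [sZX _ _ _] := HZ_ X XA.
  exact: subset_trans sZX (comps_sub (aliveK X XA)).
have cZ : #|Z| <= d * ((d.*2 + 1) * k).
  apply: leq_trans (_ : #|alive| * ((d.*2 + 1) * k) <= _); last by rewrite leq_mul2r dalive orbT.
  rewrite -sum_nat_const /Z.
  apply: (big_rec2 (fun (A : {set T}) n => #|A| <= n)) => [|X n A XA An]; first by rewrite cards0.
  apply: leq_trans (leq_card_setU _ _) _; rewrite leq_add //.
  by have [] := HZ_ X XA.
pose U := V :\: K :\: Z.
pose near := [set C in comps U | touch K C].
pose reach := cover near.
have reachP x : x \in U -> x \in reach = touch K (cmp U x).
  move=> xU; apply/bigcupP/idP => [[C]|tx].
    by rewrite inE => /andP[CU tC] xC; rewrite -(comps_comp eS CU xC).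
  by exists (cmp U x); rewrite ?comp_refl // inE mem_comps.
have reachU : reach \subset U.
  by apply/bigcupsP => C; rewrite inE => /andP[/comps_sub].
have sUVK : U \subset V :\: K := subsetDl _ _.
(* Only the vertices of [Z] adjacent to the grown set are kept, so that [K1] is connected. By
   [front], no vertex of [K1] outside [S2] has a neighbour in [V :\: K1]. *)
pose S2 := [set z in Z | touch [set z] (K :|: reach)].
have S2Z : S2 \subset Z by apply/subsetP => z; rewrite inE => /andP[].
pose K1 := K :|: reach :|: S2.
have front x y : x \in V :\: K -> y \in K :|: reach -> e x y -> x \in reach :|: S2.
  move=> xV yKr exy; rewrite inE; have [xZ|xZ] := boolP (x \in Z).
    apply/orP; right; rewrite inE xZ; apply/touchP; exists x, y.
    by rewrite inE eqxx.
  have xU : x \in U by rewrite inE xZ.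
  move: yKr; rewrite inE => /orP[yK|yr].
    rewrite reachP // (_ : touch K _) //; apply/touchP; exists y, x.
    by rewrite comp_refl // eS.
  have yU := subsetP reachU y yr; move: yr; rewrite reachP // => tCy.
  rewrite reachP // (_ : cmp U x = cmp U y) ?tCy //.
  apply: (comp_eq eS xU); apply: (comps_nbr eS (mem_comps e xU) _ yU exy).
  exact: comp_refl.
have sK1 : K1 \subset V.
  rewrite !subUset sK (subset_trans S2Z (subset_trans sZ sVK)) andbT /=.
  exact: subset_trans reachU (subset_trans sUVK sVK).
have sKK1 : K \subset K1 by rewrite /K1 -setUA subsetUl.
have K10 : K1 != set0 by have /set0Pn[x xK] := K0; apply/set0Pn; exists x; exact: (subsetP sKK1).
have cKr : conn (K :|: reach).
  apply: conn_bigcup => // C; rewrite inE => /andP[CU tC].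
  by rewrite (comps_conn eS CU).
have cK1 : conn K1.
  have -> : K1 = K :|: reach :|: \bigcup_(z in S2) [set z].
    congr (_ :|: _); apply/setP => z; apply/idP/bigcupP => [zS|[y yS /set1P->]//].
    by exists z; rewrite ?set11.
  apply: conn_bigcup => // z; rewrite inE => /andP[_ tz].
  by rewrite conn1 touchC.
have ltK1 : #|V :\: K1| < m.
  have nKV : K != V by apply: contraNneq VK0 => ->; rewrite setDv.
  have /touchP[y [x [yK xVK exy]]] := conn_cross cV sK K0 nKV.
  rewrite -ltnS; apply: leq_trans Km; rewrite ltnS; apply: proper_card; apply/properP; split; first exact: setDS.
  exists x => //; rewrite inE negb_and negbK; apply/orP; left.
  have : x \in reach :|: S2 by apply: (front x y) => //; rewrite ?inE ?yK // eS.
  by rewrite /K1 !in_setU => /orP[->|->]; rewrite ?orbT.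
have [S1 [lev1 [sS1 hS1 cS1 [touch1 lev1P] cardS1]]] := IH K1 ltK1 sK1 K10 cK1.
have S1K1 x : x \in S1 -> x \notin K1.
  by move=> /(subsetP sS1); rewrite inE => /andP[].
have S2K1 x : x \in S2 -> x \in K1 by move=> xS; rewrite in_setU xS orbT.
have rK1 x : x \in reach -> x \in K1 by move=> xS; rewrite !in_setU xS orbT.
have S2r x : x \in S2 -> x \notin reach.
  move=> /(subsetP S2Z) xZ; apply/negP => /(subsetP reachU).
  by rewrite inE xZ.
have closed A : conn A -> A \subset V :\: K -> A :&: S2 = set0 -> A :&: reach != set0 ->
    A \subset reach.
  move=> cA sA AS /set0Pn[a /setIP[aA ar]]; apply: contraT => nAr.
  have : touch (A :&: reach) (A :\: (A :&: reach)).
    apply: conn_cross => //; first exact: subsetIl.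
      by apply/set0Pn; exists a; rewrite inE aA.
    by apply: contra nAr => /eqP/setIidPl.
  case/touchP=> x [y [/setIP[xA xr] /setDP[yA]]]; rewrite in_setI yA /= => yr exy.
  have : y \in reach :|: S2.
    by apply: (front y x); rewrite ?(subsetP sA) ?in_setU ?xr ?orbT // eS.
  rewrite in_setU (negPf yr) /= => yS; have /setP/(_ y) := AS.
  by rewrite in_setI yA yS inE.
exists (S2 :|: S1), (fun x => if x \in K1 then 0 else (lev1 x).+1); split.
- rewrite subUset (subset_trans S2Z sZ); apply: subset_trans sS1 _; exact: setDS.
- move=> F FFF sF; have [F0 cF] := HFF FFF; apply: contraT => /negPn/eqP FS.
  have FS2 : F :&: S2 = set0 by apply/eqP; rewrite -subset0 -FS setIS ?subsetUl.
  have [Fr|Fr] := eqVneq (F :&: reach) set0.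
    have sF1 : F \subset V :\: K1.
      apply/subsetP => x xF; have := subsetP sF x xF; rewrite !in_setD => /andP[xK ->].
      rewrite andbT !in_setU !negb_or xK /=; apply/andP; split.
        by apply/negP => xr; have /setP/(_ x) := Fr; rewrite in_setI xF xr inE.
      by apply/negP => xr; have /setP/(_ x) := FS2; rewrite in_setI xF xr inE.
    have := hS1 F FFF sF1; rewrite -subset0 -{1}FS => /negP[]; exact/setIS/subsetUr.
  (* A member inside [reach] would make its component [C] of [U] an attached set, although [C]
     avoids [Z]. *)
  have sFr := closed F cF sF FS2 Fr; have /set0Pn[x xF] := F0.
  have /bigcupP[C] := subsetP sFr x xF; rewrite inE => /andP[CU tC] xC.
  have sFC := comps_max eS CU cF (subset_trans sFr reachU) xF xC.
  have sCU := comps_sub CU; have cC := comps_conn eS CU.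
  have xVK := subsetP sF x xF; have XK := mem_comps e xVK; set X := cmp _ x in XK.
  have sCX : C \subset X by apply: conn_sub_comp => //; exact: subset_trans sUVK.
  have XA : X \in alive.
    by rewrite inE XK; apply/exists_inP; exists F => //; exact: subset_trans sCX.
  have [_ _ hX _] := HZ_ X XA; have CFA : C \in FA.
    by apply/attachedP; rewrite cC tC (subset_trans sCU) //; split=> //; exists F.
  have /set0Pn[z /setIP[zC zZ]] := hX C CFA sCX.
  have := subsetP sCU z zC; rewrite in_setD => /andP[nzZ _].
  by case/negP: nzZ; apply/bigcupP; exists X.
- move=> C CV; have sC := comps_sub CV; have cC := comps_conn eS CV; have C0 := comps_neq0 CV.
  have sCVK : C \subset V :\: K by apply: subset_trans sC (subsetDl _ _).
  have dCS : [disjoint C & S2 :|: S1] by move: sC; rewrite subsetD => /andP[].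
  have CS2 : C :&: S2 = set0.
    by apply/eqP; rewrite setI_eq0; apply: disjointWr dCS; exact: subsetUl.
  have CS1 : [disjoint C & S1] by apply: disjointWr dCS; exact: subsetUr.
  have [Cr|Cr] := eqVneq (C :&: reach) set0.
    apply: cS1; apply: conn_comps => //.
      rewrite subsetD CS1 andbT; apply/subsetP => x xC; have := subsetP sCVK x xC.
      rewrite !in_setD => /andP[xK ->]; rewrite andbT !in_setU !negb_or xK /=; apply/andP; split.
        by apply/negP => xr; have /setP/(_ x) := Cr; rewrite in_setI xC xr inE.
      by apply/negP => xr; have /setP/(_ x) := CS2; rewrite in_setI xC xr inE.
    move=> x y xC yV exy; apply: (comps_nbr eS CV xC _ exy).
    move: yV; rewrite !in_setD in_setU negb_or => /andP[-> /andP[yK1 ->]].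
    rewrite andbT andbT; apply/andP; split; first by apply: contra yK1; exact: S2K1.
    by apply: contra yK1; exact: (subsetP sKK1).
  have sCr := closed C cC sCVK CS2 Cr; have /set0Pn[x xC] := C0.
  have /bigcupP[D] := subsetP sCr x xC; rewrite inE => /andP[DU tD] xD.
  have cD := comps_conn eS DU; have sDU := comps_sub DU.
  have sDr : D \subset reach by apply: (bigcup_sup D); rewrite inE DU.
  have sDVK := subset_trans sDU sUVK.
  have CD : C = D.
    apply/eqP; rewrite eqEsubset (comps_max eS DU cC (subset_trans sCr reachU) xC xD).
    apply: (comps_max eS CV cD _ xD xC); rewrite subsetD sDVK.
    rewrite disjoint_sym; apply: disjoint_setU; apply/pred0P => y /=; apply/negP => /andP[yS /(subsetP sDr) yr].
      by have := S2r y yS; rewrite yr.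
    by have := S1K1 y yS; rewrite rK1.
  have xVK := subsetP sCVK x xC; have XK := mem_comps e xVK; set X := cmp _ x in XK.
  have sDX : D \subset X by apply: conn_sub_comp.
  have ZX y : y \in X -> y \in Z -> X \in alive /\ y \in Z_ X.
    move=> yX /bigcupP[Y YA yZ]; have [sZY _ _ _] := HZ_ Y YA.
    by rewrite (comps_eq eS XK (aliveK Y YA) yX (subsetP sZY y yZ)).
  have [XA|nXA] := boolP (X \in alive).
    have [sZX _ _ HX] := HZ_ X XA; rewrite CD; apply: HX; apply: conn_comps (comps_neq0 DU) cD _.
      rewrite subsetD sDX; apply/pred0P => y /=; apply/negP => /andP[/(subsetP sDU) yU yZ].
      move: yU; rewrite in_setD => /andP[nyZ _].
      by case/negP: nyZ; apply/bigcupP; exists X.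
    move=> u v uD; rewrite in_setD => /andP[vZ vX] euv; apply: (comps_nbr eS DU uD _ euv).
    rewrite in_setD (subsetP (comps_sub XK)) // andbT.
    by apply: contra vZ => /(ZX v vX)[].
  (* [Z] does not meet a dead component [X], so [X] is swallowed whole and its complement is
     connected. *)
  have sXU : X \subset U.
    apply/subsetP => y yX; rewrite in_setD (subsetP (comps_sub XK)) // andbT.
    by apply: contra nXA => /(ZX y yX)[].
  have DX : D = X.
    apply/eqP; rewrite eqEsubset sDX (comps_max eS DU (comps_conn eS XK) sXU _ xD) //.
    exact: comp_refl.
  rewrite CD DX; apply: leq_trans (_ : 1 <= 2) => //; apply: (ncomp_conn eS).
  exact: (conn_compl_comp eS cV sK K0 cK XK).
- have frontK1 x y : x \in V :\: K -> y \in K :|: reach -> e x y -> x \in K1.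
    move=> xV yK exy; have := front x y xV yK exy; rewrite in_setU => /orP[/rK1|/S2K1]//.
  split=> [x y xV yK exy|x y xV yV exy].
    by rewrite (frontK1 x y) // in_setU yK.
  have [yK1|yK1] := boolP (y \in K1); first by rewrite ltn0.
  have yVK1 : y \in V :\: K1 by rewrite in_setD yK1; move: yV; rewrite in_setD => /andP[].
  have [xK1|xK1] := boolP (x \in K1); last first.
    have xVK1 : x \in V :\: K1 by rewrite in_setD xK1; move: xV; rewrite in_setD => /andP[].
    rewrite ltnS => lt; have [-> xS] := lev1P x y xVK1 yVK1 exy lt.
    by rewrite in_setU xS orbT.
  move=> _; rewrite (touch1 y x yVK1 xK1) 1?eS //; split=> //.
  move: (xK1); rewrite [x \in K1]in_setU => /orP[xKr|xS]; last by rewrite in_setU xS.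
  by case/negP: yK1; apply: (frontK1 y x) => //; rewrite eS.
- move=> [|n].
    apply: leq_trans cZ; apply: subset_leq_card; apply: subset_trans S2Z.
    apply/subsetP => x; rewrite inE in_setU => /andP[/orP[//|xS1]].
    by rewrite (negPf (S1K1 x xS1)).
  apply: leq_trans (cardS1 n); apply/subset_leq_card/subsetP => x.
  rewrite inE in_setU => /andP[xS]; case: ifP => // /negP xK1; rewrite eqSS => xn.
  by rewrite inE xn andbT; case/orP: xS => [/S2K1/xK1|].
Qed.

End StarLevels.

Lemma star_arith M k s : 0 < s -> 0 < k ->
  1 + (s.+2.*2).+1 * (M * k) <= (1 + 9 * M) * k * s.
Proof.
move=> s0 k0; have h : (s.+2.*2).+1 <= 9 * s by lia.
apply: (@leq_trans (k * s + 9 * s * (M * k))); last by nia.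
by rewrite leq_add ?muln_gt0 ?k0 // leq_mul2r h orbT.
Qed.

(** The levels grow from one vertex [v], which joins the hitting set and is ranked first at cost 1;
    the 9 absorbs the additive terms of the logarithmic bound. *)
Lemma nice_star d : nice (trunc_log 2) (apex (edgeless d)).
Proof.
exists (1 + 9 * (d * (d.*2 + 1))) => T e k V FF eS hV cV HFF nr.
have [->|V0] := eqVneq V set0.
  exists set0; split=> //.
  - by move=> F /HFF[F0 _]; rewrite subset0 (negPf F0).
  - by move=> C; rewrite set0D comps0 inE.
  - by move=> r r1; apply: wcol_leW (wcol_le0 _ _ _).
have k0 := hittable_gt0 V0 hV; have /set0Pn[v vV] := V0.
have sv : [set v] \subset V by rewrite sub1set.
have v0 : [set v] != set0 by apply/set0Pn; exists v; rewrite inE.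
have [S [lev [sS hS cS [_ levP] cardS]]] := star_levels eS hV cV HFF nr sv v0 (conn1 e v).
exists ([set v] :|: S); split.
- by rewrite subUset sv (subset_trans sS) // subsetDl.
- move=> F FFF sF; have [vF|vF] := boolP (v \in F).
    by apply/set0Pn; exists v; rewrite !inE vF eqxx.
  have /set0Pn[x /setIP[xF xS]] : F :&: S != set0.
    by apply: hS; rewrite // subsetD sF disjoint_sym disjoints1.
  by apply/set0Pn; exists x; rewrite !inE xF xS orbT.
- by move=> C; rewrite -setDDl; exact: cS.
move=> r r1; have r0 : 0 < r := ltnW r1.
have h := wcol_le_log_levels eS levP r0 cardS.
apply: wcol_leW (wcol_leU (wcol_le_card e r V [set v]) h).
rewrite cards1 [d * (_ * k)]mulnA; apply: star_arith => //.
by rewrite trunc_log_gt0.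
Qed.

(** * Excluding a rich apex graph *)

Section ApexLevels.
Variables (T : finType) (e : rel T) (k c : nat) (g : nat -> nat) (V : {set T}).
Variables (FF : {set {set T}}) (P Q : pattern) (f : P -> Q) (q0 : Q).
Hypotheses (eS : symmetric e) (hV : hittable e k V) (cV : conn e V).
Hypothesis HFF : forall F, F \in FF -> F != set0 /\ conn e F.
Hypothesis noApex : ~ rich e FF V (apex P).
Hypotheses (fI : injective f) (fE : forall x y, pedge x y -> pedge (f x) (f y)).
Hypotheses (fq0 : forall x, f x != q0) (g0 : forall r, 1 < r -> 0 < g r).
Hypothesis niceQ : forall (C : {set T}) (FF' : {set {set T}}),
  hittable e k C -> conn e C -> (forall F, F \in FF' -> F != set0 /\ conn e F) ->
  ~ rich e FF' C Q -> solution e C FF' (fun r => c * k * g r).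
Implicit Types (A B C D E F H K X Y Z R S : {set T}) (DD : {set {set T}}).

Local Notation conn := (conn e).
Local Notation cmp := (cmp e).
Local Notation comps := (comps e).
Local Notation ncomp := (ncomp e).
Local Notation touch := (touch e).

Lemma cover_comps A : cover (comps A) = A.
Proof.
apply/setP => x; apply/bigcupP/idP => [[C CA xC]|xA].
  exact: (subsetP (comps_sub CA)).
by exists (cmp A x); rewrite ?mem_comps ?comp_refl.
Qed.

(** The empty set is connected in this sense, so there are always two candidates for the apex,
    possibly empty. *)
Lemma ncomp2 A : ncomp A <= 2 -> exists D1 D2, [/\ conn D1, conn D2 & A = D1 :|: D2].
Proof.
move=> nA; have [A0|[D DA]] := set_0Vmem (comps A).
  by exists set0, set0; rewrite conn0 setU0 -(cover_comps A) A0 /cover big_set0.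
exists D, (cover (comps A :\ D)); split; first exact: comps_conn DA.
  apply: conn_ncomp => //; rewrite /ncomp (comps_cover eS (A := A)) ?subsetDl //.
  by move: nA; rewrite /ncomp (cardsD1 D) DA.
rewrite -[LHS]cover_comps -{1}(setD1K DA) /cover big_setU1 //=.
by rewrite !inE eqxx.
Qed.

(** Neither part [D1], [D2] of the outside of [C] can serve as an apex. So [niceQ] applies to the
    sets attached to [D1], and then, within each remaining component, to those attached to [D2]. *)
Lemma apex_level C : C \subset V -> conn C -> ncomp (V :\: C) <= 2 ->
  exists S, [/\ S \subset C,
    forall D, D \in comps (C :\: S) -> ncomp (V :\: D) <= 2,
    forall F H, F \in FF -> F \subset H -> H \subset C -> conn H ->
      touch H (V :\: C) -> H :&: S != set0 &
    forall r, 1 < r -> wcol_le e r C S ((2 * c + 6) * k * g r)].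
Proof.
move=> sCV cC nC; have [D1 [D2 [cD1 cD2 DE]]] := ncomp2 nC.
have notrich A D : A \subset C -> D \subset V :\: C -> conn D -> ~ rich e (attached e FF A D) A Q.
  move=> sA sD cD rQ; apply: noApex.
  apply: (rich_apex eS fI fE fq0 _ _ _ cD rQ).
  - exact: subset_trans sD (subsetDl _ _).
  - exact: subset_trans sA sCV.
  - move: sD; rewrite subsetD => /andP[_]; exact: disjointWr.
have attP A D := @attached_neq0 _ e FF A D.
have [||||S1 [sS1 hS1 cS1 wS1]] := @niceQ C (attached e FF C D1).
- exact: hittableS hV.
- by [].
- exact: attP.
- by apply: notrich => //; rewrite DE subsetUl.
have /choice[S_ HS_] : forall A, exists S, A \in comps (C :\: S1) ->
    [/\ S \subset A, forall F, F \in attached e FF A D2 -> F \subset A -> F :&: S != set0,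
      forall B, B \in comps (A :\: S) -> ncomp (A :\: B) <= 2 &
      forall r, 1 < r -> wcol_le e r A S (c * k * g r)].
  move=> A; have [AinC|] := boolP (A \in comps (C :\: S1)); last by exists set0.
  have sAC : A \subset C by apply: subset_trans (comps_sub AinC) (subsetDl _ _).
  have [||||S HS] := @niceQ A (attached e FF A D2); last by exists S.
  - exact: hittableS (subset_trans sAC sCV) hV.
  - exact: comps_conn AinC.
  - exact: attP.
  - by apply: notrich => //; rewrite DE subsetUr.
(* The 4 counts two components of [V :\: C] and two of [C :\: A]; the second round contributes 2.
   Together they give the 6 in the bound. *)
have [||S [[sS1S sS_S] sSC cS wS]] := @refine_fix _ e eS V C k S1 S_ 4 2
    (fun r => c * k * g r) (fun r => c * k * g r) cV hV sCV sS1 _ wS1.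
- move=> A AinC; have sAC : A \subset C by apply: subset_trans (comps_sub AinC) (subsetDl _ _).
  rewrite (setD_trans sAC sCV); apply: leq_trans (ncompU eS _ _) _.
  by rewrite (leq_add nC (cS1 A AinC)).
- by move=> A /HS_[].
exists S; split=> //.
- move=> F H FFF sFH sHC cH; rewrite DE => /touchP[x [y [xH yD exy]]].
  have tH D : y \in D -> touch D H.
    by move=> yD'; apply/touchP; exists y, x; rewrite yD' xH eS.
  move: yD; rewrite inE => /orP[yD1|yD2].
    have HA : H \in attached e FF C D1.
      by apply/attachedP; rewrite sHC cH tH //; split=> //; exists F.
    have /set0Pn[z /setIP[zH zS]] := hS1 H HA sHC.
    by apply/set0Pn; exists z; rewrite inE zH (subsetP sS1S).
  have [HS1|/set0Pn[z /setIP[zH zS]]] := eqVneq (H :&: S1) set0; last first.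
    by apply/set0Pn; exists z; rewrite inE zH (subsetP sS1S).
  have H0 : H != set0 by apply/set0Pn; exists x.
  have [A AinC sHA] := unhit_in_comp sHC H0 cH HS1.
  have [_ hA _ _] := HS_ A AinC.
  have HA : H \in attached e FF A D2.
    by apply/attachedP; rewrite sHA cH tH //; split=> //; exists F.
  have /set0Pn[z /setIP[zH zS]] := hA H HA sHA.
  by apply/set0Pn; exists z; rewrite inE zH (subsetP (sS_S A AinC)).
move=> r r1; apply: wcol_leW (wS r r1).
have -> : (2 * c + 6) * k * g r = c * k * g r + c * k * g r + (4 + 2) * k * g r.
  by rewrite -!mulnDl addnn mul2n.
by rewrite leq_add2l leq_pmulr ?g0.
Qed.

Lemma wcol_leS r A B S b : B \subset A -> wcol_le e r A S b -> wcol_le e r B S b.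
Proof.
move=> /subsetP sBA [rho H]; exists rho => u L HL; apply: (H u) => v /HL.
case=> vS [p [uB pp lp sp min]]; split=> //; exists p; split=> //; first exact: sBA.
by apply: sub_path pp => x y /and3P[xB yB exy]; rewrite /erel !sBA.
Qed.

(* Each component of [C - S0] that still contains a member of [FF] is cut off
   from [V - C] by [S0], so the walks of length [r] see at most [r + 1] levels. *)
Lemma apex_levels C : C \subset V -> C != V -> C != set0 -> conn C -> ncomp (V :\: C) <= 2 ->
  exists S (lev : T -> nat), [/\ S \subset C,
    forall F, F \in FF -> F \subset C -> F :&: S != set0,
    forall D, D \in comps (C :\: S) -> ncomp (V :\: D) <= 2,
    (forall x y, x \in C -> y \in V :\: C -> e x y -> lev x = 0) /\
      levelled e C S lev &
    forall r, 1 < r -> forall n, wcol_le e r [set x in C | n <= lev x]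
       [set x in S | lev x == n] ((2 * c + 6) * k * g r)].
Proof.
move: {2}#|C|.+1 (ltnSn #|C|) => m; elim: m C => // m IH C Cm sCV nCV C0 cC nC.
have [S0 [sS0 cS0 hS0 wS0]] := apex_level sCV cC nC.
pose alive D := [exists F in FF, F \subset D].
have subC D : D \in comps (C :\: S0) -> D \subset C.
  by move=> DC; apply: subset_trans (comps_sub DC) (subsetDl _ _).
have disS0 D : D \in comps (C :\: S0) -> D :&: S0 = set0.
  by move=> /comps_sub; rewrite subsetD => /andP[_ d]; apply/eqP; rewrite setI_eq0.
(* A live component touching [V :\: C] would itself be one of the sets hit by [S0]. Hence live
   components are proper subsets of [C], and the recursion ends. *)
have far D x y : D \in comps (C :\: S0) -> alive D -> x \in D -> y \in V :\: C -> ~~ e x y.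
  move=> DC /exists_inP[F FFF sFD] xD yV; apply/negP => exy.
  have tD : touch D (V :\: C) by apply/touchP; exists x, y.
  by have := hS0 F D FFF sFD (subC D DC) (comps_conn eS DC) tD; rewrite disS0 // eqxx.
have aliveC D : D \in comps (C :\: S0) -> alive D -> #|D| < m.
  move=> DC aD; rewrite -ltnS; apply: leq_trans Cm; rewrite ltnS.
  apply/proper_card; rewrite properEneq subC // andbT; apply/eqP => E.
  have /touchP[x [y [xC yV exy]]] := conn_cross cV sCV C0 nCV.
  by rewrite -E in xC; have := far D x y DC aD xC yV; rewrite exy.
have /choice[SL HSL] : forall D, exists SL : {set T} * (T -> nat), D \in comps (C :\: S0) ->
    if alive D then
    [/\ SL.1 \subset D,
    forall F, F \in FF -> F \subset D -> F :&: SL.1 != set0,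
    forall E, E \in comps (D :\: SL.1) -> ncomp (V :\: E) <= 2,
    (forall x y, x \in D -> y \in V :\: D -> e x y -> SL.2 x = 0) /\
      levelled e D SL.1 SL.2 &
    forall r, 1 < r -> forall n, wcol_le e r [set x in D | n <= SL.2 x]
       [set x in SL.1 | SL.2 x == n] ((2 * c + 6) * k * g r)] else SL.1 = set0.
  move=> D; have [DC|] := boolP (D \in comps (C :\: S0)); last by exists (set0, fun=> 0).
  case aD: (alive D); last by exists (set0, fun=> 0).
  have nDV : D != V by apply: contraNneq nCV => DV; rewrite eqEsubset sCV -DV subC.
  have [|S [lev H]] := IH D (aliveC D DC aD) _ nDV (comps_neq0 DC) (comps_conn eS DC) (cS0 D DC).
    exact: subset_trans (subC D DC) sCV.
  by exists (S, lev).
pose S_ D := (SL D).1; pose L_ D := (SL D).2.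
have S_D D : D \in comps (C :\: S0) -> S_ D \subset D.
  by move=> DC; have := HSL D DC; case: ifP => _; [case|rewrite /S_ => ->; exact: sub0set].
pose S1 := \bigcup_(D in comps (C :\: S0)) S_ D.
pose D_ x := cmp (C :\: S0) x.
(* Level 0 consists of [S0], the dead components and all vertices outside [C]; the levels inside
   live components are shifted by one. *)
pose lev x := if (x \in C :\: S0) && alive (D_ x) then (L_ (D_ x) x).+1 else 0.
have levS0 x : x \in S0 -> lev x = 0 by move=> xS; rewrite /lev inE xS.
have levD D x : D \in comps (C :\: S0) -> x \in D ->
    lev x = if alive D then (L_ D x).+1 else 0.
  move=> DC xD; have xC := subsetP (comps_sub DC) x xD.
  by rewrite /lev xC /D_ -(comps_comp eS DC xD).
have SD D x : D \in comps (C :\: S0) -> x \in D -> (x \in S0 :|: S1) = (x \in S_ D).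
  move=> DC xD; have := subsetP (comps_sub DC) x xD; rewrite in_setD => /andP[xS0 _].
  rewrite in_setU (negPf xS0) /=; apply/bigcupP/idP => [[E EC xE]|xS]; last by exists D.
  by rewrite (comps_eq eS DC EC xD (subsetP (S_D E EC) x xE)).
have levpos x : 0 < lev x -> exists2 D, D \in comps (C :\: S0) & alive D /\ x \in D.
  rewrite /lev; case: ifP => // /andP[xC ax] _; exists (D_ x); first exact: mem_comps.
  by split=> //; exact: comp_refl.
exists (S0 :|: S1), lev; split.
- by rewrite subUset sS0; apply/bigcupsP => D DC; exact: subset_trans (S_D D DC) (subC D DC).
- move=> F FFF sFC; have [F0 cF] := HFF FFF.
  have [FS0|/set0Pn[z /setIP[zF zS]]] := eqVneq (F :&: S0) set0; last first.
    by apply/set0Pn; exists z; rewrite in_setI zF in_setU zS.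
  have [D DC sFD] := unhit_in_comp sFC F0 cF FS0.
  have aD : alive D by apply/exists_inP; exists F.
  have := HSL D DC; rewrite aD => -[_ /(_ F FFF sFD)/set0Pn[z /setIP[zF zS]] _ _ _].
  apply/set0Pn; exists z; rewrite in_setI zF in_setU; apply/orP; right.
  by apply/bigcupP; exists D.
- move=> E EC; have [D DC ED] := comps_refine eS S_D EC.
  have := HSL D DC; case: ifP => [_ [_ _ H _ _]|_ S0D]; first exact: H.
  move: ED; rewrite /S_ S0D setD0 comps_full ?(comps_neq0 DC) ?(comps_conn eS DC) //.
  by move=> /set1P->; exact: cS0.
- split=> [x y xC yV exy|x y xC yC exy lt].
    apply/eqP; rewrite -leqn0 leqNgt; apply/negP => /levpos[D DC [aD xD]].
    by have := far D x y DC aD xD yV; rewrite exy.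
  have [D DC [aD yD]] := levpos y (leq_ltn_trans (leq0n _) lt).
  have := HSL D DC; rewrite aD => -[_ _ _ [touchD levP] _].
  (* An edge from [S0] into a live component [D] comes from outside [D], so its end has recursive
     level 0 and total level 1. *)
  have [xS0|xS0] := boolP (x \in S0).
    rewrite in_setU xS0 (levS0 x xS0) (levD D y DC yD) aD; split=> //; congr (_.+1).
    apply: (touchD y x) => //; last by rewrite eS.
    have /setP/(_ x) := disS0 D DC; rewrite !inE xS0 andbT => ->.
    exact: (subsetP sCV).
  have xCS : x \in C :\: S0 by rewrite inE xS0.
  have eyx : e y x by rewrite eS.
  have xD := comps_nbr eS DC yD xCS eyx.
  move: lt; rewrite (SD D x DC xD) (levD D x DC xD) (levD D y DC yD) aD ltnS => lt.
  by have [E xS] := levP x y xD yD exy lt; rewrite /L_ E.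
move=> r r1 [|n].
  apply: (@wcol_le_restrict _ e r _ S0).
    apply/setP => x; rewrite !in_setI; case xR: (x \in [set _ in C | _]); rewrite ?andbF // !andbT.
    rewrite inE; apply/idP/andP => [xS|[xS lx]]; first by rewrite in_setU xS levS0.
    move: xS; rewrite in_setU => /orP[//|/bigcupP[D DC xS]].
    have xD := subsetP (S_D D DC) x xS; move: lx; rewrite (levD D x DC xD).
    by have := HSL D DC; case: ifP => // _ S0D; move: xS; rewrite /S_ S0D inE.
  apply: wcol_leS (wS0 r r1); by apply/subsetP => x; rewrite inE => /andP[].
(* Above level 0 every component stays within one live component, where the recursive bound
   applies. *)
apply: wcol_le_comps => // E EA; have cE := comps_conn eS EA; have sEA := comps_sub EA.
have /set0Pn[x xE] := comps_neq0 EA.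
have := subsetP sEA x xE; rewrite inE => /andP[_ lx].
have [D DC [aD xD]] := levpos x (leq_ltn_trans (leq0n n) lx).
have sEC : E \subset C :\: S0.
  apply/subsetP => y yE; have := subsetP sEA y yE; rewrite inE in_setD => /andP[-> ly].
  by rewrite andbT; apply/negP => /levS0 l0; rewrite l0 in ly.
have sED := comps_max eS DC cE sEC xE xD.
have := HSL D DC; rewrite aD => -[_ _ _ _ /(_ r r1 n) wD].
have sE : E \subset [set y in D | n <= (SL D).2 y].
  apply/subsetP => y yE; have := subsetP sEA y yE; rewrite !inE => /andP[_].
  by rewrite (levD D y DC) ?aD ?(subsetP sED) // ltnS => ->.
apply: wcol_le_restrict (wcol_leS sE wD); apply/setP => y; rewrite !in_setI.
case yE: (y \in E); rewrite ?andbF // !andbT; have yD := subsetP sED y yE.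
by rewrite inE [RHS]inE (SD D y DC yD) (levD D y DC yD) aD eqSS.
Qed.

End ApexLevels.

Lemma apex_arith M k g r : 0 < k -> 0 < g -> 0 < r ->
  1 + r.+1 * (M * k * g) <= (1 + M.*2) * k * (r * g).
Proof.
move=> k0 g0 r0; have kg : 0 < k * g by rewrite muln_gt0 k0.
apply: (@leq_trans (r * (k * g) + r.*2 * (M * (k * g)))); last by nia.
apply: leq_add; first by rewrite muln_gt0 r0.
by rewrite -[M * k * g]mulnA leq_mul2r; apply/orP; right; lia.
Qed.

(** The second copy of [P] in [Q] reserves a vertex outside the first, for the spare branch set that
    makes the apex rich. The levels are built in each component left by a vertex [v], whose outside
    is connected. *)
Lemma nice_apex g (P Q : pattern) : (forall r, 1 < r -> 0 < g r) -> inhabited P ->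
  embeds (psum P P) Q -> nice g Q -> nice (fun r => r * g r) (apex P).
Proof.
move=> g0 [p] [q [qI qE]] [c Hc]; exists (1 + (2 * c + 6).*2) => T e k V FF eS hV cV HFF nr.
have [->|V0] := eqVneq V set0.
  exists set0; split=> //.
  - by move=> F /HFF[F0 _]; rewrite subset0 (negPf F0).
  - by move=> C; rewrite set0D comps0 inE.
  - by move=> r r1; apply: wcol_leW (wcol_le0 _ _ _).
have k0 := hittable_gt0 V0 hV; have /set0Pn[v vV] := V0.
have sv : [set v] \subset V by rewrite sub1set.
have v0 : [set v] != set0 by apply/set0Pn; exists v; rewrite inE.
have /choice[S_ HS_] : forall C : {set T}, exists S : {set T}, C \in comps e (V :\: [set v]) ->
   [/\ S \subset C, forall F, F \in FF -> F \subset C -> F :&: S != set0,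
    forall D, D \in comps e (C :\: S) -> ncomp e (V :\: D) <= 2 &
    forall r, 1 < r -> wcol_le e r C S (r.+1 * ((2 * c + 6) * k * g r))].
  move=> C; have [CV|] := boolP (C \in comps e (V :\: [set v])); last by exists set0.
  have sCv := comps_sub CV; have sCV : C \subset V by apply: subset_trans sCv (subsetDl _ _).
  have nCV : C != V.
    by apply: contraTneq sCv => ->; apply/subsetPn; exists v; rewrite // !inE eqxx.
  have [| | | ||S [lev [sS hS cS [_ levP] wS]]] := @apex_levels T e k c g V FF P Q (q \o inl)
      (q (inr p)) eS hV cV HFF nr _ _ _ g0 _ C sCV nCV (comps_neq0 CV) (comps_conn eS CV) _.
  - by move=> x y /qI[].
  - by move=> x y xy; exact: (qE (inl x) (inl y)).
  - by move=> x; apply/eqP => /qI.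
  - by move=> A FF' hA cA HFF'; exact: Hc.
  - apply: leq_trans (_ : 1 <= 2) => //; apply: (ncomp_conn eS).
    exact: (conn_compl_comp eS cV sv v0 (conn1 e v) CV).
  exists S => _; split=> // r r1; exact: (wcol_le_levels eS levP (wS r r1)).
have S_sub C : C \in comps e (V :\: [set v]) -> S_ C \subset C by move=> /HS_[].
exists ([set v] :|: \bigcup_(C in comps e (V :\: [set v])) S_ C); split.
- rewrite subUset sv; apply/bigcupsP => C CV; apply: subset_trans (S_sub C CV) _.
  by apply: subset_trans (comps_sub CV) (subsetDl _ _).
- move=> F FFF sF; have [F0 cF] := HFF F FFF; have [vF|vF] := boolP (v \in F).
    by apply/set0Pn; exists v; rewrite !inE vF eqxx.
  have Fv : F :&: [set v] = set0 by apply/eqP; rewrite setI_eq0 disjoint_sym disjoints1.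
  have [C CV sFC] := unhit_in_comp sF F0 cF Fv.
  have [_ /(_ F FFF sFC)/set0Pn[x /setIP[xF xS]] _ _] := HS_ C CV.
  apply/set0Pn; exists x; rewrite in_setI xF in_setU; apply/orP; right.
  by apply/bigcupP; exists C.
- move=> D DV; have [C CV DC] := comps_refine eS S_sub DV.
  by have [_ _ H _] := HS_ C CV; exact: H.
move=> r r1.
have h : wcol_le e r V ([set v] :|: \bigcup_(C in comps e (V :\: [set v])) S_ C)
    (1 + r.+1 * ((2 * c + 6) * k * g r)).
  apply: wcol_le_refine => // [|C CV]; first by rewrite -(cards1 v); exact: wcol_le_card.
  by have [sC _ _ wC] := HS_ C CV; split=> //; exact: wC.
apply: wcol_leW h; apply: apex_arith; rewrite ?muln_gt0 ?k0 ?g0 //; exact: ltnW.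
Qed.

(** * Conclusion *)

Lemma nice_le (g g' : nat -> nat) P : (forall r, 1 < r -> g r <= g' r) ->
  nice g P -> nice g' P.
Proof.
move=> gg' [c Hc]; exists c => T e k V FF eS hV cV HFF nr.
apply: solutionW (Hc T e k V FF eS hV cV HFF nr) => r r1.
by rewrite leq_mul2l gg' ?orbT.
Qed.

(** For [t = 0] the copies of an edgeless pattern stay edgeless, and stars give the logarithm. Each
    further step excludes the apex of a pattern one level lower, which multiplies the bound by
    [r]. *)
Lemma nice_universal t P : universal t.+2 P ->
  nice (fun r => r ^ t * trunc_log 2 r) P.
Proof.
have g0 s r : 1 < r -> 0 < r ^ s * trunc_log 2 r.
  by move=> r1; rewrite muln_gt0 expn_gt0 (ltnW r1) trunc_log_gt0.
elim: t P => [|t IH] P tP; inversion tP as [|t' P' h d tP' E1 E2];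
  apply: nice_ptree => [r|d1]; try exact: g0.
  have [Q tQ PQ] := universal_copies d1 tP'; inversion tQ as [n E3 E4|s Q' h' d' tQ' E3 E4].
    apply: (@nice_le (trunc_log 2)) => [r _|]; first by rewrite mul1n.
    by apply: nice_embeds (nice_star n.+1); rewrite E4; exact: embeds_apex.
  by inversion tQ'.
have [Q tQ PQ] := universal_copies d1 tP'.
have [Q2 tQ2 QQ] := universal_sum tQ tQ.
apply: nice_embeds (embeds_apex PQ) _.
apply: (@nice_le (fun r => r * (r ^ t * trunc_log 2 r))) => [r _|].
  by rewrite expnS mulnA.
exact: nice_apex (g0 t) (universal_inhabited tQ) QQ (IH _ tQ2).
Qed.

(** * Translation back to graphs and orderings *)

Section Conversions.
Variables (T : finType) (G : graph T).
Implicit Types (U S : {set T}) (C D F : graph T).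

Lemma subgraph_adj F x y : subgraph F G -> adj F x y -> adj G x y.
Proof. by case/andP=> _ /subsetP; apply. Qed.

Lemma subgraph_conn F : subgraph F G -> connected F ->
  [/\ vset F \subset vset G, vset F != set0 & conn (adj G) (vset F)].
Proof.
move=> sF /connected_conn[F0 /connP cF]; split=> //; first by case/andP: sF.
apply/connP => x y xF yF; apply: connect_sub (cF x y xF yF) => u v /and3P[uF vF uv].
by apply: connect1; rewrite /erel uF vF (subgraph_adj sF uv).
Qed.

(** By maximality a component is the subgraph induced on its vertex set, so components can be
    counted by their vertex sets. *)
Lemma components_delete U D : D \in components (delete G U) ->
  vset D \in comps (adj G) (vset G :\: U) /\ D = induced G (vset D).
Proof.
rewrite inE => /and3P[/andP[sVD sED] cD /forallP maxD].
have GS := @adj_sym _ G.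
have sDG : subgraph D G.
  rewrite /subgraph (subset_trans sVD) ?subsetIl //=.
  by apply: subset_trans sED _; apply/subsetP => a; rewrite inE => /andP[].
have [_ /set0Pn[x xD] cvD] := subgraph_conn sDG cD.
rewrite vset_delete in sVD; have xU := subsetP sVD x xD.
set W := cmp (adj G) (vset G :\: U) x.
have sW : W \subset vset G :\: U := comp_sub _ _ _.
have sDW : vset D \subset W by exact: conn_sub_comp.
have GW : vset G :&: W = W by apply/setIidPr; apply: subset_trans sW (subsetDl _ _).
have E : induced G W = D.
  apply/eqP; apply: (implyP (maxD _)); apply/and3P; split.
  - rewrite /subgraph vset_induced GW sDW /=; apply/subsetP => a aD.
    have := subsetP sED a aD; rewrite !inE => /andP[-> _] /=.
    have /forall_inP/(_ a aD)/andP[_ aV] := graphP D.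
    exact: subset_trans aV sDW.
  - rewrite /subgraph vset_induced vset_delete GW sW /=; apply/subsetP => a.
    rewrite !inE => /andP[-> /= aW]; apply: subset_trans aW _.
    by apply: subset_trans sW _; rewrite setDE subsetIr.
  - by rewrite connected_induced GW comp_conn // andbT; apply/set0Pn; exists x; exact: comp_refl.
have VE : vset D = W by rewrite -E vset_induced.
by rewrite VE; split; [exact: mem_comps|].
Qed.

(** Sorting [S] by [rho] gives a suitable ordering. Ties may be broken arbitrarily, since [v]
    preceding [w] implies [rho v <= rho w]. *)
Lemma wcol_le_wcol r S b : wcol_le (adj G) r (vset G) S b -> wcol r G S <= b.
Proof.
move=> [rho H]; rewrite /wcol.
case: arg_minnP => [|s0 _ min]; first exact: perm_refl.
pose leR x y := rho x <= rho y.
have leRt : transitive leR by move=> y x z; exact: leq_trans.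
have leRr : reflexive leR by move=> x; exact: leqnn.
have leRtot : total leR by move=> x y; exact: leq_total.
pose s := sort leR (enum S).
have sz : size s == #|S| by rewrite size_sort -cardE.
apply: leq_trans (min (Tuple sz) _) _; first by rewrite /ordering /= perm_sort perm_refl.
apply/bigmax_leqP => u uG; apply: (H u) => v; rewrite inE => /asboolP[vS].
case=> p [/and4P[_ pp _ /eqP lp] sp [_ _ minp]]; split=> //; exists p; split=> //.
  elim: p u uG pp {lp sp minp} => //= z p IH u uG /andP[uz pz].
  by have [_ zG _] := adj_vset uz; rewrite /erel uG zG uz /= IH.
move=> w wp wS; apply: (sorted_leq_index leRt leRr (sort_sorted leRtot (enum S))) => //.
- by rewrite mem_sort mem_enum.
- by rewrite mem_sort mem_enum.
- exact: minp.
Qed.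

End Conversions.

Lemma trunc_log_le_log2 (R : realType) r : 1 < r ->
  ((trunc_log 2 r)%:R <= log2 r%:R :> R)%R.
Proof.
move=> r1; have ln2 : (0 < ln 2 :> R)%R by apply: ln_gt0; rewrite Num.Theory.ltr1n.
rewrite /log2 Num.Theory.ler_pdivlMr // GRing.mulrC GRing.mulr_natr -lnXn ?Num.Theory.ltr0n //.
rewrite ler_ln ?Num.Theory.posrE ?Num.Theory.exprn_gt0 ?Num.Theory.ltr0n ?(ltnW r1) //.
by rewrite -GRing.natrX Num.Theory.ler_nat trunc_logP // ltnW.
Qed.

Theorem theorem46 (R : realType) (t : nat) (ht : 2 <= t)
    (U : finType) (X : graph U) (hX : rtd2 X <= t) :
  exists c : int,
    forall (k : int) (T : finType) (G : graph T) (FF : {set graph T}),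
      (tw G < k)%R ->
      (forall F, F \in FF -> subgraph F G /\ connected F) ->
      ~ (exists B : U -> {set T}, rich_model FF X G B) ->
      exists S : {set T},
        [/\ S \subset vset G,
            forall F, F \in FF -> vset F :&: S != set0,
            forall C, C \in components (delete G S) ->
              #|[set D in components (delete G (vset C)) |
                  vset D :&: nbhd G (vset C) != set0]| <= 2 &
            forall r : nat, 2 <= r ->
              ((wcol r G S)%:R <=
                 c%:~R * k%:~R * (r%:R ^+ (t - 2) * log2 r%:R) :> R)%R].
Proof.
case: t ht hX => [|[|t]] // _ hX.
have [P tP [f [fI fE]]] := rtd2_universal (isT : 0 < t.+2) hX.
have [c Hc] := nice_universal tP; exists (Posz c) => k T G FF twk HFF nR.
(* Treewidth is at least -1, so [k] is nonnegative. *)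
have [k' kE] : exists k' : nat, k = Posz k'.
  case: k twk => [n _|n]; first by exists n.
  by rewrite /tw; case: ex_minnP => m _ _; rewrite NegzE; lia.
rewrite {k}kE in twk *; have hG := tw_hittable twk.
have GS := @adj_sym _ G; pose V := vset G.
have FFP F : F \in FF -> [/\ vset F \subset V, vset F != set0 & conn (adj G) (vset F)].
  by move=> /HFF[sF cF]; exact: subgraph_conn.
pose FS := [set vset F | F in FF].
have FSP F : F \in FS -> F != set0 /\ conn (adj G) F.
  by case/imsetP=> F' /FFP[_ F0 cF] ->.
have norich (A : {set T}) : A \subset V -> ~ rich (adj G) FS A P.
  move=> sA [B [B1 B2 B3]]; apply: nR; exists (B \o f); split; first split.
  - move=> x xX; have [sB cB [F /imsetP[F' /FFP[_ F0 _] FE] sF]] := B1 (f x).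
    have sBV := subset_trans sB sA; split=> //.
    rewrite connected_induced (setIidPr sBV) cB andbT.
    by apply: contraNneq F0 => E; rewrite -subset0 -E -FE.
  - move=> x y xX yX nxy; apply: B2; apply: contra nxy => /eqP E.
    by apply/eqP; exact: fI.
  - by move=> x y /fE/B3/touchP[u [v [uB vB uv]]]; exists u, v.
  move=> x xX; have [sB _ [_ /imsetP[F FFF ->] sF]] := B1 (f x); exists F => //.
  have [sFG _] := HFF F FFF; have /andP[sV sE] := sFG.
  rewrite /subgraph vset_induced subsetI sV sF /=; apply/subsetP => a aF.
  rewrite inE (subsetP sE) //=; have /forall_inP/(_ a aF)/andP[_ aV] := graphP F.
  exact: subset_trans aV sF.
(* [G] may be disconnected: each component is solved separately, and no walk joins two of them. *)
have /choice[S_ HS_] : forall A : {set T}, exists S : {set T}, A \in comps (adj G) V ->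
    [/\ S \subset A, forall F, F \in FS -> F \subset A -> F :&: S != set0,
      forall C, C \in comps (adj G) (A :\: S) -> ncomp (adj G) (A :\: C) <= 2 &
      forall r, 1 < r -> wcol_le (adj G) r A S (c * k' * (r ^ t * trunc_log 2 r))].
  move=> A; have [AV|] := boolP (A \in comps (adj G) V); last by exists set0.
  have sA := comps_sub AV.
  have [S HS] := Hc T (adj G) k' A FS GS (hittableS sA hG) (comps_conn GS AV) FSP (norich A sA).
  by exists S.
pose S := \bigcup_(A in comps (adj G) V) S_ A.
have S_sub A : A \in comps (adj G) V -> S_ A \subset A by move=> /HS_[].
have sS : S \subset V.
  by apply/bigcupsP => A AV; apply: subset_trans (S_sub A AV) (comps_sub AV).
exists S; split=> //.
- move=> F FFF; have [sF F0 cF] := FFP F FFF.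
  have [A] := unhit_in_comp (S := set0) sF F0 cF (setI0 _); rewrite setD0 => AV sFA.
  have [_ /(_ (vset F) (imset_f _ FFF) sFA)/set0Pn[x /setIP[xF xS]] _ _] := HS_ A AV.
  by apply/set0Pn; exists x; rewrite inE xF; apply/bigcupP; exists A.
- move=> C /components_delete[CV _].
  have [A AV CA] : exists2 A, A \in comps (adj G) V & vset C \in comps (adj G) (A :\: S_ A).
    have := @comps_refine _ _ GS V set0 S_ (vset C); rewrite setD0 set0U.
    exact.
  have [_ _ /(_ _ CA) n2 _] := HS_ A AV; apply: leq_trans n2.
  have sCA : vset C \subset A by apply: subset_trans (comps_sub CA) (subsetDl _ _).
  rewrite -(card_in_imset (f := @vset T)); last first.
    move=> D1 D2; rewrite !inE => /andP[D1C _] /andP[D2C _] E.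
    have [_ ->] := components_delete (D := D1) (U := vset C) (G := G) ltac:(by rewrite inE).
    have [_ ->] := components_delete (D := D2) (U := vset C) (G := G) ltac:(by rewrite inE).
    by rewrite E.
  apply/subset_leq_card/subsetP => _ /imsetP[D + ->]; rewrite inE => /andP[DC].
  have [DV _] := components_delete DC.
  (* A component of [G - V(C)] containing a neighbour of [C] stays in the component [A] of [G]
     around [C], so it is a component of [A :\: vset C]; the others are not counted in (B). *)
  case/set0Pn=> x; rewrite !inE => /andP[xD /andP[/andP[xC xG] /exists_inP[u uC ux]]].
  have xA : x \in A by apply: (comps_nbr GS AV (subsetP sCA u uC)).
  have sDG : vset D \subset V by apply: subset_trans (comps_sub DV) (subsetDl _ _).
  have sDA := comps_max GS AV (comps_conn GS DV) sDG xD xA.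
  apply: conn_comps (comps_neq0 DV) (comps_conn GS DV) _ => //.
    by rewrite subsetD sDA; have := comps_sub DV; rewrite subsetD => /andP[].
  move=> a b aD; rewrite inE => /andP[bC bA] ab; apply: (comps_nbr GS DV aD _ ab).
  by rewrite inE bC (subsetP (comps_sub AV)).
move=> r r1; rewrite !subSS subn0.
have : wcol r G S <= c * k' * (r ^ t * trunc_log 2 r).
  apply: wcol_le_wcol; apply: wcol_le_comps => // A AV.
  have [sA _ _ /(_ r r1)] := HS_ A AV; apply: wcol_le_restrict.
  apply/setP => x; rewrite !in_setI; case xA: (x \in A); rewrite ?andbF // !andbT.
  apply/idP/bigcupP => [xS|[B BV xS]]; first by exists A.
  by rewrite (comps_eq GS AV BV xA (subsetP (S_sub B BV) x xS)).
rewrite -(Num.Theory.ler_nat R) => /Order.POrderTheory.le_trans; apply.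
rewrite !GRing.natrM GRing.natrX; apply: Num.Theory.ler_wpM2l.
  by rewrite -GRing.natrM Num.Theory.ler0n.
apply: Num.Theory.ler_wpM2l; last exact: trunc_log_le_log2.
by rewrite -GRing.natrX Num.Theory.ler0n.
Qed.
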